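(* Let $R(\omega):L^p_\mu(Y)\to L^p_\sigma(X)$, $\omega\in\Omega^X$, be a random isometry for all $p\in[1,\infty]$. Assume that $h\in\bigcap_{p=1}^\infty L^p_\mu(Y)$ is such that $\sup_{p\ge1}\|h\|_{L^p_\mu(Y)}<\infty$, that $$ E_\sigma\left[\int_{X^{a+1}}\Big|\Delta_{s_0}\cdots\Delta_{s_a}\Big(\prod_{p=0}^a (Rh(s_p))^{l_p}\Big)\Big|\,\sigma(ds_0)\cdots\sigma(ds_a)\right]<\infty $$ for all $a\ge0$ and all integers $l_0,\dots,l_a\ge1$, and that $Rh$ satisfies the cyclic condition $$ D_{t_1}Rh(t_2)\,D_{t_2}Rh(t_3)\cdots D_{t_{k-1}}Rh(t_k)\,D_{t_k}Rh(t_1)=0,\qquad t_1,\dots,t_k\in X, $$ $\pi_\sigma\otimes\sigma^{\otimes k}$-a.e., for all $k\ge2$. Then, under $\pi_\sigma$, $\delta_\sigma(Rh)$ has the same distribution as the compensated Poisson integral $\delta_\mu(h)=\int_Y h(y)(\omega(dy)-\mu(dy))$ of $h$ under $\pi_\mu$.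
   Context: $X$ and $Y$ are $\sigma$-compact metric spaces with their Borel $\sigma$-algebras, equipped with $\sigma$-finite diffuse measures $\sigma$ on $X$ and $\mu$ on $Y$; $L^p_\sigma(X)=L^p(X,\sigma)$, $L^p_\mu(Y)=L^p(Y,\mu)$. $\Omega^X$ is the space of at most countable, locally finite subsets $\omega$ of $X$, identified with the Radon point measures $\omega=\sum_{x\in\omega}\epsilon_x$, where $\epsilon_x$ is the Dirac measure at $x$. $\pi_\sigma$ is the Poisson measure with intensity $\sigma$: the unique probability on $\Omega^X$ under which, for disjoint compact $A_1,\dots,A_n\subset X$, the variables $\omega(A_1),\dots,\omega(A_n)$ are independent $\mathbb{N}$-valued Poisson variables with intensities $\sigma(A_1),\dots,\sigma(A_n)$; $E_\sigma$ is expectation under $\pi_\sigma$. $\Omega^Y,\pi_\mu$ are defined likewise from $(Y,\mu)$. A random isometry $R$ is a family of isometries $R(\omega):L^p_\mu(Y)\to L^p_\sigma(X)$ indexed by $\omega\in\Omega^X$; $Rh$ denotes the process $(\omega,t)\mapsto R(\omega)h(t)=:Rh(t)$ on $\Omega^X\times X$. For a random variable $F:\Omega^X\to\mathbb{R}$ and $x\in X$: $D_xF(\omega)=F(\omega\cup\{x\})-F(\omega)$. For a measurable process $u:\Omega^X\times X\to\mathbb{R}$ (written $u_t(\omega)$) with $E_\sigma[\int_X|u_t|\sigma(dt)]<\infty$, the Skorohod integral is $$\delta_\sigma(u)=\int_X u_t(\omega\setminus\{t\})\,(\omega(dt)-\sigma(dt)).$$ Notation $\Delta$: for measurable processes $v^{(0)},\dots,v^{(n)}$,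 $0\le j\le n$ and $s_0,\dots,s_n\in X$, $$\Delta_{s_0}\cdots\Delta_{s_j}\prod_{p=0}^n v^{(p)}_{s_p}=\sum_{\substack{\Theta_0\cup\cdots\cup\Theta_n=\{s_0,\dots,s_j\}\\ s_0\notin\Theta_0,\dots,s_j\notin\Theta_j}} D_{\Theta_0}v^{(0)}_{s_0}\cdots D_{\Theta_n}v^{(n)}_{s_n},$$ where the sum is over (possibly empty) subsets $\Theta_p\subset\{s_0,\dots,s_j\}$ and $D_\Theta=\prod_{s\in\Theta}D_s$, $D_\emptyset=I$.
   Formalization: The random isometry R(ω) is additionally assumed to map nonnegative functions to nonnegative functions a.e.; without this the claim fails, e.g. for R(ω)f = −f and h an indicator function with 0 < μ(A) < ∞. *)

(* Defs.v *)
From HB Require Import structures.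
From mathcomp Require Import all_boot all_order all_algebra finmap.
From mathcomp Require Import all_classical all_reals all_analysis.
From mathcomp Require Import measurable_realfun.

Set Implicit Arguments.
Unset Strict Implicit.
Unset Printing Implicit Defensive.
Import Order.TTheory GRing.Theory Num.Theory.
Import numFieldNormedType.Exports.

Local Open Scope classical_set_scope.
Local Open Scope ring_scope.

(* The library's measurable types are pointed, so the space is nonempty. *)
HB.mixin Record isBorelMetric (d : measure_display) (R : realType) X
    & Metric R X & Measurable d X := {
  borelE : d.-measurable = <<s [set U : set X | open U] >>
}.

#[short(type="borelMetricType")]
HB.structure Definition BorelMetric (d : measure_display) (R : realType) :=
  {X of Metric R X & Measurable d X & isBorelMetric d R X}.

Definition sigma_compact (X : topologicalType) :=
  exists K : nat -> set X, (forall n, compact (K n)) /\ \bigcup_n K n = setT.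

Section diffuse.
Context d (X : measurableType d) (R : realType).

Definition diffuse (m : {measure set X -> \bar R}) :=
  forall x, m [set x] = 0%E.

End diffuse.

Section same_law.
Context d1 d2 (T1 : measurableType d1) (T2 : measurableType d2).
Context (R : realType) (P : probability T1 R) (Q : probability T2 R).

Definition same_law (F : T1 -> R) (G : T2 -> R) :=
  [/\ measurable_fun setT F, measurable_fun setT G &
      forall B : set R, measurable B -> pushforward P F B = pushforward Q G B].

End same_law.

Section power_measure.
Context d (X : measurableType d) (R : realType).
Variable m : {sigma_finite_measure set X -> \bar R}.
Local Open Scope ereal_scope.

Definition tcons n (z : (X * n.-tuple X)%type) : n.+1.-tuple X := [tuple of z.1 :: z.2].

Lemma measurable_tcons n : measurable_fun setT (@tcons n).
Proof. by apply: measurable_cons. Qed.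

Section step.
Context (n : nat) (mn : {sigma_finite_measure set (n.-tuple X) -> \bar R}).

Definition power_step : set (n.+1.-tuple X) -> \bar R :=
  pushforward (m \x mn) (@tcons n).

Let power_step0 : power_step set0 = 0.
Proof. by rewrite /power_step /pushforward preimage_set0 measure0. Qed.

Let power_step_ge0 A : 0 <= power_step A.
Proof. by rewrite /power_step /pushforward; apply: measure_ge0. Qed.

Let power_step_sigma_additive : semi_sigma_additive power_step.
Proof.
move=> F mF tF mUF; rewrite /power_step /pushforward preimage_bigcup.
have mpre A : measurable A -> measurable (@tcons n @^-1` A).
  by move=> mA; rewrite -[_ @^-1` _]setTI; exact: measurable_tcons.
apply: measure_semi_sigma_additive.
- by move=> k; exact: mpre.
- apply/trivIsetP => /= i j _ _ ij; rewrite -preimage_setI.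
  by move/trivIsetP : tF => /(_ _ _ _ _ ij) ->//; rewrite preimage_set0.
- by rewrite -preimage_bigcup; exact: mpre.
Qed.

HB.instance Definition _ := isMeasure.Build _ _ _ power_step
  power_step0 power_step_ge0 power_step_sigma_additive.

Let power_step_sigma_finite : sigma_finite setT power_step.
Proof.
have /sigma_finiteP[F [FT ndF Foo]] := sigma_finiteT m.
have /sigma_finiteP[G [GT ndG Goo]] := sigma_finiteT mn.
pose uncons (t : n.+1.-tuple X) : (X * n.-tuple X)%type :=
  (thead t, [tuple of behead t]).
have muncons : measurable_fun setT uncons.
  apply/measurable_fun_pairP; split.
    exact: (measurable_tnth ord0).
  exact: measurable_behead.
have tconsK : uncons \o @tcons n = id.
  by apply/funext => -[x t]; congr pair; exact/val_inj.
exists (fun k => uncons @^-1` (F k `*` G k)).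
  rewrite -preimage_bigcup (_ : \bigcup_k _ = setT)// predeqE => -[x y].
  split=> // _.
  have [i _ Fix] : (\bigcup_k F k) x by rewrite -FT.
  have [j _ Gjy] : (\bigcup_k G k) y by rewrite -GT.
  exists (maxn i j) => //; split => /=.
    by move: x Fix; exact/subsetPset/ndF/leq_maxl.
  by move: y Gjy; exact/subsetPset/ndG/leq_maxr.
move=> k; have [? ?] := Foo k; have [? ?] := Goo k; split.
  by rewrite -[_ @^-1` _]setTI; apply: muncons => //; exact: measurableX.
rewrite /power_step /pushforward -comp_preimage tconsK preimage_id.
by rewrite product_measure1E// lte_mul_pinfty// ge0_fin_numE.
Qed.

HB.instance Definition _ :=
  Measure_isSigmaFinite.Build _ _ _ power_step
  power_step_sigma_finite.

End step.

Fixpoint power_measure (n : nat) : {sigma_finite_measure set (n.-tuple X) -> \bar R} :=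
  match n with
  | 0 => \d_([tuple] : 0.-tuple X)
  | n'.+1 => power_step (power_measure n')
  end.

End power_measure.

Section configuration.
Context d (R : realType) (X : borelMetricType d R).

Definition locally_finite (w : set X) :=
  forall x : X, exists2 U : set X, nbhs x U & finite_set (w `&` U).

Record config := Config {
  points :> set X;
  config_countable : countable points;
  config_locally_finite : locally_finite points
}.

Lemma locally_finite0 : locally_finite set0.
Proof. by move=> x; exists setT; [exact: filterT|rewrite set0I]. Qed.

Definition config0 := Config (@countable0 X) locally_finite0.

Lemma countable_add (w : config) x : countable (points w `|` [set x]).
Proof.
rewrite -bigcup2E; apply: bigcup_countable => // -[_|[_|//]] /=.
  exact: config_countable.
exact: countable1.
Qed.

Lemma locally_finite_add (w : config) x : locally_finite (points w `|` [set x]).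
Proof.
move=> y; have [U yU finU] := config_locally_finite w y; exists U => //.
by rewrite setIUl finite_setU; split=> //; exact: finite_setIl.
Qed.

Definition addpt (w : config) (x : X) : config :=
  Config (countable_add w x) (locally_finite_add w x).

Lemma countable_rem (w : config) x : countable (points w `\ x).
Proof.
by apply: sub_countable (config_countable w); apply: subset_card_le;
  exact: subDsetl.
Qed.

Lemma locally_finite_rem (w : config) x : locally_finite (points w `\ x).
Proof.
move=> y; have [U yU finU] := config_locally_finite w y; exists U => //.
by apply: sub_finite_set finU; apply: setSI; exact: subDsetl.
Qed.

Definition rmpt (w : config) (x : X) : config :=
  Config (countable_rem w x) (locally_finite_rem w x).

HB.instance Definition _ := gen_eqMixin config.
HB.instance Definition _ := gen_choiceMixin config.
HB.instance Definition _ := isPointed.Build config config0.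

(* omega(A) for omega = \sum_(x in omega) \d_x, i.e. #(A `&` omega). *)
Definition point_measure (w : config) (A : set X) : \bar R :=
  counting (A `&` points w).

Let point_measure0 w : point_measure w set0 = 0%E.
Proof.
rewrite /point_measure set0I.
exact: (measure0 (counting : {measure set (g_sigma_algebraType [set: set X]) -> \bar R})).
Qed.

Let point_measure_ge0 w A : (0 <= point_measure w A)%E.
Proof. by rewrite /point_measure /counting; case: ifPn; rewrite ?lee_fin ?leey. Qed.

Let point_measure_sigma_additive w : semi_sigma_additive (point_measure w).
Proof.
move=> F mF tF mUF; rewrite /point_measure setI_bigcupl.
have mall (A : set (g_sigma_algebraType [set: set X])) : measurable A.
  exact: sub_sigma_algebra.
apply: (@measure_semi_sigma_additive _ _ _
  (counting : {measure set (g_sigma_algebraType [set: set X]) -> \bar R})) => //.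
exact: trivIset_setIr.
Qed.

HB.instance Definition _ w := isMeasure.Build _ _ _ (point_measure w)
  (point_measure0 w) (point_measure_ge0 w) (@point_measure_sigma_additive w).

(* The sigma-algebra on configurations is generated by the maps
   omega |-> omega(A), for A Borel. *)
Definition config_events : set (set config) :=
  [set E | exists A : set X, measurable A /\
     exists B : set (\bar R), measurable B /\
       E = [set w | B (point_measure w A)]].

HB.instance Definition _ :=
  Measurable.copy config (g_sigma_algebraType config_events).

End configuration.

Section calculus.
Context d (R : realType) (X : borelMetricType d R).

(* A Poisson variable has a finite intensity. The library's poisson_pmf is not
   used because it is not a probability mass function for the rate 0. *)
Definition is_poisson_measure (m : {measure set X -> \bar R})
    (P : probability (config X) R) :=
  (forall A : set X, compact A -> (m A < +oo)%E /\
     forall k : nat, P [set w | point_measure w A = k%:R%:E] =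
       (expR (- fine (m A)) * fine (m A) ^+ k / k`!%:R)%:E) /\
  (forall (n : nat) (A : 'I_n -> set X), (forall i, compact (A i)) ->
     trivIset setT A ->
     forall B : 'I_n -> set (\bar R), (forall i, measurable (B i)) ->
       P [set w | forall i, B i (point_measure w (A i))] =
       (\prod_(i < n) P [set w | B i (point_measure w (A i))])%E).

Definition compensated_integral (m : {measure set X -> \bar R}) (h : X -> R)
    (w : config X) : R :=
  \int[point_measure w]_x h x - \int[m]_x h x.

Definition skorohod (m : {measure set X -> \bar R}) (u : config X -> X -> R)
    (w : config X) : R :=
  \int[point_measure w]_t u (rmpt w t) t - \int[m]_t u (rmpt w t) t.

Definition diffop (x : X) (F : config X -> R) (w : config X) : R :=
  F (addpt w x) - F w.

(* The difference operators commute, so the order of the enumeration is immaterial. *)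
Definition Dset n (s : n.-tuple X) (Theta : {set 'I_n}) :
    (config X -> R) -> config X -> R :=
  foldr (fun i F => diffop (tnth s i) F) ^~ (enum Theta).

(* Delta_{s_0} ... Delta_{s_j} \prod_(p = 0)^n v^(p)_{s_p}, for j <= n. The
   subsets of {s_0, ..., s_j} are given by the sets of their indices, which
   makes a difference only when some points s_i coincide, a null event for a
   diffuse measure. *)
Definition Delta n (j : 'I_n.+1) (v : 'I_n.+1 -> config X -> X -> R)
    (s : n.+1.-tuple X) (w : config X) : R :=
  \sum_(Theta : {ffun 'I_n.+1 -> {set 'I_n.+1}} |
      (\bigcup_p Theta p == [set i : 'I_n.+1 | (i <= j)%N])%SET &&
      [forall i : 'I_n.+1, (i <= j)%N ==> (i \notin Theta i)])
    \prod_(p < n.+1) Dset s (Theta p) (fun w' => v p w' (tnth s p)) w.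

(* D_{t_1} u(t_2) ... D_{t_(k-1)} u(t_k) D_{t_k} u(t_1) = 0 a.e.; ordS is the
   cyclic successor. *)
Definition cyclic_condition (P : probability (config X) R)
    (m : {sigma_finite_measure set X -> \bar R}) (u : config X -> X -> R)
    (k : nat) :=
  {ae (P \x power_measure m k)%E, forall z : config X * k.-tuple X,
    \prod_(i < k) diffop (tnth z.2 i) (fun w => u w (tnth z.2 (ordS i))) z.1 = 0}.

End calculus.

Section isometry.
Context d1 d2 (Y : measurableType d1) (X : measurableType d2) (R : realType).
Variables (mu : {measure set Y -> \bar R}) (sigma : {measure set X -> \bar R}).
Implicit Types (p : \bar R) (U : (Y -> R) -> X -> R).

(* U maps functions to functions; these properties make it induce a linear
   isometry between the spaces of classes modulo a.e. equality. *)
Definition Lp_isometry p U :=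
  [/\ forall f, f \in Lfun mu p -> U f \in Lfun sigma p,
      forall (a : R) f g, f \in Lfun mu p -> g \in Lfun mu p ->
        {ae sigma, forall x, U (fun y => a * f y + g y) x = a * U f x + U g x} &
      forall f, f \in Lfun mu p ->
        ('N[sigma]_p[EFin \o U f] = 'N[mu]_p[EFin \o f])%E].

(* An isometry for all p may change signs: U f = - f is one. The identities
   \int (U h)^k = \int h^k also hold for odd k when U is moreover positive. *)
Definition positive_operator p U :=
  forall f, f \in Lfun mu p -> (forall y, 0 <= f y) ->
    {ae sigma, forall x, 0 <= U f x}.

End isometry.

Section random_isometry.
Context (d1 d2 : measure_display) (R : realType).
Context (Y : borelMetricType d1 R) (X : borelMetricType d2 R).

Definition random_isometry (mu : {measure set Y -> \bar R})
    (sigma : {measure set X -> \bar R}) (p : \bar R)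
    (U : config X -> (Y -> R) -> X -> R) :=
  forall w, Lp_isometry mu sigma p (U w).

End random_isometry.

(* Main.v *)
Require Import Defs.
From HB Require Import structures.
From mathcomp Require Import all_boot all_order all_algebra.
Set Implicit Arguments.
Unset Strict Implicit.
Unset Printing Implicit Defensive.
Import Order.TTheory GRing.Theory Num.Theory.
Local Open Scope ring_scope.

(** Write u w = U w h and let N^+ w and N^- w be the sums over the points t of w
    of the positive and negative parts of u (rmpt w t) t. In an integral over t,
    removing t changes nothing up to a null set, and the isometry together with
    positivity preserves integrals, so that the Skorohod integral of u is N^+ - N^- minus the integral
    of h. It is therefore enough to find the joint law of N^+ and N^-, and for this
    their joint Laplace transform: for all naturals a and b,

      E exp (- (a N^+ + b N^-)) = exp (- \int (1 - exp (- (a h^+ + b h^-)))).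

    The right-hand side does not depend on U. The formula covers the
    deterministic process h on Y as well, whose Skorohod integral is the
    compensated Poisson integral of h, so that the two laws agree.

    Why the transform has this value. Let v = a u^+ + b u^- and
    g w t = 1 - exp (- v (rmpt w t) t). Then exp (- \sum_t v (rmpt w t) t) is the
    product over w of the 1 - g w t, hence the alternating series of the sums of
    g w t_1 ... g w t_n over n-tuples of distinct points of w, divided by n!
    (parity_sum_exp). By the Mecke formula, applied n times (mecke_tuple), the mean
    of such a sum is the integral of the product of the g (w u {t_1, ..., t_n}) t_i
    over w and t_1, ..., t_n. The point is that this integral is c^n
    (correlationE), where c, the integral of 1 - exp (- v w t) over t, is the same
    for all w. The series then sums up to exp (- c) (laplace_functional).

    The value c^n is where the cyclic condition is used. For a subset A of the
    indices let f_p(A) be the value g at t_p in the configuration w to which the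
    t_i with i in A have been added. If each t_i with i in J changed one of the
    other values with index in J when added, one could follow these influences
    until they close up into a cycle, which the cyclic condition excludes. So each
    nonempty J has a member that influences none of the others (no_cycle_sink),
    and this combinatorial property alone implies that the sum over all A of
    (-1)^|A| times the product of the f_p(A) vanishes (alternating_sum_eq0). When
    this identity is integrated, the points not in A integrate to c one by one, so
    that the subsets other than the full one contribute (-1)^|A| c^n by induction
    on n; since the signs add up to 0, the full subset gives c^n too.

    That c depends on h only: the norms of integer orders give the moments of
    the parts of u w, because U maps the parts of h to the parts of U h
    (isometry_pos_moment), and the integral of 1 - exp (- a f) is a series in the
    moments of f (exp_moments).

    Finally the transform at integer points determines the joint law, because
    (1 - exp (- n N)) ^ k with k about n exp (n c) tends to the indicator of N > c
    and is a combination of exponentials (laplace_joint_law). *)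

(** * An alternating sum over subsets *)

Section alternating.
Variables (I : finType).
Implicit Types (A B J S : {set I}).

(** Here f p A stands for the value that a process takes at the p-th point of
    a tuple once the points with indices in A have been added to the
    configuration. Adding the point of a sink i of J changes the value at none
    of the points of J. Only bases B disjoint from J occur, since the cyclic
    condition, which holds almost everywhere only, says nothing about cycles
    through points that are already present. *)
Definition has_sinks (T : eqType) (f : I -> {set I} -> T) :=
  forall J B, J != set0 -> [disjoint J & B] ->
    exists2 i, i \in J & forall p, p \in J -> f p (i |: B) = f p B.

Lemma has_sinks_comp (T T' : eqType) (f : I -> {set I} -> T) (k : I -> T -> T') :
  has_sinks f -> has_sinks (fun p A => k p (f p A)).
Proof.
move=> Hf J B J0 JB; have [i iJ fi] := Hf J B J0 JB.
by exists i => // p pJ; rewrite fi.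
Qed.

Lemma sum_subset_split (R : nmodType) (S J : {set I}) (F : {set I} -> R) :
  S \subset J ->
  \sum_(A in powerset J) F A =
  \sum_(A2 in powerset (J :\: S)) \sum_(A1 in powerset S) F (A2 :|: A1).
Proof.
move=> SJ; rewrite pair_big_dep/=.
rewrite (reindex_onto (fun q : {set I} * {set I} => q.1 :|: q.2)
                      (fun A => (A :\: S, A :&: S))) /=; last first.
  by move=> A _; rewrite setUC setID.
apply: eq_bigl => -[A2 A1] /=; rewrite !powersetE.
apply/andP/andP => [[AJ /eqP[e1 e2]]|[A2J A1S]].
  by split; [rewrite -e1 setSD|rewrite -e2 subsetIr].
have disj : A2 :&: S = set0.
  apply/setP => x; rewrite !inE; apply/negP => /andP[/(subsetP A2J)].
  by rewrite !inE => /andP[/negPf->].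
split.
  by rewrite subUset (subset_trans A1S SJ) (subset_trans A2J (subsetDl _ _)).
apply/eqP; congr pair.
  apply/setP => x; rewrite !inE; have [xS|xS] := boolP (x \in S) => /=.
    by apply/esym/negP => xA; move/setP/(_ x): disj; rewrite !inE xA xS.
  by rewrite orb_idr// => /(subsetP A1S); rewrite (negPf xS).
by rewrite setIUl disj set0U; apply/setIidPl.
Qed.

Lemma prod_one_plus_sign (J : {set I}) (b : I -> bool) :
  \prod_(p in J) (1 + (-1) ^+ b p) =
  2 ^+ #|J| * [forall (p | p \in J), ~~ b p]%:R :> int.
Proof.
have [/forall_inP H|] := boolP [forall (p | p \in J), ~~ b p].
  by rewrite mulr1 -prodr_const; apply: eq_bigr => p /H/negPf ->.
rewrite negb_forall => /existsP[p]; rewrite negb_imply negbK => /andP[pJ bp].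
by rewrite mulr0 (bigD1 p)//= bp expr1 subrr mul0r.
Qed.

Lemma prod_one_plus (J : {set I}) (a : I -> int) :
  \prod_(p in J) (1 + a p) = \sum_(S in powerset J) \prod_(p in S) a p.
Proof.
rewrite big_mkcond/=.
transitivity (\prod_p ((if p \in J then a p else 0) + 1)).
  by apply: eq_bigr => p _; case: ifP; rewrite ?add0r// addrC.
rewrite bigA_distr (bigID (fun S : {set I} => S \subset J))/=.
rewrite [X in _ + X]big1 ?addr0; last first.
  move=> S /subsetPn[p pS pJ]; rewrite (bigD1 p)//= pS (negPf pJ) mul0r//.
apply: eq_big => [S|S SJ]; first by rewrite powersetE.
rewrite [RHS]big_mkcond/=; apply: eq_bigr => p _.
by case: ifP => // /(subsetP SJ) ->.
Qed.

Lemma sign_card_prod (A J : {set I}) : A \subset J ->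
  (-1) ^+ #|A| = \prod_(p in J) (-1) ^+ (p \in A) :> int.
Proof.
move=> AJ; rewrite (bigID [in A])/= [X in _ * X]big1 ?mulr1; last first.
  by move=> p /andP[_ /negPf ->].
rewrite (eq_bigl [in A]); last first.
  by move=> p; rewrite andb_idl// => /(subsetP AJ).
by rewrite (eq_bigr (fun _ => -1)) ?prodr_const// => p ->; rewrite expr1.
Qed.

(** The signed sum over the subcube of the sets between B and B :|: J; its
    faces are the sums with a smaller J and a larger B, which is what the
    induction runs on. *)
Let T (e : I -> {set I} -> bool) (J B : {set I}) : int :=
  \sum_(A in powerset J) (-1) ^+ #|A| * \prod_(p in J) (-1) ^+ (e p (B :|: A)).

(** Divisibility against size. Once the sums over proper faces vanish, the
    expansion of the products of the 1 + sign shows that 2 ^ #|J| divides the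
    signed sum; but a sink makes two of its 2 ^ #|J| terms cancel, so that it
    is smaller than 2 ^ #|J| in absolute value. *)
Let sign_sum_step e (J B : {set I}) : has_sinks e -> J != set0 ->
  [disjoint J & B] ->
  (forall S B', S \proper J -> S != set0 -> [disjoint S & B'] -> T e S B' = 0) ->
  T e J B = 0.
Proof.
move=> He J0 JB IH.
pose eta p A : bool := (p \in A) (+) e p (B :|: A).
have TE : T e J B = \sum_(A in powerset J) \prod_(p in J) (-1) ^+ eta p A.
  apply: eq_bigr => A; rewrite powersetE => AJ.
  rewrite (sign_card_prod AJ) -big_split/=; apply: eq_bigr => p _.
  by rewrite signr_addb.
(* Among the S of the expansion of the products of the 1 + eta, the empty one
   gives 2 ^ #|J|, J itself gives T, and the others give proper faces. *)
have [N TN] : exists N : int, T e J B = 2 ^+ #|J| * N.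
  have : \sum_(A in powerset J) \prod_(p in J) (1 + (-1) ^+ eta p A) =
     2 ^+ #|J| + T e J B :> int.
    under eq_bigr do rewrite prod_one_plus.
    rewrite exchange_big/= (bigD1 set0) ?powersetE ?sub0set//=; congr (_ + _).
      under eq_bigr do rewrite big_set0.
      by rewrite sumr_const card_powerset natrX.
    rewrite (bigD1 J) ?powersetE ?subxx//= -TE [X in _ + X]big1 ?addr0//.
    move=> S /andP[/andP[]]; rewrite powersetE => SJ S0 SneJ.
    rewrite (sum_subset_split _ SJ) big1// => A2; rewrite powersetE => A2J.
    have SA2 : [disjoint S & A2].
      rewrite -setI_eq0; apply/eqP/setP => x; rewrite !inE; apply/negP.
      by move=> /andP[xS /(subsetP A2J)]; rewrite !inE xS.
    rewrite -[RHS](IH S (B :|: A2)) ?properEneq ?SneJ ?SJ//; last first.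
      by rewrite disjoint_sym disjoints_subset subUset -!disjoints_subset ![[disjoint _ & S]]disjoint_sym SA2 (disjointWl SJ).
    apply: eq_bigr => A1; rewrite powersetE => A1S.
    rewrite (sign_card_prod A1S) -big_split/=; apply: eq_bigr => p pS.
    rewrite /eta inE signr_addb setUA; congr ((-1) ^+ _ * _).
    by rewrite (disjointFr SA2 pS).
  under eq_bigr do rewrite prod_one_plus_sign.
  rewrite -big_distrr/=; set N := (X in 2 ^+ _ * X) => H.
  by exists (N - 1); rewrite mulrBr mulr1 H addrC addKr.
have [i iJ ei] := He J B J0 JB.
(* the terms A = set0 and A = [set i] cancel *)
have Tlt : `|T e J B| < 2 ^+ #|J|.
  have i0 : [set i] != set0 by apply/set0Pn; exists i; rewrite inE.
  rewrite TE (bigD1 set0) ?powersetE ?sub0set//= (bigD1 [set i])/=; last first.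
    by rewrite powersetE sub1set iJ.
  rewrite addrA (_ : \prod_(p in J) _ + \prod_(p in J) _ = 0); last first.
    rewrite [\prod_(p in J) _ ^+ eta p set0](bigD1 i iJ)/=.
    rewrite [\prod_(p in J) _ ^+ eta p [set i]](bigD1 i iJ)/=.
    rewrite [X in _ + _ * X](eq_bigr (fun p => (-1) ^+ eta p set0)); last first.
      by move=> p /andP[pJ pi]; rewrite /eta !inE (negPf pi) setU0 setUC ei.
    rewrite -mulrDl /eta !inE eqxx setU0 [B :|: _]setUC ei//=.
    by case: (e i B) => /=; rewrite ?(expr0, expr1, addrN, addNr, mul0r).
  rewrite add0r; apply: le_lt_trans (ler_norm_sum _ _ _) _.
  rewrite (eq_bigr (fun _ => 1)); last first.
    move=> A _; rewrite normr_prod big1// => p _; rewrite normrX normrN1 expr1n//.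
  have -> : 2 ^+ #|J| = \sum_(A in powerset J) 1 :> int.
    by rewrite sumr_const card_powerset natrX.
  rewrite [X in _ < X](bigD1 set0) ?powersetE ?sub0set//= [X in _ < _ + X](bigD1 [set i])/=.
    by rewrite addrA ltrDr.
  by rewrite powersetE sub1set iJ.
move: Tlt; rewrite TN normrM ger0_norm ?exprn_ge0// gtr_pMr ?exprn_gt0//.
by rewrite -[X in _ < X]addr0 ltz1D normr_le0 => /eqP ->; rewrite mulr0.
Qed.

Let sign_sum_eq0 e (J B : {set I}) : has_sinks e -> J != set0 ->
  [disjoint J & B] -> T e J B = 0.
Proof.
move=> He; elim/ltn_ind: {J}#|J| {-2}J (erefl #|J|) B => n IH J cJ B J0 JB.
apply: sign_sum_step => // S B' SJ S0 SB'.
by apply: (IH #|S|) => //; rewrite -cJ proper_card.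
Qed.

(** Reduction to signs: f p A is a combination, over the values taken by f p,
    of the indicators that f p A is that value, and an indicator is half of 1
    plus a sign. Expanding the product leaves signed sums of families of
    signs, which inherit the sinks of f. A value is encoded by a set B at
    which f p takes it, which explains the multiplicity m below; the Boolean
    selects the summand 1 or the sign. *)
Lemma alternating_sum_eq0 (R : numFieldType) (f : I -> {set I} -> R) (J : {set I}) :
  has_sinks f -> J != set0 ->
  \sum_(A in powerset J) (-1) ^+ #|A| * \prod_(p in J) f p A = 0.
Proof.
move=> Hf J0.
pose m p B : R := #|[set B' : {set I} | f p B' == f p B]|%:R.
have m0 p B : m p B != 0.
  rewrite pnatr_eq0 -lt0n; apply/card_gt0P; exists B; rewrite inE//.
pose e (k : I -> {set I} * bool) p A : bool := (k p).2 && (f p A != f p (k p).1).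
have He k : has_sinks (e k).
  exact: (has_sinks_comp (fun p x => (k p).2 && (x != f p (k p).1)) Hf).
have fE p A : f p A = \sum_(q : {set I} * bool)
    (f p q.1 / m p q.1 / 2) * (-1) ^+ (q.2 && (f p A != f p q.1)).
  rewrite -(pair_big predT predT (fun B b =>
    (f p B / m p B / 2) * (-1) ^+ (b && (f p A != f p B))))/=.
  transitivity (\sum_(B | f p B == f p A) f p A / m p A).
    rewrite sumr_const -[RHS]mulr_natr -mulrA.
    set N := (X in _ = _ * (_ * X)); suff -> : N = m p A by rewrite mulVf ?mulr1.
    by congr (_%:R); apply: eq_card => B; rewrite inE.
  rewrite big_mkcond/=; apply: eq_bigr => B _.
  rewrite big_bool/= eq_sym; case: eqVneq => [fAB|_]/=.
    rewrite expr0 -mulrDl mulr1 fAB -splitr.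
    by congr (_ / _); rewrite /m fAB.
  by rewrite expr0 expr1 mulr1 mulrN1 addNr.
under eq_bigr do under eq_bigr do rewrite fE.
under eq_bigr do rewrite (big_distr_big (set0, true))/= big_distrr/=.
rewrite exchange_big/= big1// => k _.
under eq_bigr do rewrite big_split/= mulrCA.
rewrite -big_distrr/=.
suff -> : \sum_(A in powerset J) (-1) ^+ #|A| *
    \prod_(p in J) (-1) ^+ e k p A = 0 :> R by rewrite mulr0.
have := sign_sum_eq0 (He k) J0 (_ : [disjoint J & set0]).
rewrite disjoint_sym disjoints_subset sub0set => /(_ isT) /(congr1 (fun z => z%:~R : R)).
rewrite /T rmorph_sum/= mulr0z => T0; rewrite -[RHS]T0; apply: eq_bigr => A _.
rewrite rmorphM/= rmorph_prod/= rmorphXn/= rmorphN1; congr (_ * _).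
by apply: eq_bigr => p _; rewrite rmorphXn/= rmorphN1 set0U.
Qed.

(** Otherwise every i in J has a successor in J, and iterating the successor
    ends in a cycle. *)
Lemma no_cycle_sink (J : {set I}) (e : rel I) : J != set0 ->
  (forall (k : nat) (c : k.-tuple I), (2 <= k)%N -> uniq c ->
     {subset c <= J} -> ~ (forall i, e (tnth c i) (tnth c (ordS i)))) ->
  exists2 i, i \in J & forall p, p \in J -> p != i -> ~~ e i p.
Proof.
move=> J0 noc.
have [/existsP[i /andP[iJ /forall_inP H]]|] :=
    boolP [exists i, (i \in J) && [forall (p | p \in J), (p != i) ==> ~~ e i p]].
  by exists i => // p pJ; apply/implyP/H.
rewrite negb_exists => /forallP H; exfalso.
have nextP i : i \in J -> exists p, [&& p \in J, p != i & e i p].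
  move=> iJ; have := H i; rewrite iJ/= negb_forall => /existsP[p].
  by rewrite !negb_imply ?negbK/= andbT => Hp; exists p.
pose f i := if [pick p | [&& p \in J, p != i & e i p]] is Some p then p else i.
have fP i : i \in J -> [&& f i \in J, f i != i & e i (f i)].
  by move=> /nextP[p Hp]; rewrite /f; case: pickP => // /(_ p); rewrite Hp.
(* f permutes a minimal nonempty stable set, where its orbits are cycles *)
pose st (K : {set I}) := [&& K != set0, K \subset J & f @: K \subset K].
have stJ : st J.
  by rewrite /st J0 subxx/=; apply/subsetP => _ /imsetP[i /fP/and3P[? _ _] ->].
have [K /minsetP[/and3P[K0 KJ fK] Kmin] _] := minset_exists stJ.
have fKE : f @: K = K.
  apply: Kmin => //; rewrite /st imset_eq0 K0 (subset_trans fK KJ)/=.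
  exact: imsetS.
have injf : {in K &, injective f}.
  by apply/imset_injP; rewrite fKE.
have fin : {in K, forall x, f x \in K} by move=> x xK; rewrite -fKE imset_f.
have [x xK] := set0Pn _ K0.
have itK n : iter n f x \in K by elim: n => //= n; exact: fin.
pose k := order f x.
have itk : iter k f x = x by apply: (iter_order_in fin injf).
have k2 : (2 <= k)%N.
  case E : k itk => [|[|//]].
    by have := orderSpred f x; rewrite -/k E.
  move=> /= fx; have /and3P[_ + _] := fP x (subsetP KJ _ xK).
  by rewrite fx eqxx.
apply: (noc k [tuple iter i f x | i < k]) => //.
- have := orbit_uniq f x; rewrite /orbit -/k.
  have -> // : traject f x k = [tuple iter i f x | i < k].
  apply: (@eq_from_nth _ x); first by rewrite size_traject size_tuple.
  move=> i; rewrite size_traject => ik.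
  by rewrite nth_traject// -[i]/(val (Ordinal ik)) -tnth_nth tnth_mktuple.
- by move=> y /tnthP[i ->]; rewrite tnth_mktuple (subsetP KJ).
- move=> i; rewrite !tnth_mktuple/=.
  have /and3P[_ _] := fP (iter i f x) (subsetP KJ _ (itK i)).
  rewrite -iterS; case: (ltngtP i.+1 k) (ltn_ord i) => // [ik|ik] _.
    by rewrite modn_small.
  by rewrite ik modnn itk.
Qed.

End alternating.

(** For a nonnegative f both sides are sums of nonnegative terms, so that this
    form can be integrated before anything is known to be integrable. *)
Lemma alternating_parity (R : numFieldType) n (f : 'I_n -> {set 'I_n} -> R) (b : bool) :
  has_sinks f -> (0 < n)%N ->
  \sum_(A : {set 'I_n} | odd #|A| == b) \prod_p f p A =
  \sum_(A : {set 'I_n} | odd #|A| != b) \prod_p f p A.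
Proof.
move=> Hf n0; have J0 : [set: 'I_n] != set0.
  by apply/set0Pn; exists (Ordinal n0); rewrite inE.
have := alternating_sum_eq0 Hf J0; rewrite powersetT.
rewrite (eq_bigl predT); last by move=> A; rewrite inE.
rewrite (bigID (fun A : {set 'I_n} => odd #|A| == b))/=.
rewrite (eq_bigr (fun A : {set 'I_n} => (-1) ^+ b * \prod_p f p A)); last first.
  by move=> A /eqP Ab; rewrite -signr_odd Ab; congr (_ * _); apply: eq_bigl => p; rewrite inE.
rewrite [X in _ + X](eq_bigr (fun A : {set 'I_n} => - ((-1) ^+ b * \prod_p f p A))); last first.
  move=> A Ab; rewrite -signr_odd (_ : odd #|A| = ~~ b); last first.
    by case: (odd _) Ab; case: (b).
  rewrite signrN mulNr; congr (- (_ * _)); apply: eq_bigl => p; rewrite inE//.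
rewrite sumrN -!mulr_sumr => /eqP; rewrite subr_eq0 => /eqP/(mulfI _)-> //.
by rewrite signr_eq0.
Qed.

From mathcomp Require Import finmap all_classical all_reals all_analysis.
From mathcomp Require Import measurable_realfun.
From mathcomp Require Import ring lra.
Import numFieldNormedType.Exports.
Local Open Scope classical_set_scope.
Local Open Scope ring_scope.

(** * Borel sets and configurations of a sigma-compact metric space *)

Section borel_metric.
Context d (R : realType) (X : borelMetricType d R).

Lemma open_measurableX (U : set X) : open U -> measurable U.
Proof. by move=> oU; rewrite borelE; exact: sub_sigma_algebra. Qed.

Lemma closed_measurableX (C : set X) : closed C -> measurable C.
Proof.
by move=> cC; rewrite -[C]setCK; apply: measurableC; apply: open_measurableX; exact: closed_openC.
Qed.

Lemma compact_closedX (K : set X) : compact K -> closed K.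
Proof. by apply: compact_closed; exact: metric_hausdorff. Qed.

Lemma compact_measurableX (K : set X) : compact K -> measurable K.
Proof. by move=> /compact_closedX; exact: closed_measurableX. Qed.

Lemma measurable_singleton (x : X) : measurable [set x].
Proof. by apply: compact_measurableX; exact: compact_set1. Qed.

Lemma open_mball (x : X) (e : R) : open [set y : X | mdist x y < e].
Proof.
rewrite openE => y /= xy; rewrite /interior; apply/nbhs_ballP.
exists (e - mdist x y); first by rewrite /= subr_gt0.
move=> z; rewrite ballEmdist/= ltrBrDl => H.
exact: le_lt_trans (metric_triangle x y z) H.
Qed.

Lemma open_mfar (x : X) (e : R) : open [set y : X | e < mdist x y].
Proof.
rewrite openE => y /= xy; rewrite /interior; apply/nbhs_ballP.
exists (mdist x y - e); first by rewrite /= subr_gt0.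
move=> z; rewrite ballEmdist/= ltrBrDr -ltrBrDl => H.
apply: lt_le_trans H _; rewrite lerBlDr (metric_sym y z).
exact: metric_triangle.
Qed.

Lemma closed_mball (x : X) (e : R) : closed [set y : X | mdist x y <= e].
Proof.
rewrite (_ : [set y | _] = ~` [set y | e < mdist x y]).
  by apply: open_closedC; exact: open_mfar.
by apply/seteqP; split => y /=; rewrite leNgt => /negP.
Qed.

Lemma nbhs_mball (x : X) (U : set X) : nbhs x U ->
  exists2 e : R, 0 < e & forall y, mdist x y < e -> U y.
Proof.
by move=> /nbhs_ballP[e /= e0 eU]; exists e => // y xy; apply: eU; rewrite ballEmdist.
Qed.

Hypothesis X_sigma_compact : sigma_compact X.

Lemma compact_exhaustion : exists K : nat -> set X,
  [/\ forall n, compact (K n), nondecreasing_seq K & \bigcup_n K n = setT].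
Proof.
have [K [cK KT]] := X_sigma_compact.
exists (fun n => \big[setU/set0]_(i < n.+1) K i); split.
- by move=> n; exact: bigsetU_compact.
- move=> m n mn; apply/subsetPset => x; rewrite -!bigcup_mkord => -[i /= im Kx].
  by exists i => //=; exact: leq_trans im _.
- by rewrite bigcup_bigsetU_bigcup.
Qed.

(** Finitely many balls of radius 1/(m+1) cover each compact set of an
    exhaustion; their centres are enumerated. *)
Lemma dense_sequence : exists c : nat -> X,
  forall (x : X) (e : R), 0 < e -> exists i, mdist (c i) x < e.
Proof.
have [K [cK _ KT]] := compact_exhaustion.
have cover n m : exists D : {fset X}, forall x, K n x ->
    exists2 y, y \in D & mdist y x < m.+1%:R^-1.
  have := cK n; rewrite compact_cover => /(_ X setT (fun y => [set z | mdist y z < m.+1%:R^-1])).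
  case.
  - by move=> i _; exact: open_mball.
  - by move=> x _; exists x => //=; rewrite mdistxx.
  - by move=> D _ DK; exists D => x /DK[y /= yD xy]; exists y.
have /choice[D HD] : forall nm : nat * nat, exists D : {fset X}, forall x, K nm.1 x ->
    exists2 y, y \in D & mdist y x < nm.2.+1%:R^-1.
  by move=> [n m]; exact: cover.
pose c (k : nat) := oapp (fun q : (nat * nat) * nat => nth point (D q.1) q.2) point (choice.unpickle k).
exists c => x e e0.
have [n _ Knx] : (\bigcup_n K n) x by rewrite KT.
have [m me] : exists m : nat, m.+1%:R^-1 < e.
  have [m] := @ltr_add_invr R 0 e e0; rewrite add0r; by exists m.
have [y yD yx] := HD (n, m) x Knx.
exists (choice.pickle ((n, m), index y (D (n, m)))); rewrite /c choice.pickleK/= nth_index//.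
exact: lt_trans yx me.
Qed.

End borel_metric.

Section config_basics.
Context d (R : realType) (X : borelMetricType d R).
Implicit Types (w : config X) (x : X) (A : set X).

Lemma config_eq w w' : points w = points w' -> w = w'.
Proof.
case: w w' => [p c l] [p' c' l'] /= E; subst p'.
by congr Config; exact: Prop_irrelevance.
Qed.

Lemma addpt_rmpt w x : points w x -> addpt (rmpt w x) x = w.
Proof.
move=> wx; apply: config_eq => /=; apply/seteqP; split=> [y [[]//|->//]|y wy].
by have [->|yx] := pselect (y = x); [right|left].
Qed.

Lemma rmpt_addpt w x : ~ points w x -> rmpt (addpt w x) x = w.
Proof.
move=> wx; apply: config_eq => /=; apply/seteqP; split=> [y [[//|] /[swap]//]|y wy].
by split; [left|move=> yx; apply: wx; rewrite -yx].
Qed.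

Lemma measurable_points w : measurable (points w).
Proof.
apply: countable_measurable; last exact: config_countable.
exact: measurable_singleton.
Qed.

Let cnt : {measure set (g_sigma_algebraType [set: set X]) -> \bar R} := counting.

Let mcnt (A : set (g_sigma_algebraType [set: set X])) : measurable A.
Proof. exact: sub_sigma_algebra. Qed.

Lemma point_measureU w A B : A `&` B = set0 ->
  (point_measure w (A `|` B) = point_measure w A + point_measure w B)%E.
Proof.
move=> AB; rewrite /point_measure setIUl.
by apply: (@measureU _ _ _ cnt) => //; rewrite setIACA AB set0I.
Qed.

Lemma point_measure1 w x : point_measure w [set x] = (\1_(points w) x)%:E.
Proof.
rewrite /point_measure indicE; have [wx|wx] := pselect (points w x).
  rewrite (_ : _ `&` _ = [set x]); last first.
    by apply/seteqP; split => y [] //= ->.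
  by rewrite mem_set// /counting asboolT// fset_set1 cardfs1.
rewrite memNset// (_ : _ `&` _ = set0) ?[LHS](@measure0 _ _ _ cnt)//.
by apply/seteqP; split => y // [] /= ->.
Qed.

Lemma rmpt_measure w x A : points w x ->
  (point_measure w A = point_measure (rmpt w x) A + \d_x A)%E.
Proof.
move=> wx; rewrite -{1}(setUIDK A [set x]) point_measureU; last first.
  by apply/seteqP; split => y // [[_ yx] [_]].
rewrite addeC; congr (_ + _)%E.
  by rewrite /point_measure/= setDE setIAC -setIA -setDE.
rewrite diracE; have [xA|xA] := pselect (A x).
  rewrite (_ : A `&` _ = [set x]); last first.
    by apply/seteqP; split=> [y []//|y ->].
  by rewrite point_measure1 indicE !mem_set.
rewrite (_ : A `&` _ = set0) ?measure0 ?memNset//.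
by apply/seteqP; split => y // [] /[swap] ->.
Qed.

Lemma rmpt_id w x : ~ points w x -> rmpt w x = w.
Proof.
move=> wx; apply: config_eq; apply/seteqP; split => [y []//|y wy]; split => //.
by move=> yx; apply: wx; rewrite -yx.
Qed.

Lemma addpt_id w x : points w x -> addpt w x = w.
Proof.
move=> wx; apply: config_eq; apply/seteqP; split => [y [//|->//]|y wy]; by left.
Qed.

Lemma addpt_measure w x A : ~ points w x ->
  (point_measure (addpt w x) A = point_measure w A + \d_x A)%E.
Proof.
by move=> wx; rewrite (@rmpt_measure _ x) ?rmpt_addpt//; right.
Qed.

Lemma point_measure_gt0 w A :
  (point_measure w A != 0)%E <-> exists2 x, points w x & A x.
Proof.
split=> [|[x wx Ax]].
  rewrite /point_measure; apply: contra_neqP => H.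
  rewrite (_ : _ `&` _ = set0) ?[LHS](@measure0 _ _ _ cnt)//.
  by apply/seteqP; split=> // y [Ay wy]; apply: H; exists y.
rewrite (@rmpt_measure _ x)// diracE mem_set//= gt_eqF//.
by apply: lt_le_trans (leeDr _ _); rewrite ?lte01// measure_ge0.
Qed.

Lemma compact_finite_points w K : compact K -> finite_set (K `&` points w).
Proof.
move=> cK.
have /choice[f Hf] : forall x, exists U : set X, nbhs x U /\ finite_set (points w `&` U).
  by move=> x; have [U] := config_locally_finite w x; exists U.
move: cK; rewrite compact_cover => /(_ X setT (fun x => (f x)°)).
case.
- by move=> i _; exact: open_interior.
- by move=> x _; exists x => //; have [] := Hf x.
move=> D _ DK; apply: (@sub_finite_set _ _ (\bigcup_(x in [set` D]) (points w `&` f x))).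
  move=> x [Kx wx]; have [y yD fyx] := DK _ Kx; exists y => //; split => //.
  exact: interior_subset fyx.
by apply: bigcup_finite => // x _; have [] := Hf x.
Qed.

Lemma compact_point_measure w K : compact K -> (point_measure w K < +oo)%E.
Proof.
move=> /(compact_finite_points w) fK; rewrite /point_measure /counting asboolT//.
exact: ltry.
Qed.

Lemma point_measureC w : point_measure w (~` points w) = 0%E.
Proof.
by apply/eqP; apply: contrapT => /negP/point_measure_gt0[x].
Qed.

Local Open Scope ereal_scope.

Lemma eq_integral_points w (f g : X -> \bar R) :
  measurable_fun setT f -> measurable_fun setT g ->
  (forall x, points w x -> f x = g x) ->
  \int[point_measure w]_x f x = \int[point_measure w]_x g x.
Proof.
move=> mf mg fg; apply: ae_eq_integral => //.
exists (~` points w); split; first by apply: measurableC; exact: measurable_points.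
  exact: point_measureC.
by move=> x /= H wx; apply: H => _; exact: fg.
Qed.

Lemma integral_points_split w x (f : X -> \bar R) :
  measurable_fun setT f -> (forall y, 0 <= f y) -> points w x ->
  \int[point_measure w]_y f y = f x + \int[point_measure (rmpt w x)]_y f y.
Proof.
move=> mf f0 wx.
rewrite (@eq_measure_integral _ _ _ _ (measure_add (point_measure (rmpt w x)) \d_x)); last first.
  by move=> A mA _; rewrite [RHS]measure_addE; exact: rmpt_measure.
rewrite ge0_integral_measure_add// addeC; congr (_ + _).
by rewrite integral_dirac// diracT mul1e.
Qed.

End config_basics.

Section config_measurable.
Context d (R : realType) (X : borelMetricType d R).
Context d' (T : measurableType d').

Lemma measurable_point_measure (A : set X) : measurable A ->
  measurable_fun setT (fun w : config X => point_measure w A).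
Proof.
move=> mA _ B mB; rewrite setTI; apply: sub_sigma_algebra.
by exists A; split => //; exists B; split.
Qed.

Lemma measurable_to_config (f : T -> config X) :
  (forall A : set X, measurable A ->
     measurable_fun setT (fun z => point_measure (f z) A)) ->
  measurable_fun setT f.
Proof.
move=> mf; apply: (@measurability _ _ _ _ _ _ (@config_events d R X)) => //.
move=> _ [_ [A [mA [B [mB ->]]]] <-].
by rewrite setTI; have := mf A mA measurableT B mB; rewrite setTI.
Qed.

End config_measurable.

Section isolated.
Context d (R : realType) (X : borelMetricType d R).

(** A locally finite set is closed, and only finitely many of its points are
    near x. *)
Lemma config_isolated (w : config X) x : ~ points w x ->
  exists2 r : R, 0 < r & forall y, points w y -> r <= mdist x y.
Proof.
move=> wx.
have [U /nbhs_mball[e e0 eU] finU] := config_locally_finite w x.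
have cl : closed (points w `&` U).
  by apply: compact_closedX; exact: finite_compact.
have oC : open (~` (points w `&` U)) by exact: closed_openC.
have /nbhs_mball[r r0 rU] : nbhs x (~` (points w `&` U)).
  by apply: open_nbhs_nbhs; split => // -[].
exists (Num.min e r); first by rewrite lt_min e0.
move=> y wy; rewrite leNgt lt_min; apply/negP => /andP[xe xr].
by apply: (rU _ xr); split => //; exact: eU.
Qed.

End isolated.

Section config_kernel.
Context d (R : realType) (X : borelMetricType d R).
Hypothesis X_sigma_compact : sigma_compact X.
Context d' (T : measurableType d').
Local Open Scope ereal_scope.

Section fixed_map.
Import HBNNSimple.
Variables (f : T -> config X) (mf : measurable_fun setT f).

Definition config_kernel (z : T) : {measure set X -> \bar R} := point_measure (f z).

Let measurable_config_kernel U : measurable U -> measurable_fun setT (config_kernel ^~ U).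
Proof.
by move=> mU; exact: (measurableT_comp (measurable_point_measure mU) mf).
Qed.

HB.instance Definition _ := isKernel.Build _ _ T X R config_kernel measurable_config_kernel.

(** Point measures are finite on compact sets only, so the section is cut
    along a compact exhaustion. *)
Lemma measurable_point_measure_xsection (E : set (T * X)) : measurable E ->
  measurable_fun setT (fun z => point_measure (f z) (xsection E z)).
Proof.
move=> mE.
have [K [cK ndK KT]] := compact_exhaustion X_sigma_compact.
apply: (@emeasurable_fun_cvg _ _ _ setT
    (fun n z => mrestr (config_kernel z) (compact_measurableX (cK n)) (xsection E z))).
- move=> n.
  have H := @measurable_prod_subset_xsection_kernel _ _ T X R config_kernel (K n)
    (compact_measurableX (cK n)).
  apply: (proj2 (H _ E mE)) => z.
  exists (fine (point_measure (f z) (K n)) + 1)%R => B mB.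
  have fin : point_measure (f z) (K n) \is a fin_num.
    by rewrite ge0_fin_numE//; exact: compact_point_measure.
  rewrite EFinD fineK//; apply: (@le_lt_trans _ _ (point_measure (f z) (K n))).
    apply: le_measure; rewrite ?inE//; last exact: compact_measurableX.
    by apply: measurableI => //; exact: compact_measurableX.
  by rewrite lteDl// lte01.
- move=> z _; rewrite [X in _ --> X](_ : _ = point_measure (f z) (\bigcup_n (xsection E z `&` K n))).
    apply: nondecreasing_cvg_mu.
    + move=> n; apply: measurableI; [exact: measurable_xsection|exact: compact_measurableX].
    + apply: bigcupT_measurable => n.
      by apply: measurableI; [exact: measurable_xsection|exact: compact_measurableX].
    + by move=> m n mn; apply/subsetPset; apply: setIS; exact/subsetPset/ndK.
  by rewrite -setI_bigcupr KT setIT.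
Qed.

Lemma measurable_config_integral (F : T * X -> \bar R) :
  measurable_fun setT F -> (forall z, 0 <= F z) ->
  measurable_fun setT (fun z => \int[point_measure (f z)]_x F (z, x)).
Proof.
move=> mF F0; pose F_ := nnsfun_approx measurableT mF.
apply: (@measurable_fun_xsection_integral _ _ T X R F
  (fun z => point_measure (f z) : {measure set X -> \bar R}) F_).
- by move=> a b ab; exact/nd_nnsfun_approx.
- by move=> z; exact/cvg_nnsfun_approx.
- by move=> n r; apply: measurable_point_measure_xsection.
Qed.

End fixed_map.

(** As w is closed, x belongs to w as soon as each radius 1/(n+1) admits a
    ball with centre in a dense sequence that contains x and a point of w;
    this is a countable condition on counts and balls. *)
Lemma measurable_mem_config :
  measurable [set z : config X * X | points z.1 z.2].
Proof.
have [c cP] := dense_sequence X_sigma_compact.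
pose B i n := [set y : X | (mdist (c i) y < n.+1%:R^-1)%R].
have mB i n : measurable (B i n).
  by apply: open_measurableX; exact: open_mball.
rewrite (_ : [set z | _] = \bigcap_n \bigcup_i
    ([set w : config X | point_measure w (B i n) != 0] `*` B i n)); last first.
  apply/seteqP; split=> [[w x] /= wx n _|[w x] /= H].
    have [//|i ix] := cP x (n.+1%:R^-1)%R.
    by exists i => //; split => //=; apply/point_measure_gt0; exists x.
  apply: contrapT => wx.
  have [r r0 Hr] := config_isolated wx.
  have [n ne] : exists n : nat, (n.+1%:R^-1 < r / 2)%R.
    have r20 : (0 < r / 2)%R by rewrite divr_gt0.
    by have [m] := ltr_add_invr r20; rewrite add0r; exists m.
  have [i _ [/= /point_measure_gt0[y wy By] Bx]] := H n I.
  have := Hr y wy; rewrite leNgt => /negP; apply.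
  apply: le_lt_trans (metric_triangle x (c i) y) _.
  rewrite (splitr r) (metric_sym x); apply: ltrD; exact: lt_trans ne.
apply: bigcapT_measurable => n; apply: bigcupT_measurable => i.
apply: measurableX => //.
have := measurable_point_measure (mB i n) measurableT (measurableC (emeasurable_set1 0)).
rewrite setTI; congr measurable; apply/seteqP; split=> w /=; first by move/eqP.
by move/eqP.
Qed.

Lemma measurable_indic_mem :
  measurable_fun setT (fun z : config X * X => (\1_(points z.1) z.2)%:E : \bar R).
Proof.
apply/measurable_EFinP.
have := measurable_indic measurable_mem_config (R:=R) (D:=setT).
by congr measurable_fun; apply/funext => -[w x]; rewrite /= !indicE.
Qed.

End config_kernel.

(** * Void events generate the events of configurations *)

Section config_maps.
Context d (R : realType) (X : borelMetricType d R).
Hypothesis X_sigma_compact : sigma_compact X.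
Context d' (T : measurableType d').
Variables (f : T -> config X) (g : T -> X).
Hypotheses (mf : measurable_fun setT f) (mg : measurable_fun setT g).
Local Open Scope ereal_scope.

Let mem := fun z => (\1_(points (f z)) (g z))%R : R.

Let mmem : measurable_fun setT (fun z => (mem z)%:E).
Proof.
have mfg : measurable_fun setT (fun z => (f z, g z)) by exact: measurable_fun_pair.
exact: (measurableT_comp (measurable_indic_mem X_sigma_compact) mfg).
Qed.

Let mdirac (A : set X) : measurable A -> measurable_fun setT (fun z => \d_(g z) A : \bar R).
Proof.
move=> mA; apply/measurable_EFinP.
by apply: (measurableT_comp _ mg); exact: measurable_indic.
Qed.

(** Removing a point subtracts from a count the product of the indicator of
    membership and of a Dirac mass, both jointly measurable. *)
Lemma measurable_rmpt : measurable_fun setT (fun z => rmpt (f z) (g z)).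
Proof.
apply: measurable_to_config => A mA.
have -> : (fun z => point_measure (rmpt (f z) (g z)) A) =
    (fun z => point_measure (f z) A - (mem z)%:E * \d_(g z) A).
  apply/funext => z; rewrite /mem indicE.
  have [H|H] := pselect (points (f z) (g z)).
    by rewrite mem_set// mul1e (rmpt_measure _ H) addeK.
  by rewrite memNset// mul0e sube0 rmpt_id.
apply: emeasurable_funB; last by apply: emeasurable_funM => //; exact: mdirac.
exact: (measurableT_comp (measurable_point_measure mA) mf).
Qed.

Lemma measurable_addpt : measurable_fun setT (fun z => addpt (f z) (g z)).
Proof.
apply: measurable_to_config => A mA.
have -> : (fun z => point_measure (addpt (f z) (g z)) A) =
    (fun z => point_measure (f z) A + (1 - (mem z)%:E) * \d_(g z) A).
  apply/funext => z; rewrite /mem indicE.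
  have [H|H] := pselect (points (f z) (g z)).
    by rewrite mem_set// subee// mul0e adde0 addpt_id.
  by rewrite memNset// sube0 mul1e addpt_measure.
apply: emeasurable_funD; last first.
  by apply: emeasurable_funM; [exact: emeasurable_funB|exact: mdirac].
exact: (measurableT_comp (measurable_point_measure mA) mf).
Qed.

End config_maps.

Section void_events.
Context d (R : realType) (X : borelMetricType d R).
Hypothesis X_sigma_compact : sigma_compact X.
Local Open Scope ereal_scope.

Definition void_event (C : set X) : set (config X) := [set w | point_measure w C = 0].

(** The events that determine the law of a point process (Renyi). They are
    preferred to events on counts because the effect of the removal of a point
    on them is explicit. *)
Definition void_events : set (set (config X)) :=
  [set E | exists C, compact C /\ E = void_event C].

Lemma void_eventP C w : void_event C w <-> forall x, C x -> ~ points w x.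
Proof.
rewrite /void_event /=; split=> [w0 x Cx wx|H].
  have : point_measure w C != 0 by apply/point_measure_gt0; exists x.
  by rewrite w0 eqxx.
by apply/eqP; apply: contrapT => /negP/point_measure_gt0[x wx Cx]; exact: (H x).
Qed.

Let T := g_sigma_algebraType void_events.
Let pm (A : set X) : T -> \bar R := fun w => point_measure (w : config X) A.

Let measurable_hit C : compact C -> measurable ([set w | pm C w != 0] : set T).
Proof.
move=> cC; rewrite (_ : [set w | _] = ~` (void_event C : set T)).
  by apply: measurableC; apply: sub_sigma_algebra; exists C.
by apply/seteqP; split => w /=; [move/eqP|move=> H; apply/eqP].
Qed.

(** C contains at least k + 1 points of w if and only if a small ball of a
    countable family contains a point of w in C while k points of w in C lie
    outside the ball of twice the radius. This gives an induction on k in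
    which only compact sets occur. *)
Let measurable_count k C : compact C -> measurable ([set w | k%:R%:E <= pm C w] : set T).
Proof.
have [c cP] := dense_sequence X_sigma_compact.
elim: k C => [|k IH] C cC.
  rewrite (_ : [set w | _] = setT)//.
  by apply/seteqP; split => w //= _; exact: measure_ge0.
pose B (q : nat * nat) := [set y : X | (mdist (c q.1) y <= q.2.+1%:R^-1)%R].
pose F (q : nat * nat) := [set y : X | (q.2.+1%:R^-1 < mdist (c q.1) y)%R].
pose F' (q : nat * nat) := [set y : X | (2 * q.2.+1%:R^-1 <= mdist (c q.1) y)%R].
have cF' q : closed (F' q).
  rewrite (_ : F' q = ~` [set y | (mdist (c q.1) y < 2 * q.2.+1%:R^-1)%R]).
    by apply: open_closedC; exact: open_mball.
  by apply/seteqP; split => y; rewrite /F' /= leNgt => /negP.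
rewrite (_ : [set w | _] = \bigcup_q ([set w | pm (C `&` B q) w != 0] `&`
    [set w | k%:R%:E <= pm (C `&` F' q) w])).
  apply: countable_bigcupT_measurable => // q; apply: measurableI.
    by apply: measurable_hit; apply: compact_closedI => //; exact: closed_mball.
  by apply: IH; exact: compact_closedI.
apply/seteqP; split => [w /= Hk|w [[i n] _ [/= H1 H2]]].
  have [x wx Cx] : exists2 x, points w x & C x.
    apply/point_measure_gt0; rewrite gt_eqF//; apply: lt_le_trans Hk.
    by rewrite lte_fin ltr0n.
  have [|r r0 Hr] := @config_isolated _ _ _ (rmpt w x) x; first by case=> _; apply.
  (* the double ball has its points within 3 / (n + 1) of x *)
  have [n Hn] : exists n : nat, (n.+1%:R^-1 < r / 3)%R.
    have r30 : (0 < r / 3)%R by rewrite divr_gt0.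
    by have [m] := ltr_add_invr r30; rewrite add0r; exists m.
  have [//|i ix] := cP x (n.+1%:R^-1)%R.
  exists (i, n) => //; split => /=.
    by apply/point_measure_gt0; exists x => //; split => //; exact: ltW.
  have : k%:R%:E <= pm C (rmpt w x).
    move: Hk; rewrite /pm (rmpt_measure C wx) diracE mem_set//.
    by rewrite -natr1 EFinD leeD2rE.
  move=> /le_trans; apply.
  rewrite /pm (rmpt_measure _ wx); apply: (@le_trans _ _ (point_measure (rmpt w x) (C `&` F' (i, n)))).
    rewrite {1}/point_measure [leRHS]/point_measure.
    rewrite (_ : C `&` points (rmpt w x) = C `&` F' (i, n) `&` points (rmpt w x))//.
    apply/seteqP; split => [y [Cy wy]|y [[Cy _] wy]//]; split => //; split => //.
    rewrite /F' /=; have := Hr y wy; have := metric_triangle x (c i) y.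
    rewrite (metric_sym x (c i)) => H1 H2; move: ix Hn; set a := (n.+1%:R^-1)%R; lra.
  by rewrite leeDl.
apply: (@le_trans _ _ (pm ((C `&` B (i, n)) `|` (C `&` F' (i, n))) w)).
  rewrite /pm point_measureU.
    rewrite -nat1r EFinD leeD//; move: H1 => /point_measure_gt0[x wx Bx].
    by rewrite /pm (rmpt_measure _ wx) diracE mem_set// leeDr.
  apply/seteqP; split => // y [[_ By] [_ Fy]]; move: By Fy; rewrite /B /F' /=.
  have : (0 < n.+1%:R^-1 :> R)%R by rewrite invr_gt0.
  set a := (n.+1%:R^-1)%R; lra.
apply: le_measure; rewrite ?inE//.
- apply: measurableU; apply: compact_measurableX; apply: compact_closedI => //.
  exact: closed_mball.
- exact: compact_measurableX.
- by move=> y [] [].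
Qed.

Let measurable_pm_compact C : compact C -> measurable_fun setT (pm C).
Proof.
move=> cC; apply: (measurability _ (ErealGenOInfty.measurableE R)).
move=> _ [_ [r ->] <-]; rewrite setTI.
rewrite (_ : _ @^-1` _ = \bigcup_(k in [set k : nat | (r < k%:R)%R]) [set w | k%:R%:E <= pm C w]).
  by apply: bigcup_measurable => k _; exact: measurable_count.
apply/seteqP; split => [w|w [k /= rk kw]] /=; rewrite in_itv/= andbT.
  rewrite /pm /point_measure /counting; case: asboolP => fin H.
    by exists (#|` fset_set (C `&` points w)|) => //=; rewrite asboolT.
  exfalso; apply: fin; exact: compact_finite_points.
by apply: lt_le_trans kw; rewrite lte_fin.
Qed.

Lemma borel_compact : (measurable : set (set X)) = <<s [set C : set X | compact C] >>.
Proof.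
have [K [cK _ KT]] := compact_exhaustion X_sigma_compact.
apply/seteqP; split.
  rewrite borelE; apply: smallest_sub; first exact: smallest_sigma_algebra.
  move=> U oU; rewrite -[U]setCK.
  have mC : (<<s [set C : set X | compact C] >>) (~` U).
    rewrite -[~` U]setIT -KT setI_bigcupr.
    apply: sigma_algebra_bigcup => n; apply: sub_sigma_algebra => /=.
    by rewrite setIC; apply: compact_closedI => //; exact: open_closedC.
  by rewrite -setTD; apply: sigma_algebraCD.
apply: smallest_sub; first exact: sigma_algebra_measurable.
by move=> C; exact: compact_measurableX.
Qed.

(** A Dynkin class argument inside a compact set, where counts are finite and
    can be subtracted. *)
Let measurable_pm_restr K A : compact K -> measurable A -> measurable_fun setT (pm (A `&` K)).
Proof.
move=> cK; rewrite borel_compact => mA.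
pose B := [set A : set X | measurable A /\ measurable_fun setT (pm (A `&` K))].
suff : B A by case.
have mK := compact_measurableX cK.
have finK w : point_measure w K < +oo by exact: compact_point_measure.
have CI : setI_closed [set C : set X | compact C].
  by move=> C C' cC cC'; apply: compact_closedI => //; exact: compact_closedX.
have CB : [set C : set X | compact C] `<=` B.
  move=> C cC; split; first exact: compact_measurableX.
  by apply: measurable_pm_compact; apply: compact_closedI => //; exact: compact_closedX.
apply: (lambda_system_subset CI (D := setT)) => //; split => //.
- by split => //; rewrite setTI; exact: measurable_pm_compact.
- move=> A1 A2 A21 [mA1 m1] [mA2 m2]; split; first exact: measurableD.
  rewrite (_ : pm _ = fun w => pm (A1 `&` K) w - pm (A2 `&` K) w).
    exact: emeasurable_funB.
  apply/funext => w; rewrite /pm.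
  rewrite (_ : _ `&` K = (A1 `&` K) `\` (A2 `&` K)); last first.
    by apply/seteqP; split => y; rewrite /setD/setI/=; tauto.
  rewrite measureD//.
  + by congr (_ - point_measure w _); rewrite setIACA setIid (setIidr A21).
  + exact: measurableI.
  + exact: measurableI.
  + apply: le_lt_trans (finK w); apply: le_measure; rewrite ?inE//.
    exact: measurableI.
- move=> F ndF FB; split; first by apply: bigcupT_measurable => n; have [] := FB n.
  apply: (@emeasurable_fun_cvg _ _ _ setT (fun n => pm (F n `&` K))).
    by move=> n; have [] := FB n.
  move=> w _; rewrite /pm setI_bigcupl; apply: nondecreasing_cvg_mu.
  + by move=> n; apply: measurableI => //; have [] := FB n.
  + by apply: bigcupT_measurable => n; apply: measurableI => //; have [] := FB n.
  + by move=> m n mn; apply/subsetPset; apply: setSI; exact/subsetPset/ndF.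
Qed.

Let measurable_pm A : measurable A -> measurable_fun setT (pm A).
Proof.
move=> mA.
have [K [cK ndK KT]] := compact_exhaustion X_sigma_compact.
apply: (@emeasurable_fun_cvg _ _ _ setT (fun n => pm (A `&` K n))).
  by move=> n; exact: measurable_pm_restr.
move=> w _; rewrite /pm -{2}(setIT A) -KT setI_bigcupr; apply: nondecreasing_cvg_mu.
- by move=> n; apply: measurableI => //; exact: compact_measurableX.
- by apply: bigcupT_measurable => n; apply: measurableI => //; exact: compact_measurableX.
- by move=> m n mn; apply/subsetPset; apply: setIS; exact/subsetPset/ndK.
Qed.

Lemma measurable_void_events : (measurable : set (set (config X))) `<=` <<s void_events >>.
Proof.
have mid : measurable_fun setT (fun w : T => w : config X).
  by apply: measurable_to_config => A mA; exact: measurable_pm.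
by move=> E mE; have := mid measurableT E mE; rewrite setTI.
Qed.

Lemma void_event_measurable C : measurable C -> measurable (void_event C).
Proof.
move=> mC; have := measurable_point_measure mC measurableT (emeasurable_set1 0).
by rewrite setTI.
Qed.

(** A pi-system that generates the product sigma-algebra and on which both
    sides of the Mecke formula can be computed. *)
Definition void_rectangles : set (set (config X * X)) :=
  [set E | exists C B, [/\ compact C, compact B & E = void_event C `*` B]].

Lemma void_rectangles_setI : setI_closed void_rectangles.
Proof.
move=> _ _ [C [B [cC cB ->]]] [C' [B' [cC' cB' ->]]].
exists (C `|` C'), (B `&` B'); split.
- exact: compactU.
- by apply: compact_closedI => //; exact: compact_closedX.
- rewrite -setXI; congr (_ `*` _); apply/seteqP; split => w.
    by move=> [/void_eventP H /void_eventP H']; apply/void_eventP => x [/H|/H'].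
  by move=> /void_eventP H; split; apply/void_eventP => x Cx; apply: H; [left|right].
Qed.

Lemma measurable_void_rectangles :
  (measurable : set (set (config X * X))) = <<s void_rectangles >>.
Proof.
have [K [cK _ KT]] := compact_exhaustion X_sigma_compact.
pose T' := g_sigma_algebraType void_rectangles.
have mfst : measurable_fun setT (fun z : T' => z.1 : config X).
  move=> _ E /measurable_void_events mE; rewrite setTI.
  suff : (<<s void_events >> : set (set (config X))) `<=` [set E | measurable ((fun z : T' => z.1) @^-1` E)].
    by apply.
  apply: smallest_sub.
    split => //=.
    - by rewrite preimage_set0.
    - by move=> A mA; rewrite setTD preimage_setC; exact: measurableC.
    - by move=> F mF; rewrite preimage_bigcup; exact: bigcupT_measurable.
  move=> _ [C [cC ->]] /=.
  rewrite (_ : _ @^-1` _ = \bigcup_n (void_event C `*` K n)).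
    by apply: bigcupT_measurable => n; apply: sub_sigma_algebra; exists C, (K n).
  apply/seteqP; split => [[w x] /= Hw|[w x] [n _ []]//].
  have [n _ Knx] : (\bigcup_n K n) x by rewrite KT.
  by exists n.
have msnd : measurable_fun setT (fun z : T' => z.2 : X).
  apply: (measurability _ borel_compact) => _ [C cC <-]; rewrite setTI.
  apply: sub_sigma_algebra; exists set0, C; split => //; first exact: compact0.
  by apply/seteqP; split => [[w x] /= Cx|[w x] []//]; split => //=.
apply/seteqP; split => [E mE|].
  have mid : measurable_fun setT (fun z : T' => (z.1, z.2) : config X * X).
    exact: measurable_fun_pair.
  have := mid measurableT E mE; rewrite setTI.
  by congr (<<s _ >> _); apply/seteqP; split=> -[].
apply: smallest_sub; first exact: sigma_algebra_measurable.
move=> _ [C [B [cC cB ->]]]; apply: measurableX; last exact: compact_measurableX.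
by apply: void_event_measurable; exact: compact_measurableX.
Qed.

End void_events.

(** * Integration against point measures *)

Section kernel_integral.
Context d1 d2 (T1 : measurableType d1) (T2 : measurableType d2) (R : realType).
Variables (m1 : {measure set T1 -> \bar R}) (k : T1 -> {measure set T2 -> \bar R}).
Variable (m : {measure set (T1 * T2) -> \bar R}).
Hypothesis mk : forall E, measurable E -> measurable_fun setT (fun t => k t (xsection E t)).
Hypothesis mE : forall E, measurable E -> (m E = \int[m1]_t k t (xsection E t))%E.
Local Open Scope ereal_scope.
Import HBNNSimple.

Let indic_section (E : set (T1 * T2)) t : measurable E ->
  \int[k t]_x (\1_E (t, x))%:E = k t (xsection E t).
Proof.
move=> mE'.
transitivity (\int[k t]_x (\1_(xsection E t) x)%:E).
  by apply: eq_integral => x _; rewrite !indicE mem_xsection.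
by rewrite integral_indic ?setIT//; exact: measurable_xsection.
Qed.

Let mkf (F : T1 * T2 -> \bar R) : measurable_fun setT F -> (forall z, 0 <= F z) ->
  measurable_fun setT (fun t => \int[k t]_x F (t, x)).
Proof.
move=> mF F0; pose F_ := nnsfun_approx measurableT mF.
apply: (@measurable_fun_xsection_integral _ _ T1 T2 R F k F_).
- by move=> a b ab; exact/nd_nnsfun_approx.
- by move=> z; exact/cvg_nnsfun_approx.
- by move=> n r; apply: mk.
Qed.

Let kernel_integral_nnsfun (f : {nnsfun (T1 * T2) >-> R}) :
  \int[m]_z (f z)%:E = \int[m1]_t \int[k t]_x (f (t, x))%:E.
Proof.
under [in LHS]eq_integral do rewrite fimfunE -fsumEFin//.
rewrite ge0_integral_fsum//; last 2 first.
  - by move=> r; exact/measurable_EFinP/measurableT_comp.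
  - by move=> r z _; rewrite EFinM nnfun_muleindic_ge0.
transitivity (\int[m1]_t \sum_(r \in range f) r%:E * k t (xsection (f @^-1` [set r]) t)).
  rewrite ge0_integral_fsum//; last 2 first.
  - by move=> r; apply: measurable_funeM; exact: mk.
  - move=> r t _; have [r0|r0] := leP 0%R r.
      by apply: mule_ge0; rewrite ?lee_fin//; exact: measure_ge0.
    rewrite preimage_nnfun0// (_ : xsection _ _ = set0) ?measure0 ?mule0//.
    by apply/seteqP; split => x //=; rewrite /xsection/= inE.
  apply: eq_fsbigr => r _.
  rewrite (integralZl_indic _ (fun r => f @^-1` [set r]))//; last first.
    by move=> r0; rewrite preimage_nnfun0.
  rewrite integral_indic// setIT mE//.
  have [r0|r0] := leP 0%R r.
    by rewrite ge0_integralZl//; exact: mk.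
  rewrite preimage_nnfun0//.
  have H t : xsection (@set0 (T1 * T2)) t = set0.
    by apply/seteqP; split => x //=; rewrite /xsection/= inE.
  under eq_integral do rewrite H measure0.
  under [in RHS]eq_integral do rewrite H measure0 mule0.
  by rewrite !integral0 mule0.
apply: eq_integral => t _.
under [in RHS]eq_integral do rewrite fimfunE -fsumEFin//.
rewrite ge0_integral_fsum//; last 2 first.
  - move=> r; apply/measurable_EFinP; apply: measurableT_comp => //.
    by apply: measurableT_comp => //; exact: pair1_measurable.
  - by move=> r x _; rewrite EFinM nnfun_muleindic_ge0.
apply: eq_fsbigr => r _.
under eq_integral do rewrite EFinM.
have [r0|r0] := leP 0%R r.
  rewrite ge0_integralZl//.
    by rewrite indic_section.
  by apply/measurable_EFinP; apply: measurableT_comp => //; exact: pair1_measurable.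
rewrite preimage_nnfun0//.
rewrite (_ : xsection _ _ = set0) ?measure0 ?mule0; last first.
  by apply/seteqP; split => x //=; rewrite /xsection/= inE.
by rewrite integral0_eq// => x _; rewrite indic0 mule0.
Qed.

(** The passage from sets to functions, by nonnegative simple functions and
    monotone convergence. The kernel enters only through the measurability of
    its sections, which is what is known of point measures. *)
Lemma kernel_integralE (F : T1 * T2 -> \bar R) :
  measurable_fun setT F -> (forall z, 0 <= F z) ->
  \int[m]_z F z = \int[m1]_t \int[k t]_x F (t, x).
Proof.
move=> mF F0; pose F_ := nnsfun_approx measurableT mF.
have cvgF z : (F_ n z)%:E @[n --> \oo] --> F z by exact: cvg_nnsfun_approx.
have limF z : F z = limn (fun n => (F_ n z)%:E) by apply/esym/cvg_lim.
transitivity (\int[m]_z limn (fun n => (F_ n z)%:E)).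
  by apply: eq_integral => z _; exact: limF.
rewrite monotone_convergence//; last 3 first.
  by move=> n; exact/measurable_EFinP.
  by move=> n z _; rewrite lee_fin.
  by move=> z _ a b ab; rewrite lee_fin; exact/lefP/nd_nnsfun_approx.
under eq_fun do rewrite kernel_integral_nnsfun.
rewrite -monotone_convergence//; last 3 first.
- by move=> n; apply: (mkf (F := fun z => (F_ n z)%:E)) => //; [exact/measurable_EFinP|move=> z; rewrite lee_fin].
- by move=> n t _; apply: integral_ge0 => x _; rewrite lee_fin.
- move=> t _ a b ab; apply: ge0_le_integral => //.
  + by move=> x _; rewrite lee_fin.
  + by apply/measurable_EFinP; apply: measurableT_comp => //; exact: pair1_measurable.
  + by apply/measurable_EFinP; apply: measurableT_comp => //; exact: pair1_measurable.
  + by move=> x _; rewrite lee_fin; exact/lefP/nd_nnsfun_approx.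
apply: eq_integral => t _; rewrite -monotone_convergence//; last 3 first.
- by move=> n; apply/measurable_EFinP; apply: measurableT_comp => //; exact: pair1_measurable.
- by move=> n x _; rewrite lee_fin.
- by move=> x _ a b ab; rewrite lee_fin; exact/lefP/nd_nnsfun_approx.
by apply: eq_integral => x _; rewrite -limF.
Qed.

End kernel_integral.

Section campbell.
Context d (R : realType) (X : borelMetricType d R).
Hypothesis X_sigma_compact : sigma_compact X.
Variable P : {measure set (config X) -> \bar R}.
Local Open Scope ereal_scope.

(** The Campbell measure of the point process P. The dummy argument carries
    the hypothesis on which sigma-additivity rests, so that the structure of
    measure can be inferred from the term. *)
Definition campbell (_ : sigma_compact X) (E : set (config X * X)) : \bar R :=
  \int[P]_w point_measure w (xsection E w).

Let mksec (E : set (config X * X)) : measurable E ->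
  measurable_fun setT (fun w : config X => point_measure w (xsection E w)).
Proof. by move=> mE; exact: (measurable_point_measure_xsection X_sigma_compact (f := id)). Qed.

Let campbell0 : campbell X_sigma_compact set0 = 0.
Proof.
rewrite /campbell integral0_eq// => w _.
by rewrite (_ : xsection _ _ = set0) ?measure0//; apply/seteqP; split => x //=; rewrite /xsection/= inE.
Qed.

Let campbell_ge0 E : 0 <= campbell X_sigma_compact E.
Proof. by apply: integral_ge0 => w _; exact: measure_ge0. Qed.

Let campbell_sigma_additive : semi_sigma_additive (campbell X_sigma_compact).
Proof.
move=> F mF tF mUF; rewrite [X in _ --> X](_ : _ = \sum_(n <oo) campbell X_sigma_compact (F n)).
  apply/cvg_closeP; split; last by rewrite closeE.
  by apply: is_cvg_nneseries => n _ _; exact: integral_ge0.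
rewrite -integral_nneseries//; last first.
  by move=> n; exact: mksec.
apply: eq_integral => w _; rewrite xsection_bigcup measure_bigcup//.
- by apply: eq_eseriesl => n; rewrite in_setT.
- by move=> n _; exact: measurable_xsection.
- exact: trivIset_xsection.
Qed.

HB.instance Definition _ := isMeasure.Build _ _ _ (campbell X_sigma_compact)
  campbell0 campbell_ge0 campbell_sigma_additive.

Lemma campbellE (F : config X * X -> \bar R) :
  measurable_fun setT F -> (forall z, 0 <= F z) ->
  \int[campbell X_sigma_compact]_z F z = \int[P]_w \int[point_measure w]_x F (w, x).
Proof.
by apply: kernel_integralE => // E mE; exact: mksec.
Qed.

End campbell.

(** * The Mecke formula *)

Section exp_series.
Context (R : realType).
Local Open Scope ereal_scope.

Lemma expR_nneseries (x : R) : (0 <= x)%R ->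
  \sum_(0 <= k <oo) (x ^+ k / k`!%:R)%:E = (expR x)%:E.
Proof.
move=> x0; rewrite /expR; apply/cvg_lim => //.
have -> : (fun n => \sum_(0 <= k < n) (x ^+ k / k`!%:R)%:E) = EFin \o series (exp_coeff x).
  by apply/funext => n /=; rewrite sumEFin; congr EFin; apply: eq_bigr => k _; rewrite exp_coeffE.
apply/fine_cvgP; split; first exact: nearW.
exact: (is_cvg_series_exp_coeff x).
Qed.

End exp_series.

Section poisson_mecke.
Context d (R : realType) (X : borelMetricType d R).
Hypothesis X_sigma_compact : sigma_compact X.
Variables (sigma : {sigma_finite_measure set X -> \bar R}) (P : probability (config X) R).
Hypothesis P_poisson : is_poisson_measure sigma P.
Local Open Scope ereal_scope.
Implicit Types (A B C D : set X).

Lemma eq_point_measure (w : config X) A B : A `&` points w = B `&` points w ->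
  point_measure w A = point_measure w B.
Proof. by rewrite /point_measure => ->. Qed.

(** Independence is given for compact sets only, whereas differences of
    compact sets arise; these are increasing unions of compact sets, F j being
    the part of B at distance at least 1/(j+1) from C. *)
Lemma compact_diff_exhaustion B C : compact B -> compact C ->
  exists F : nat -> set X, [/\ forall j, compact (F j), nondecreasing_seq F &
    \bigcup_j F j = B `\` C].
Proof.
move=> cB cC.
pose F (j : nat) := B `&` [set x : X | forall c, C c -> (j.+1%:R^-1 <= mdist x c)%R].
exists F; split.
- move=> j; apply: compact_closedI => //.
  rewrite (_ : [set x | _] = ~` \bigcup_(c in C) [set x | (mdist c x < j.+1%:R^-1)%R]).
    by apply: open_closedC; apply: bigcup_open => c _; exact: open_mball.
  apply/seteqP; split => [x /= H [c Cc /=]|x /= H c Cc].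
    by rewrite ltNge metric_sym H.
  by rewrite leNgt; apply/negP => xc; apply: H; exists c => //=; rewrite metric_sym.
- move=> i j ij; apply/subsetPset => x [Bx H]; split => // c /H; apply: le_trans.
  by rewrite lef_pV2 ?posrE// ler_nat.
- apply/seteqP; split => [x [j _ [Bx H]]|x [Bx Cx]].
    split => // Cx; have := H x Cx; rewrite mdistxx leNgt => /negP; apply.
    by rewrite invr_gt0.
  have /nbhs_mball[e e0 eU] : nbhs x (~` C).
    by apply: open_nbhs_nbhs; split => //; apply: closed_openC; exact: compact_closedX.
  have [j] := ltr_add_invr e0; rewrite add0r => je.
  exists j => //; split => // c Cc; rewrite leNgt; apply/negP => xc.
  by apply: (eU c) => //; exact: lt_trans je.
Qed.

Let sigma_fin C : compact C -> sigma C \is a fin_num.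
Proof. by move=> cC; rewrite ge0_fin_numE//; have [] := P_poisson.1 C cC. Qed.

Let nat_event A k : set (config X) := [set w | point_measure w A = k%:R%:E].

Let measurable_nat_event A k : measurable A -> measurable (nat_event A k).
Proof.
move=> mA; have := measurable_point_measure mA measurableT (emeasurable_set1 k%:R%:E).
by rewrite setTI.
Qed.

Let poisson_event A k : compact A ->
  P (nat_event A k) = (expR (- fine (sigma A)) * fine (sigma A) ^+ k / k`!%:R)%:E.
Proof. by move=> cA; have [_ H] := P_poisson.1 A cA; exact: H. Qed.

Lemma poisson_void C : compact C -> P (void_event C) = (expR (- fine (sigma C)))%:E.
Proof.
by move=> cC; rewrite [LHS](poisson_event 0 cC) expr0 mulr1 fact0 divr1.
Qed.

Let indep A B k l : compact A -> compact B -> A `&` B = set0 ->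
  P (nat_event A k `&` nat_event B l) = P (nat_event A k) * P (nat_event B l).
Proof.
move=> cA cB AB.
have [_ /(_ 2%N (fun i => if val i == 0%N then A else B))] := P_poisson.
move=> /(_ _ _ (fun i => if val i == 0%N then [set k%:R%:E] else [set l%:R%:E])) H.
have := H _ _ _; rewrite !big_ord_recl big_ord0 mule1/= => <-.
- congr (P _); apply/seteqP; split => w /=.
    by move=> [wA wB] i; case: ifP.
  by move=> Hi; split; [exact: (Hi ord0)|exact: (Hi (lift ord0 ord0))].
- by move=> i; case: ifP.
- apply/trivIsetP => i j _ _; case: i => [[|[|//]] ?]; case: j => [[|[|//]] ?] //= _.
  by rewrite setIC.
- by move=> i; case: ifP => _; exact: emeasurable_set1.
Qed.

Let point_measure_series w A : compact A ->
  point_measure w A = \sum_(0 <= k <oo) k%:R%:E * (\1_(nat_event A k) w)%:E.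
Proof.
move=> /(compact_finite_points w) fA.
have [N AN] : exists N, point_measure w A = N%:R%:E.
  by rewrite /point_measure /counting asboolT//; eexists.
rewrite (nneseries_split 0 N.+1)// add0n.
rewrite big_mkord (bigD1 (inord N))//= inordK// indicE mem_set// mule1 -AN.
rewrite big1 ?adde0 => [|k kN]; last first.
  rewrite indicE memNset ?mule0// /nat_event/= AN => -[] /eqP; rewrite eqr_nat => /eqP NK.
  by move/eqP : kN; apply; apply/val_inj; rewrite /= inordK.
rewrite eseries0 ?adde0// => k Nk _.
rewrite indicE memNset ?mule0// /nat_event/= AN => -[] /eqP; rewrite eqr_nat => /eqP NK.
by move: Nk; rewrite NK ltnn.
Qed.

(** An event independent of the count of A multiplies the mean of that count,
    and the mean of a Poisson variable is summed from its mass function. *)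
Let mean_restricted E A : measurable E -> compact A ->
  (forall k, P (E `&` nat_event A k) = P E * P (nat_event A k)) ->
  \int[P]_w ((\1_E w)%:E * point_measure w A) = P E * sigma A.
Proof.
move=> mE cA EA; have mA := compact_measurableX cA.
transitivity (\int[P]_w \sum_(0 <= k <oo) k%:R%:E * (\1_(E `&` nat_event A k) w)%:E).
  apply: eq_integral => w _; rewrite (point_measure_series w cA) -nneseriesZl//.
  by apply: eq_eseriesr => k _; rewrite muleCA -EFinM indicI.
rewrite integral_nneseries//; last first.
  move=> k; apply: measurable_funeM; apply/measurable_EFinP; apply: measurable_indic.
  by apply: measurableI => //; exact: measurable_nat_event.
have mEk k : measurable (E `&` nat_event A k).
  by apply: measurableI => //; exact: measurable_nat_event.
have PE0 : P E \is a fin_num by exact: fin_num_measure.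
rewrite (eq_eseriesr (g := fun k => (fine (P E))%:E *
    (k%:R%:E * (expR (- fine (sigma A)) * fine (sigma A) ^+ k / k`!%:R)%:E))); last first.
  move=> k _; rewrite ge0_integralZl//; last by apply/measurable_EFinP; exact: measurable_indic.
  rewrite integral_indic// setIT fineK//.
  by rewrite -poisson_event// muleCA; congr (_ * _); exact: EA.
rewrite nneseriesZl; last first.
  by move=> k _; rewrite -EFinM lee_fin !mulr_ge0// ?expR_ge0// exprn_ge0// fine_ge0.
rewrite fineK//; congr (_ * _).
set m := fine (sigma A); have m0 : (0 <= m)%R by rewrite fine_ge0.
have t0 k : 0 <= k%:R%:E * (expR (- m) * m ^+ k / k`!%:R)%:E.
  by rewrite -EFinM lee_fin !mulr_ge0// ?expR_ge0// exprn_ge0.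
rewrite (nneseries_split _ 1%N)// big_mkord big_ord1 mul0e add0e -nneseries_addn//.
rewrite (eq_eseriesr (g := fun k => (expR (- m) * m)%:E * (m ^+ k / k`!%:R)%:E)); last first.
  move=> k _; rewrite -!EFinM (addn1 k) factS natrM exprS; congr EFin.
  by field; rewrite nat1r !pnatr_eq0 -lt0n fact_gt0.
rewrite nneseriesZl; last by move=> k _; rewrite lee_fin divr_ge0// exprn_ge0.
rewrite expR_nneseries// -EFinM mulrAC -expRD addNr expR0 mul1r.
by rewrite fineK// sigma_fin.
Qed.

(** Monotone limit of mean_restricted along compact sets disjoint from C. *)
Let void_mean C A : compact C -> measurable A ->
  (exists F : nat -> set X, [/\ forall j, compact (F j), nondecreasing_seq F,
     \bigcup_j F j = A & forall j, C `&` F j = set0]) ->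
  \int[P]_w ((\1_(void_event C) w)%:E * point_measure w A) = P (void_event C) * sigma A.
Proof.
move=> cC mA [F [cF ndF FA CF]].
have mF j : measurable (F j) by exact: compact_measurableX.
have cvgA (m : {measure set X -> \bar R}) : m (F j) @[j --> \oo] --> m A.
  by rewrite -FA; apply: nondecreasing_cvg_mu => //; rewrite FA.
have mC : measurable (void_event C) by apply: void_event_measurable; exact: compact_measurableX.
have H : \int[P]_w ((\1_(void_event C) w)%:E * point_measure w (F j)) @[j --> \oo] -->
    \int[P]_w ((\1_(void_event C) w)%:E * point_measure w A).
  rewrite (_ : \int[P]_w ((\1_(void_event C) w)%:E * point_measure w A) =
    \int[P]_w limn (fun j => (\1_(void_event C) w)%:E * point_measure w (F j))); last first.
    apply: eq_integral => w _; apply/esym/cvg_lim => //.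
    by apply: cvgeZl => //; exact: cvgA.
  apply: cvg_monotone_convergence => //.
  - move=> j; apply: emeasurable_funM.
      by apply/measurable_EFinP; exact: measurable_indic.
    exact: measurable_point_measure.
  - by move=> j w _; apply: mule_ge0.
  - move=> w _ i j ij; apply: lee_pmul => //.
    by apply: le_measure; rewrite ?inE//; exact/subsetPset/ndF.
have H' : \int[P]_w ((\1_(void_event C) w)%:E * point_measure w (F j)) @[j --> \oo] -->
    P (void_event C) * sigma A.
  rewrite (_ : (fun j => _) = fun j => P (void_event C) * sigma (F j)).
    by apply: cvgeZl; [exact: fin_num_measure|exact: cvgA].
  apply/funext => j; apply: mean_restricted => // k.
  exact: (indep 0).
by apply: cvg_unique H H'.
Qed.

(** The joint law of two independent counts, in the limit of compact sets
    increasing to E. *)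
Let one_event D E : compact D -> measurable E ->
  (exists F : nat -> set X, [/\ forall j, compact (F j), nondecreasing_seq F,
     \bigcup_j F j = E & forall j, D `&` F j = set0]) -> (sigma E < +oo) ->
  P (nat_event D 1 `&` void_event E) =
  (fine (sigma D) * expR (- (fine (sigma D) + fine (sigma E))))%:E.
Proof.
move=> cD mE [F [cF ndF FE DF]] Efin.
have mF j : measurable (F j) by exact: compact_measurableX.
have mD : measurable (nat_event D 1).
  by apply: measurable_nat_event; exact: compact_measurableX.
have H : P (nat_event D 1 `&` void_event (F j)) @[j --> \oo] -->
    P (nat_event D 1 `&` void_event E).
  have -> : nat_event D 1 `&` void_event E = \bigcap_j (nat_event D 1 `&` void_event (F j)).
    apply/seteqP; split => [w [wD /void_eventP wE] j _|w H].
      by split => //; apply/void_eventP => x Fx; apply: wE; rewrite -FE; exists j.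
    split; first by have [] := H 0%N I.
    apply/void_eventP => x; rewrite -FE => -[j _ Fjx].
    by have [_ /void_eventP] := H j I; apply.
  apply: nonincreasing_cvg_mu => //.
  - by apply: le_lt_trans (probability_le1 _ _) _; rewrite ?ltry//; apply: measurableI => //; exact: void_event_measurable.
  - by move=> j; apply: measurableI => //; exact: void_event_measurable.
  - by apply: bigcapT_measurable => j; apply: measurableI => //; exact: void_event_measurable.
  - move=> i j ij; apply/subsetPset => w [wD /void_eventP wF]; split => //.
    by apply/void_eventP => x Fx; apply: wF; exact: (subsetPset _ _ (ndF i j ij)).
have H' : P (nat_event D 1 `&` void_event (F j)) @[j --> \oo] -->
    (fine (sigma D) * expR (- (fine (sigma D) + fine (sigma E))))%:E.
  rewrite (_ : (fun j => _) = fun j => (fine (sigma D) * expR (- (fine (sigma D) + fine (sigma (F j)))))%:E).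
    apply: cvg_EFin; first exact: nearW.
    apply: cvgMl_tmp; apply: continuous_cvg; first exact: continuous_expR.
    apply: cvgN; apply: cvgD; first exact: cvg_cst.
    apply: fine_cvg; rewrite fineK ?ge0_fin_numE//.
    by rewrite -FE; apply: nondecreasing_cvg_mu => //; rewrite FE.
  apply/funext => j; rewrite [LHS](indep 1 0)// !poisson_event//.
  rewrite -EFinM; congr EFin; rewrite !expr1 expr0 fact0 mulr1 !divr1 opprD expRD.
  by ring.
exact: cvg_unique H H'.
Qed.

(** Removing x leaves C void either because C was void already, or because x
    was the only point of w in C; the two summands count the points x of B of
    each kind. *)
Let rmpt_void_section (w : config X) C B : compact C -> compact B ->
  point_measure w [set x | void_event C (rmpt w x) /\ B x] =
  (\1_(void_event C) w)%:E * point_measure w (B `\` C) +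
  (\1_(nat_event (B `&` C) 1 `&` void_event (C `\` B)) w)%:E.
Proof.
move=> cC cB; rewrite [\1_(void_event C) w]indicE.
have [wC|wC] := pselect (void_event C w).
  have wC' := wC; move/void_eventP : wC' => wC'.
  rewrite mem_set// mul1e indicE memNset ?adde0; last first.
    move=> [+ _]; rewrite /nat_event/= => BC1.
    have /point_measure_gt0[x wx [_ Cx]] : point_measure w (B `&` C) != 0.
      by rewrite BC1 /= gt_eqF// lte_fin.
    exact: (wC' x).
  apply: eq_point_measure; apply/seteqP; split => x.
    by move=> [[_ Bx] wx]; split => //; split => // Cx; exact: (wC' x).
  move=> [[Bx Cx] wx]; split => //; split => //.
  by apply/void_eventP => y Cy [wy _]; exact: (wC' y).
rewrite memNset// mul0e add0e indicE.
have [[H1 /void_eventP H2]|H] := pselect ((nat_event (B `&` C) 1 `&` void_event (C `\` B)) w).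
  rewrite mem_set; last by split => //; exact/void_eventP.
  have /point_measure_gt0[y wy [By Cy]] : point_measure w (B `&` C) != 0.
    by rewrite H1 /= gt_eqF// lte_fin.
  have /void_eventP BCy : void_event (B `&` C) (rmpt w y).
    move: H1; rewrite /nat_event /void_event/= (rmpt_measure _ wy) diracE mem_set//=.
    by move=> /(congr1 (fun z => z - 1)); rewrite addeK// subee.
  rewrite (eq_point_measure (B := [set y])).
    by rewrite point_measure1 indicE mem_set.
  apply/seteqP; split => x.
    move=> [[/void_eventP Hx Bx] wx]; split => //=; apply: contrapT => xy.
    have Cx : C x.
      by apply: contrapT => Cx; apply: (Hx y Cy); split => // yx; apply: Cx; rewrite -yx.
    by apply: (BCy x); split.
  move=> [/= -> _]; split => //; split => //; apply/void_eventP => z Cz [wz zy].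
  have [Bz|Bz] := pselect (B z); first exact: (BCy z).
  exact: (H2 z).
rewrite memNset// (eq_point_measure (B := set0)) ?measure0//.
apply/seteqP; split => [x [[/void_eventP Hx Bx] wx]|x [[]]].
have Cx : C x.
  apply: contrapT => Cx; apply: wC; apply/void_eventP => y Cy wy.
  by apply: (Hx y Cy); split => // yx; apply: Cx; rewrite -yx.
exfalso; apply: H; split.
  rewrite /nat_event/= (rmpt_measure _ wx) diracE mem_set//.
  rewrite (_ : point_measure _ _ = 0) ?add0e//.
  by apply/void_eventP => y [_]; exact: Hx.
apply/void_eventP => y [Cy By] wy; apply: (Hx y Cy); split => // yx.
by apply: By; rewrite yx.
Qed.

Let palm_map (z : config X * X) : config X * X := (rmpt z.1 z.2, z.2).

Let measurable_palm_map : measurable_fun setT palm_map.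
Proof.
by apply: measurable_fun_pair => //; exact: measurable_rmpt.
Qed.

(** The two summands of rmpt_void_section have the means exp(- sigma C) *
    sigma (B minus C) and exp(- sigma C) * sigma (B :&: C), whose sum is
    exp(- sigma C) * sigma B. *)
Let palm_rectangle C B : compact C -> compact B ->
  pushforward (campbell P X_sigma_compact) palm_map (void_event C `*` B) =
  P (void_event C) * sigma B.
Proof.
move=> cC cB; rewrite /pushforward/= /campbell.
have [F [cF ndF FE]] := compact_diff_exhaustion cB cC.
have [G [cG ndG GE]] := compact_diff_exhaustion cC cB.
have mB := compact_measurableX cB; have mC := compact_measurableX cC.
have mV : measurable (void_event C) by exact: void_event_measurable.
have cBC : compact (B `&` C) by apply: compact_closedI => //; exact: compact_closedX.
have mE : measurable (nat_event (B `&` C) 1 `&` void_event (C `\` B)).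
  apply: measurableI; first by apply: measurable_nat_event; exact: measurableI.
  by apply: void_event_measurable; exact: measurableD.
transitivity (\int[P]_w ((\1_(void_event C) w)%:E * point_measure w (B `\` C) +
  (\1_(nat_event (B `&` C) 1 `&` void_event (C `\` B)) w)%:E)).
  apply: eq_integral => w _; rewrite -rmpt_void_section//; congr (point_measure w _).
  by apply/seteqP; split => x; rewrite /xsection/= inE.
rewrite ge0_integralD//; last 3 first.
- by move=> w _; apply: mule_ge0.
- apply: emeasurable_funM; first by apply/measurable_EFinP; exact: measurable_indic.
  by apply: measurable_point_measure; exact: measurableD.
- by apply/measurable_EFinP; exact: measurable_indic.
rewrite integral_indic// setIT void_mean//; first last.
- exists F; split => // j; apply/seteqP; split => // x [Cx Fx].
  have : (B `\` C) x by rewrite -FE; exists j.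
  by case.
- exact: measurableD.
have sCB : sigma (C `\` B) < +oo.
  apply: le_lt_trans (proj1 (P_poisson.1 C cC)); apply: le_measure; rewrite ?inE//.
  exact: measurableD.
have one : P (nat_event (B `&` C) 1 `&` void_event (C `\` B)) =
    (fine (sigma (B `&` C)) * expR (- (fine (sigma (B `&` C)) + fine (sigma (C `\` B)))))%:E.
  apply: one_event => //; first exact: measurableD.
  exists G; split => // j; apply/seteqP; split => // x [[Bx Cx] Gx].
  have : (C `\` B) x by rewrite -GE; exists j.
  by case.
rewrite [X in _ + X]one.
rewrite poisson_void//.
have -> : (fine (sigma (B `&` C)) + fine (sigma (C `\` B)) = fine (sigma C))%R.
  have fBC := sigma_fin cBC; rewrite -fineD ?ge0_fin_numE//; last by rewrite -ge0_fin_numE.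
  rewrite -measureU//; [|exact: measurableI|exact: measurableD|].
    by congr (fine (sigma _)); rewrite setIC setUIDK.
  by apply/seteqP; split => x // [[Bx _] [_]].
rewrite mulrC EFinM fineK ?sigma_fin// -ge0_muleDr//.
rewrite -measureU//; [|exact: measurableD|exact: measurableI|].
  by rewrite setUC setUIDK.
by apply/seteqP; split => x // [[_ Cx] [_]].
Qed.

Let palm_meas : {measure set (config X * X) -> \bar R} :=
  measure_function_pushforward__canonical__measure_function_Measure
    (campbell P X_sigma_compact) measurable_palm_map.

Let palmE E : measurable E -> palm_meas E = (P \x sigma) E.
Proof.
have [K [cK ndK KT]] := compact_exhaustion X_sigma_compact.
have K0 n : void_rectangles (void_event set0 `*` K n).
  by exists set0, (K n); split => //; exact: compact0.
have rect C B : compact C -> compact B ->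
    palm_meas (void_event C `*` B) = P (void_event C) * sigma B.
  exact: palm_rectangle.
apply: (measure_unique (@void_rectangles _ R X) (fun n => void_event set0 `*` K n)) => //.
- exact: measurable_void_rectangles.
- exact: void_rectangles_setI.
- apply/seteqP; split => // -[w x] _.
  have [n _ Knx] : (\bigcup_n K n) x by rewrite KT.
  by exists n => //; split => //=; exact/void_eventP.
- move=> _ [C [B [cC cB ->]]]; rewrite rect//; apply/esym; apply: product_measure1E.
    by apply: void_event_measurable; exact: compact_measurableX.
  exact: compact_measurableX.
- move=> n; rewrite rect//; last exact: compact0.
  rewrite lte_mul_pinfty// ?fin_num_measure//.
    by apply: void_event_measurable.
  by have [] := P_poisson.1 (K n) (cK n).
Qed.

(** Removing a typical point of w leaves P unchanged: the image of the
    Campbell measure under the removal agrees with the product of P and sigma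
    on a generating pi-system. *)
Theorem mecke (F : config X * X -> \bar R) :
  measurable_fun setT F -> (forall z, 0 <= F z) ->
  \int[P]_w \int[point_measure w]_x F (rmpt w x, x) =
  \int[P]_w \int[sigma]_x F (w, x).
Proof.
move=> mF F0.
transitivity (\int[palm_meas]_z F z).
  rewrite ge0_integral_pushforward//= preimage_setT campbellE//.
  exact: measurableT_comp.
rewrite -(fubini_tonelli1 F mF F0).
by apply: eq_measure_integral => A mA _; exact: palmE.
Qed.

Theorem mecke_add (F : config X * X -> \bar R) :
  measurable_fun setT F -> (forall z, 0 <= F z) ->
  \int[P]_w \int[point_measure w]_x F (w, x) =
  \int[P]_w \int[sigma]_x F (addpt w x, x).
Proof.
move=> mF F0.
have mG : measurable_fun setT (fun z : config X * X => F (addpt z.1 z.2, z.2)).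
  apply: measurableT_comp => //; apply: measurable_fun_pair => //.
  exact: measurable_addpt.
rewrite -(mecke mG) => [|z]; last exact: F0.
apply: eq_integral => w _; apply: eq_integral_points.
- exact: measurableT_comp.
- apply: (measurableT_comp mF) => /=; apply: measurable_fun_pair; last exact: measurable_id.
  apply: measurable_addpt => //.
  exact: (measurable_rmpt X_sigma_compact (f := cst w) (g := id)).
- by move=> x wx /=; rewrite addpt_rmpt.
Qed.

End poisson_mecke.

(** * Iterated integrals over the coordinates of a tuple *)

Section coordinate_update.
Context (X : Type) (n : nat).
Implicit Types (t : n.-tuple X) (i j : 'I_n).

Definition upd t i x : n.-tuple X := [tuple if j == i then x else tnth t j | j < n].

Lemma tnth_upd t i x j : tnth (upd t i x) j = if j == i then x else tnth t j.
Proof. by rewrite tnth_mktuple. Qed.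

Lemma updC t i j x y : i != j -> upd (upd t i x) j y = upd (upd t j y) i x.
Proof.
move=> ij; apply: eq_from_tnth => k; rewrite !tnth_upd.
by case: (k =P j) => [->|_]; rewrite ?eqxx// eq_sym (negPf ij).
Qed.

Lemma upd_upd t i x y : upd (upd t i x) i y = upd t i y.
Proof. by apply: eq_from_tnth => k; rewrite !tnth_upd; case: (k == i). Qed.

End coordinate_update.

Section iterated_integral.
Context dX dW (R : realType) (X : measurableType dX) (W : measurableType dW) (n : nat).
Variable sigma : {sigma_finite_measure set X -> \bar R}.
Local Open Scope ereal_scope.
Implicit Types (F G H : W * n.-tuple X -> \bar R) (i j : 'I_n) (l : seq 'I_n).

(** Coordinates are integrated in place, the result still being a function of
    the whole tuple. They can then be integrated in any order, and a function
    of some of the coordinates needs no reindexing. *)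
Definition integrate_coord i F (z : W * n.-tuple X) : \bar R :=
  \int[sigma]_x F (z.1, upd z.2 i x).

Definition integrate_coords l F := foldr integrate_coord F l.

Definition independent_of i F := forall w t x, F (w, upd t i x) = F (w, t).

Lemma measurable_upd dT (T : measurableType dT) (f : T -> n.-tuple X) (g : T -> X) i :
  measurable_fun setT f -> measurable_fun setT g ->
  measurable_fun setT (fun z => upd (f z) i (g z)).
Proof.
move=> mf mg; apply/measurable_fun_tnthP => j.
rewrite (_ : _ \o _ = fun z => if j == i then g z else tnth (f z) j); last first.
  by apply/funext => z /=; rewrite tnth_upd.
case: (j == i) => //; exact: (measurableT_comp (measurable_tnth j) mf).
Qed.

Let measurable_shift F i : measurable_fun setT F ->
  measurable_fun setT (fun q : (W * n.-tuple X) * X => F (q.1.1, upd q.1.2 i q.2)).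
Proof.
move=> mF; apply: (measurableT_comp mF) => /=; apply: measurable_fun_pair.
  exact: measurableT_comp.
by apply: measurable_upd => //; exact: measurableT_comp.
Qed.

Lemma measurable_integrate_coord i F : measurable_fun setT F -> (forall z, 0 <= F z) ->
  measurable_fun setT (integrate_coord i F).
Proof.
move=> mF F0.
by apply: (measurable_fun_fubini_tonelli_F (m2 := sigma) _ (measurable_shift i mF)).
Qed.

Lemma integrate_coord_ge0 i F : (forall z, 0 <= F z) -> forall z, 0 <= integrate_coord i F z.
Proof. by move=> F0 z; apply: integral_ge0. Qed.

Lemma integrate_coords_ge0 l F : (forall z, 0 <= F z) -> forall z, 0 <= integrate_coords l F z.
Proof. by move=> F0; elim: l => //= i l IH; exact: integrate_coord_ge0. Qed.

Lemma measurable_integrate_coords l F : measurable_fun setT F -> (forall z, 0 <= F z) ->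
  measurable_fun setT (integrate_coords l F).
Proof.
move=> mF F0; elim: l => //= i l IH.
by apply: measurable_integrate_coord => //; exact: integrate_coords_ge0.
Qed.

Let measurable_slice F w t i : measurable_fun setT F ->
  measurable_fun setT (fun x => F (w, upd t i x)).
Proof.
move=> mF; exact: (measurableT_comp (measurable_shift i mF) (pair1_measurable (w, t))).
Qed.

Lemma integrate_coords_cat l l' F :
  integrate_coords (l ++ l') F = integrate_coords l (integrate_coords l' F).
Proof. exact: foldr_cat. Qed.

Lemma integrate_coordC i j F : measurable_fun setT F -> (forall z, 0 <= F z) ->
  integrate_coord i (integrate_coord j F) = integrate_coord j (integrate_coord i F).
Proof.
move=> mF F0; have [->//|ij] := eqVneq i j.
apply/funext => -[w t]; rewrite /integrate_coord /=.
have mFq : measurable_fun setT (fun q => F (w, upd (upd t i q.1) j q.2)).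
  apply: (measurableT_comp mF) => /=; apply: measurable_fun_pair => //.
  by apply: measurable_upd => //; exact: measurable_upd.
rewrite (fubini_tonelli _ mFq) => [|q]; last exact: F0.
by apply: eq_integral => x _; apply: eq_integral => y _ /=; rewrite updC.
Qed.

Let integrate_coords_move l1 i l2 F : measurable_fun setT F -> (forall z, 0 <= F z) ->
  integrate_coords (l1 ++ i :: l2) F = integrate_coords (i :: l1 ++ l2) F.
Proof.
move=> mF F0; elim: l1 => //= j l1 ->; rewrite /= integrate_coordC//.
  exact: measurable_integrate_coords.
exact: integrate_coords_ge0.
Qed.

Lemma perm_integrate_coords l l' F : measurable_fun setT F -> (forall z, 0 <= F z) ->
  perm_eq l l' -> integrate_coords l F = integrate_coords l' F.
Proof.
move=> mF F0; elim: l l' => [|i l IH] l'.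
  by move=> /perm_size /esym/size0nil ->.
move=> ll'; have il' : i \in l' by rewrite -(perm_mem ll') mem_head.
move: ll'; have [l1 l2] := splitPr il'; rewrite perm_sym perm_catC/= perm_cons => ll'.
rewrite integrate_coords_move//=; congr integrate_coord; apply: IH.
by rewrite perm_sym perm_catC.
Qed.

Lemma eq_integrate_coords l F G w t :
  (forall t', (forall j, j \notin l -> tnth t' j = tnth t j) -> F (w, t') = G (w, t')) ->
  integrate_coords l F (w, t) = integrate_coords l G (w, t).
Proof.
elim: l t => [|i l IH] t FG /=; first exact: FG.
apply: eq_integral => x _ /=; apply: IH => t' t't; apply: FG => j.
rewrite inE negb_or => /andP[ji jl].
by rewrite t't// tnth_upd (negPf ji).
Qed.

Lemma integrate_coords_param (f : W -> W) l F z :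
  integrate_coords l (fun z => F (f z.1, z.2)) z = integrate_coords l F (f z.1, z.2).
Proof.
elim: l z => //= i l IH z; apply: eq_integral => x _; exact: IH.
Qed.

Lemma integrate_coordsZl l H F z :
  measurable_fun setT F -> (forall z, 0 <= F z) -> (forall z, 0 <= H z) ->
  (forall i, i \in l -> independent_of i H) ->
  integrate_coords l (fun z => H z * F z) z = H z * integrate_coords l F z.
Proof.
move=> mF F0 H0; elim: l z => //= i l IH [w t] Hi.
rewrite /integrate_coord /=.
under eq_integral => x _.
  rewrite IH; last by move=> j jl; apply: Hi; rewrite inE jl orbT.
  rewrite (Hi i (mem_head _ _)); over.
rewrite ge0_integralZl//.
  by apply: measurable_slice; exact: measurable_integrate_coords.
by move=> x _; exact: integrate_coords_ge0.
Qed.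

Lemma integrate_coords_indep l i F : independent_of i F -> independent_of i (integrate_coords l F).
Proof.
move=> Fi; elim: l => //= j l IH w t x; apply: eq_integral => y _ /=.
have [->|ij] := eqVneq i j; first by rewrite upd_upd.
by rewrite updC// IH.
Qed.

End iterated_integral.

Section power_measure_integral.
Context dX dW (R : realType) (X : measurableType dX) (W : measurableType dW) (n : nat).
Variable sigma : {sigma_finite_measure set X -> \bar R}.
Local Open Scope ereal_scope.

Lemma integral_power_measureS k (F : k.+1.-tuple X -> \bar R) :
  measurable_fun setT F -> (forall s, 0 <= F s) ->
  \int[power_measure sigma k.+1]_s F s =
  \int[sigma]_x \int[power_measure sigma k]_s F (tcons (x, s)).
Proof.
move=> mF F0.
transitivity (\int[sigma \x power_measure sigma k]_z F (tcons z)).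
  rewrite [LHS]ge0_integral_pushforward//; exact: measurable_tcons.
rewrite fubini_tonelli1//; exact: (measurableT_comp mF (@measurable_tcons _ _ _)).
Qed.

(** The tuple c selects distinct coordinates among n; as many iterated
    integrals compute the integral over the power measure. *)
Lemma integrate_coords_power k (c : k.-tuple 'I_n) (F : k.-tuple X -> \bar R)
    (z : W * n.-tuple X) :
  measurable_fun setT F -> (forall s, 0 <= F s) -> uniq c ->
  integrate_coords sigma c (fun z => F (map_tuple (tnth z.2) c)) z =
  \int[power_measure sigma k]_s F s.
Proof.
elim: k c F z => [|k IH] c F [w t] mF F0 uc.
  rewrite (tuple0 c) /= integral_dirac// diracT mul1e; congr F; exact/val_inj.
rewrite integral_power_measureS//.
case/tupleP: c uc => c0 c /= /andP[c0c uc].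
apply: eq_integral => x _ /=.
rewrite -(IH c (fun s => F (tcons (x, s))) (w, upd t c0 x))//; last first.
  apply: (measurableT_comp mF) => /=.
  exact: (measurable_cons (f := cst x) (g := id)).
apply: eq_integrate_coords => t' t't /=; congr F; apply/val_inj => /=.
by rewrite t't// tnth_upd eqxx.
Qed.

End power_measure_integral.

(** * Sums over distinct points and the exponential of a point sum *)

Section factorial_sums.
Context d (R : realType) (X : borelMetricType d R).
Hypothesis X_sigma_compact : sigma_compact X.
Local Open Scope ereal_scope.
Implicit Types (w : config X) (x : X).

(** The sum of the products g x_1 * ... * g x_n over the n-tuples of distinct
    points of w, obtained by removing each point before the next one is
    chosen. *)
Fixpoint factorial_sum (g : X -> R) (n : nat) (w : config X) : \bar R :=
  if n is n'.+1 then \int[point_measure w]_x ((g x)%:E * factorial_sum g n' (rmpt w x))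
  else 1.

Lemma measurable_factorial_sum dT (T : measurableType dT) (g : T * X -> R) n :
  measurable_fun setT g -> (forall z, (0 <= g z)%R) ->
  measurable_fun setT (fun z : T * config X => factorial_sum (fun x => g (z.1, x)) n z.2) /\
  forall z : T * config X, 0 <= factorial_sum (fun x => g (z.1, x)) n z.2.
Proof.
move=> mg g0; elim: n => [|n [mE E0]]; first by split => //; exact: measurable_cst.
split; last first.
  move=> [t w] /=; apply: integral_ge0 => x _; apply: mule_ge0; rewrite ?lee_fin//.
  exact: (E0 (t, rmpt w x)).
apply: (@measurable_config_integral _ _ _ X_sigma_compact _ _ snd _
  (fun q : (T * config X) * X => (g (q.1.1, q.2))%:E *
     factorial_sum (fun x => g (q.1.1, x)) n (rmpt q.1.2 q.2))) => //.
  apply: emeasurable_funM.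
    apply/measurable_EFinP; apply: (measurableT_comp mg) => /=.
    by apply: measurable_fun_pair => //; exact: measurableT_comp.
  apply: (measurableT_comp mE (g := fun q : (T * config X) * X => (q.1.1, rmpt q.1.2 q.2))).
  apply: measurable_fun_pair; first exact: measurableT_comp.
  by apply: measurable_rmpt => //; exact: measurableT_comp.
move=> [[t w] x]; apply: mule_ge0; rewrite ?lee_fin//; exact: (E0 (t, rmpt w x)).
Qed.

Section fixed_weight.
Variable g : X -> R.
Hypotheses (mg : measurable_fun setT g) (g0 : forall x, (0 <= g x)%R).

Let mgX : measurable_fun setT (fun z : X * X => g z.2).
Proof. exact: measurableT_comp. Qed.

Lemma factorial_sum_ge0 n w : 0 <= factorial_sum g n w.
Proof.
by have [_ /(_ (point, w))] := measurable_factorial_sum n mgX (fun z => g0 z.2).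
Qed.

Let measurable_fs n : measurable_fun setT (factorial_sum g n).
Proof.
have [H _] := measurable_factorial_sum n mgX (fun z => g0 z.2).
exact: (measurableT_comp H (pair1_measurable point)).
Qed.

Let measurable_term n w :
  measurable_fun setT (fun x => (g x)%:E * factorial_sum g n (rmpt w x)).
Proof.
apply: emeasurable_funM; first exact/measurable_EFinP.
apply: (measurableT_comp (measurable_fs n)).
exact: (measurable_rmpt X_sigma_compact (f := cst w) (g := id)).
Qed.

Let term_ge0 n w x : 0 <= (g x)%:E * factorial_sum g n (rmpt w x).
Proof. by apply: mule_ge0; rewrite ?lee_fin//; exact: factorial_sum_ge0. Qed.

Lemma rmptC w x y : rmpt (rmpt w x) y = rmpt (rmpt w y) x.
Proof. by apply: config_eq; apply/seteqP; split => z [[]]. Qed.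

(** An n-tuple of distinct points either avoids x or has x at exactly one of
    its n places. *)
Lemma factorial_sum_split n w x : points w x ->
  factorial_sum g n w = factorial_sum g n (rmpt w x) +
    (n%:R * g x)%:E * factorial_sum g n.-1 (rmpt w x).
Proof.
elim: n w => [|n IH] w wx; first by rewrite /= mul0r mul0e adde0.
rewrite {1}/factorial_sum -/factorial_sum (integral_points_split _ _ wx)//.
case: n IH => [|n] IH.
  by rewrite /= !mul1r addeC; congr (_ + _); rewrite mule1.
rewrite -[n.+2.-1]/(n.+1) addeC.
rewrite (@eq_integral_points _ _ _ _ _ (fun y => (g y)%:E * factorial_sum g n.+1 (rmpt (rmpt w x) y) +
    (n.+1%:R * g x)%:E * ((g y)%:E * factorial_sum g n (rmpt (rmpt w x) y)))); last 3 first.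
- exact: measurable_term.
- by apply: emeasurable_funD; [exact: measurable_term|apply: measurable_funeM; exact: measurable_term].
- move=> y [wy yx]; rewrite (IH (rmpt w y)); last by split => // xy; exact: yx.
  by rewrite ge0_muleDr ?mule_ge0 ?factorial_sum_ge0 ?lee_fin ?mulr_ge0// rmptC muleCA.
rewrite ge0_integralD; [|exact: measurableT|by []|exact: measurable_term| |]; last 2 first.
- by move=> y _; apply: mule_ge0; rewrite ?lee_fin ?mulr_ge0.
- by apply: measurable_funeM; exact: measurable_term.
rewrite ge0_integralZl//; last by rewrite lee_fin mulr_ge0.
rewrite -/(factorial_sum g n.+2 _) -/(factorial_sum g n.+1 _) -addeA; congr (_ + _).
rewrite -ge0_muleDl ?lee_fin ?mulr_ge0// -EFinD; congr (_%:E * _).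
by rewrite -[in RHS]natr1 mulrDl mul1r.
Qed.

(** Dropping the condition that the points are distinct gives the n-th power
    of the sum. *)
Lemma factorial_sum_le (a : R) n w : (0 <= a)%R ->
  \int[point_measure w]_x (g x)%:E <= a%:E -> factorial_sum g n w <= (a ^+ n)%:E.
Proof.
move=> a0; elim: n w => [|n IH] w ga; first by rewrite expr0.
apply: (@le_trans _ _ ((a ^+ n)%:E * \int[point_measure w]_x (g x)%:E)); last first.
  by rewrite exprSr EFinM; apply: lee_wpmul2l => //; rewrite lee_fin exprn_ge0.
rewrite -ge0_integralZl//; last 3 first.
- exact/measurable_EFinP.
- by move=> x _; rewrite lee_fin.
- by rewrite lee_fin exprn_ge0.
have mind : measurable_fun setT (fun x => (g x)%:E * factorial_sum g n (rmpt w x) * (\1_(points w) x)%:E).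
  apply: emeasurable_funM; first exact: measurable_term.
  by apply/measurable_EFinP; apply: measurable_indic; exact: measurable_points.
rewrite /= (@eq_integral_points _ _ _ _ _ (fun x => (g x)%:E * factorial_sum g n (rmpt w x) * (\1_(points w) x)%:E))//; last first.
  by move=> x wx; rewrite indicE mem_set// mule1.
apply: ge0_le_integral => //.
- by move=> x _; apply: mule_ge0.
- by apply: measurable_funeM; exact/measurable_EFinP.
- move=> x _; have [wx|wx] := pselect (points w x); last first.
    rewrite indicE memNset// mule0; apply: mule_ge0; rewrite lee_fin//.
    exact: exprn_ge0.
  rewrite indicE mem_set// mule1 muleC; apply: lee_pmul; rewrite ?lee_fin//.
    exact: factorial_sum_ge0.
  apply: IH; apply: le_trans ga.
  rewrite (integral_points_split _ _ wx)//; last exact/measurable_EFinP.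
  by rewrite leeDr// lee_fin.
Qed.

(** The product over w of the 1 - g x is the alternating series of the
    factorial_sum g n w / n!. Its even and odd halves are kept apart, as
    series of nonnegative terms that make sense before any convergence is
    known. *)
Definition parity_sum b w : \bar R :=
  \sum_(0 <= n <oo) (((odd n == b)%:R / n`!%:R)%:E * factorial_sum g n w).

Let coef_ge0 b n : (0 <= (odd n == b)%:R / n`!%:R :> R)%R.
Proof. by rewrite divr_ge0. Qed.

Let coef_term_ge0 b n w : 0 <= ((odd n == b)%:R / n`!%:R)%:E * factorial_sum g n w.
Proof. by apply: mule_ge0; [rewrite lee_fin|exact: factorial_sum_ge0]. Qed.

Lemma parity_sum_ge0 b w : 0 <= parity_sum b w.
Proof. by apply: nneseries_ge0 => n _ _. Qed.

(** One more factor 1 - g x: its second term moves the contributions of one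
    parity into the other. *)
Lemma parity_sum_split b w x : points w x ->
  parity_sum b w = parity_sum b (rmpt w x) + (g x)%:E * parity_sum (~~ b) (rmpt w x).
Proof.
move=> wx; rewrite /parity_sum.
pose t n := ((odd n == b)%:R / n`!%:R * n%:R)%:E * factorial_sum g n.-1 (rmpt w x).
have t0 n : 0 <= t n.
  apply: mule_ge0; last exact: factorial_sum_ge0.
  by rewrite lee_fin; apply: mulr_ge0 => //; exact: coef_ge0.
rewrite (eq_eseriesr (g := fun n => ((odd n == b)%:R / n`!%:R)%:E * factorial_sum g n (rmpt w x) +
   (g x)%:E * t n)); last first.
  move=> n _; rewrite (factorial_sum_split n wx) ge0_muleDr//; last 2 first.
  - exact: factorial_sum_ge0.
  - by apply: mule_ge0; [rewrite lee_fin mulr_ge0|exact: factorial_sum_ge0].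
  congr (_ + _); rewrite !muleA -!EFinM; congr (_%:E * _).
  by rewrite mulrA mulrC.
rewrite nneseriesD//; last by move=> n _ _; apply: mule_ge0; rewrite ?lee_fin.
congr (_ + _); rewrite nneseriesZl//; congr (_ * _).
rewrite (nneseries_split 0 1)// add0n big_mkord big_ord1 /t mulr0 mul0e add0e.
rewrite -(nneseries_addn (f := t))//; apply: eq_eseriesr => n _.
rewrite /t (addn1 n) /=; congr (_%:E * _).
rewrite factS natrM; have -> : (~~ odd n == b) = (odd n == ~~ b) by case: (odd n); case: (b).
by field; rewrite nat1r !pnatr_eq0 -lt0n fact_gt0.
Qed.

Lemma parity_sum_bound (a : R) w : (0 <= a)%R -> \int[point_measure w]_x (g x)%:E <= a%:E ->
  parity_sum false w + parity_sum true w <= (expR a)%:E.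
Proof.
move=> a0 ga; rewrite /parity_sum -nneseriesD// -expR_nneseries//.
apply: lee_nneseries => n _.
  by move=> _; apply: adde_ge0.
rewrite -ge0_muleDl ?lee_fin// -EFinD -mulrDl.
have -> : ((odd n == false)%:R + (odd n == true)%:R = 1 :> R)%R.
  by case: (odd n); rewrite ?add0r ?addr0.
rewrite mul1r mulrC EFinM; apply: lee_wpmul2l; first by rewrite lee_fin invr_ge0.
exact: factorial_sum_le.
Qed.

Lemma parity_sum_ge1 w : 1 <= parity_sum false w.
Proof.
rewrite /parity_sum (nneseries_split 0 1)// add0n big_mkord big_ord1 /= divr1 mul1e.
by rewrite leeDl// nneseries_ge0.
Qed.

End fixed_weight.

Section product_formula.
Variable v : X -> R.
Hypotheses (mv : measurable_fun setT v) (v0 : forall x, (0 <= v x)%R).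

Let g x : R := (1 - expR (- v x))%R.

Let mg : measurable_fun setT g.
Proof.
apply: measurable_funB => //; apply: measurableT_comp => //; exact: measurableT_comp.
Qed.

Let g0 x : (0 <= g x)%R.
Proof. by rewrite subr_ge0 -expR0 ler_expR oppr_le0. Qed.

Let gv x : (g x <= v x)%R.
Proof. by rewrite /g lerBlDr -lerBlDl; have := expR_ge1Dx (- v x). Qed.

Let a w := \int[point_measure w]_x (v x)%:E.

Let a_ge0 w : 0 <= a w.
Proof. by apply: integral_ge0 => x _; rewrite lee_fin. Qed.

Let a_split w x : points w x -> a w = (v x)%:E + a (rmpt w x).
Proof. by move=> wx; apply: integral_points_split => //; exact/measurable_EFinP. Qed.

Let a_rm_fin w x : a w < +oo -> a (rmpt w x) < +oo.
Proof.
have [wx|wx] := pselect (points w x); last by rewrite rmpt_id.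
by rewrite (a_split wx); apply: le_lt_trans; rewrite leeDr// lee_fin.
Qed.

Let sum_bound w : a w < +oo ->
  parity_sum g false w + parity_sum g true w <= (expR (fine (a w)))%:E.
Proof.
move=> aw; apply: parity_sum_bound => //; first exact: fine_ge0.
rewrite fineK ?ge0_fin_numE//; apply: ge0_le_integral => //.
- by move=> x _; rewrite lee_fin.
- exact/measurable_EFinP.
- exact/measurable_EFinP.
- by move=> x _; rewrite lee_fin.
Qed.

Let ps_ge0 b w : 0 <= parity_sum g b w. Proof. exact: parity_sum_ge0. Qed.

Let ps_fin b w : a w < +oo -> parity_sum g b w \is a fin_num.
Proof.
move=> aw; rewrite ge0_fin_numE//; apply: le_lt_trans (ltry (expR (fine (a w)))).
apply: le_trans (sum_bound aw).
by case: b; rewrite ?leeDl ?leeDr.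
Qed.

Let D w := (fine (parity_sum g false w) - fine (parity_sum g true w))%R.

(** Putting x back multiplies D by exp(- v x) and exp(a) by exp(v x). *)
Let D_split w x : a w < +oo -> (D w * expR (fine (a w)) =
  D (rmpt w x) * expR (fine (a (rmpt w x))))%R.
Proof.
move=> aw; have [wx|wx] := pselect (points w x); last by rewrite rmpt_id.
have aw' := a_rm_fin x aw.
rewrite (a_split wx) fineD//; last by rewrite ge0_fin_numE.
rewrite -[fine (v x)%:E]/(v x) expRD mulrA; congr (_ * _)%R.
rewrite /D !(parity_sum_split mg g0 _ wx) !fineD ?fin_numM ?ps_fin//.
rewrite !fineM ?ps_fin//=.
have := expRxMexpNx_1 (v x); rewrite /g.
set e := expR (v x); set e' := expR (- v x) => ee.
set p := fine _; set q := fine _; transitivity ((p - q) * (e * e'))%R; first by ring.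
by rewrite ee mulr1.
Qed.

Let D_near1 w : a w < +oo -> (`|D w - 1| <= expR (fine (a w)) - 1)%R.
Proof.
move=> aw.
have H : (fine (parity_sum g false w) + fine (parity_sum g true w) <= expR (fine (a w)))%R.
  by rewrite -fineD ?ps_fin// -lee_fin fineK ?sum_bound// fin_numD !ps_fin.
have H1 : (1 <= fine (parity_sum g false w))%R.
  by rewrite -lee_fin fineK ?ps_fin//; exact: parity_sum_ge1.
have H2 : (0 <= fine (parity_sum g true w))%R by rewrite fine_ge0.
rewrite ler_norml /D; apply/andP; split; lra.
Qed.

(** The difference D of the two halves is the product over w of the
    exp(- v x). Removing the points of w one after the other leaves D w *
    exp(a w) unchanged, while the remaining sums a tend to 0 by dominated
    convergence, so that both factors tend to 1. *)
Lemma parity_sum_exp w : a w < +oo ->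
  parity_sum g false w = parity_sum g true w + (expR (- fine (a w)))%:E.
Proof.
move=> aw.
have /pcard_geP/surjPex[c cw] := config_countable w.
pose r m := iteri m (fun i w' => rmpt w' (c i)) w.
have rS m : r m.+1 = rmpt (r m) (c m) by [].
have afin m : a (r m) < +oo by elim: m => // m IH; rewrite rS; exact: a_rm_fin.
have Dinv m : (D w * expR (fine (a w)) = D (r m) * expR (fine (a (r m))))%R.
  elim: m => [//|m ->]; rewrite rS; exact: (D_split (c m) (afin m)).
have rsub m : points (r m) `<=` points w.
  by elim: m => // m IH x; rewrite rS => -[/IH].
have rout m i : (i < m)%N -> ~ points (r m) (c i).
  elim: m => // m IH; rewrite ltnS leq_eqVlt => /orP[/eqP ->|im]; rewrite rS.
    by case=> _; apply.
  by case=> /(IH im).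
have integral_r f m : measurable_fun setT f -> (forall x, 0 <= f x) ->
    (forall i, (i < m)%N -> f (c i) = 0) ->
    \int[point_measure w]_x f x = \int[point_measure (r m)]_x f x.
  move=> mf f0; elim: m => // m IH fc; rewrite IH; last by move=> i im; apply: fc; exact: ltnW.
  rewrite rS; have [H|H] := pselect (points (r m) (c m)); last by rewrite rmpt_id.
  by rewrite (integral_points_split _ _ H)// fc// add0e.
have mind m : measurable_fun setT (fun x => (v x)%:E * (\1_(points (r m)) x)%:E).
  apply: emeasurable_funM; first exact/measurable_EFinP.
  by apply/measurable_EFinP; apply: measurable_indic; exact: measurable_points.
have ar m : a (r m) = \int[point_measure w]_x ((v x)%:E * (\1_(points (r m)) x)%:E).
  rewrite (integral_r _ m)//.
  - apply: eq_integral_points => //; first exact/measurable_EFinP.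
    by move=> x rx; rewrite indicE mem_set// mule1.
  - by move=> x; apply: mule_ge0; rewrite lee_fin.
  - by move=> i im; rewrite indicE memNset ?mule0//; exact: rout.
have cva : (fun m => a (r m)) @ \oo --> 0.
  have -> : (fun m => a (r m)) = fun m => \int[point_measure w]_x ((v x)%:E * (\1_(points (r m)) x)%:E).
    by apply/funext => m; exact: ar.
  have hf : {ae point_measure w, forall x, setT x ->
      (fun m => (v x)%:E * (\1_(points (r m)) x)%:E) @ \oo --> (cst 0 : X -> \bar R) x}.
    apply: aeW => x _; apply: cvg_near_cst.
    have [i Hi] : exists i, forall m, (i < m)%N -> ~ points (r m) x.
      have [wx|wx] := pselect (points w x); last by exists 0%N => m _ /rsub.
      by have [i _ <-] := cw _ wx; exists i => m; exact: rout.
    exists i.+1 => // m /= im; rewrite indicE memNset ?mule0//; exact: Hi.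
  have hi : (point_measure w).-integrable setT (EFin \o v).
    apply/integrableP; split; first exact/measurable_EFinP.
    apply: le_lt_trans aw; rewrite le_eqVlt; apply/orP; left; apply/eqP.
    by apply: eq_integral => x _ /=; rewrite ger0_norm.
  have hb : {ae point_measure w, forall x m, setT x ->
      `|(v x)%:E * (\1_(points (r m)) x)%:E| <= (EFin \o v) x}.
    apply: aeW => x m _; rewrite indicE; case: (_ \in _); rewrite /= ?mulr1 ?mulr0.
      by rewrite ger0_norm.
    by rewrite normr0 lee_fin.
  have mc : measurable_fun setT (cst 0 : X -> \bar R) by exact: measurable_cst.
  have [_ _] := @dominated_convergence _ _ _ (point_measure w) setT measurableT _ _ (EFin \o v) mind mc hf hi hb.
  by rewrite integral_cst// mul0e.
have cvf : (fun m => fine (a (r m))) @ \oo --> (0%R : R).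
  by apply: fine_cvg; exact: cva.
have cve : (fun m => expR (fine (a (r m)))) @ \oo --> (1%R : R).
  by rewrite -[X in _ --> X]expR0; apply: continuous_cvg => //; exact: continuous_expR.
have cvD : (fun m => D (r m)) @ \oo --> (1%R : R).
  apply: (@squeeze_cvgr _ _ _ _ (fun m => 1 - (expR (fine (a (r m))) - 1))%R
    (fun m => 1 + (expR (fine (a (r m))) - 1))%R).
  - by apply: nearW => m; have := D_near1 (afin m); rewrite ler_norml => /andP[]; lra.
  - rewrite -[X in _ --> X]subr0 -[X in (_ - X)%R](subrr 1%R); apply: cvgB; first exact: cvg_cst.
    by apply: cvgB => //; exact: cvg_cst.
  - rewrite -[X in _ --> X]addr0 -[X in (_ + X)%R](subrr 1%R); apply: cvgD; first exact: cvg_cst.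
    by apply: cvgB => //; exact: cvg_cst.
have cvDe : (fun m => D (r m) * expR (fine (a (r m))))%R @ \oo --> (1%R : R).
  by rewrite -[X in _ --> X]mulr1; exact: cvgM.
have De1 : (D w * expR (fine (a w)) = 1)%R.
  have cst : (fun m => D (r m) * expR (fine (a (r m))))%R @ \oo --> (D w * expR (fine (a w)))%R.
    rewrite (_ : (fun m => _) = fun=> (D w * expR (fine (a w)))%R); first exact: cvg_cst.
    by apply/funext => m; rewrite -Dinv.
  exact: cvg_unique cst cvDe.
have Dw : D w = expR (- fine (a w)).
  by rewrite expRN -[RHS]mul1r -De1 mulfK// gt_eqF// expR_gt0.
rewrite -[LHS]fineK ?ps_fin// -[X in X + _]fineK ?ps_fin// -EFinD -Dw /D; congr EFin.
by rewrite addrC subrK.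
Qed.

End product_formula.
End factorial_sums.

(** * The iterated Mecke formula *)

Lemma measurable_tcons_fun dT dX (T : measurableType dT) (X : measurableType dX) n
    (f : T -> X) (g : T -> n.-tuple X) :
  measurable_fun setT f -> measurable_fun setT g ->
  measurable_fun setT (fun z => tcons (f z, g z)).
Proof. exact: measurable_cons. Qed.

Section distinct_sums.
Context d (R : realType) (X : borelMetricType d R).
Hypothesis X_sigma_compact : sigma_compact X.
Local Open Scope ereal_scope.

(** As in factorial_sum, over n-tuples of distinct points; here F also
    receives the configuration that is left after their removal, as in the
    Mecke formula. *)
Fixpoint distinct_sum n : (config X * n.-tuple X -> \bar R) -> config X -> \bar R :=
  match n with
  | 0 => fun F w => F (w, [tuple])
  | n'.+1 => fun F w => \int[point_measure w]_x
      distinct_sum (fun q : config X * n'.-tuple X => F (q.1, tcons (x, q.2))) (rmpt w x)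
  end.

Lemma measurable_distinct_sum n dT (T : measurableType dT)
    (F : (T * config X) * n.-tuple X -> \bar R) :
  measurable_fun setT F -> (forall z, 0 <= F z) ->
  measurable_fun setT (fun z : T * config X =>
    distinct_sum (fun q => F ((z.1, q.1), q.2)) z.2) /\
  (forall z : T * config X, 0 <= distinct_sum (fun q => F ((z.1, q.1), q.2)) z.2).
Proof.
elim: n dT T F => [|n IH] dT T F mF F0 /=.
  split => //.
  have mg : measurable_fun setT
      (fun z : T * config X => ((z.1, z.2), [tuple] : 0.-tuple X)).
    by apply: measurable_fun_pair => //; exact: measurable_fun_pair.
  exact: (measurableT_comp mF mg).
pose F' (q : ((T * X) * config X) * n.-tuple X) : \bar R :=
  F ((q.1.1.1, q.1.2), tcons (q.1.1.2, q.2)).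
have mF' : measurable_fun setT F'.
  have m11 : measurable_fun setT (fun q : ((T * X) * config X) * n.-tuple X => q.1.1).
    exact: measurableT_comp.
  apply: (measurableT_comp mF) => /=; apply: measurable_fun_pair.
    apply: measurable_fun_pair; last exact: measurableT_comp.
    exact: (measurableT_comp measurable_fst m11).
  apply: measurable_tcons_fun; last exact: measurable_snd.
  exact: (measurableT_comp measurable_snd m11).
have [mS S0] := IH _ _ F' mF' (fun q => F0 _).
split; last first.
  by move=> [t w] /=; apply: integral_ge0 => x _; exact: (S0 ((t, x), rmpt w x)).
apply: (@measurable_config_integral _ _ _ X_sigma_compact _ _ snd _
  (fun q : (T * config X) * X => distinct_sum
     (fun q' : config X * n.-tuple X => F ((q.1.1, q'.1), tcons (q.2, q'.2))) (rmpt q.1.2 q.2))) => //.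
  apply: (measurableT_comp mS (g := fun q : (T * config X) * X => ((q.1.1, q.2), rmpt q.1.2 q.2))).
  apply: measurable_fun_pair.
    by apply: measurable_fun_pair => //; exact: measurableT_comp.
  by apply: measurable_rmpt => //; exact: measurableT_comp.
by move=> [[t w] x]; exact: (S0 ((t, x), rmpt w x)).
Qed.

Let slice n (F : config X * n.+1.-tuple X -> \bar R) (x : X) :=
  fun q : config X * n.-tuple X => F (q.1, tcons (x, q.2)).

Let measurable_slice2 n (F : config X * n.+1.-tuple X -> \bar R) : measurable_fun setT F ->
  measurable_fun setT (fun q : (X * config X) * n.-tuple X => F (q.1.2, tcons (q.1.1, q.2))).
Proof.
move=> mF; apply: (measurableT_comp mF) => /=; apply: measurable_fun_pair.
  exact: measurableT_comp.
by apply: measurable_tcons_fun; [exact: measurableT_comp|exact: measurable_snd].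
Qed.

Let measurable_slice n (F : config X * n.+1.-tuple X -> \bar R) x : measurable_fun setT F ->
  measurable_fun setT (slice F x).
Proof.
move=> mF; apply: (measurableT_comp mF) => /=; apply: measurable_fun_pair => //.
by apply: measurable_tcons_fun; [exact: measurable_cst|exact: measurable_snd].
Qed.

Let measurable_dslice n (F : config X * n.+1.-tuple X -> \bar R) :
  measurable_fun setT F -> (forall z, 0 <= F z) ->
  measurable_fun setT (fun z : X * config X => distinct_sum (slice F z.1) z.2) /\
  (forall z : X * config X, 0 <= distinct_sum (slice F z.1) z.2).
Proof.
by move=> mF F0; exact: (measurable_distinct_sum (measurable_slice2 mF) (fun q => F0 _)).
Qed.

Let measurable_integrand n (F : config X * n.+1.-tuple X -> \bar R) w :
  measurable_fun setT F -> (forall z, 0 <= F z) ->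
  measurable_fun setT (fun x => distinct_sum (slice F x) (rmpt w x)).
Proof.
move=> mF F0; have [mS _] := measurable_dslice mF F0.
apply: (measurableT_comp mS (g := fun x => (x, rmpt w x))).
apply: measurable_fun_pair => //.
exact: (measurable_rmpt X_sigma_compact (f := cst w) (g := id)).
Qed.

(** The configurations and tuples that occur in the sum put together give w
    again. *)
Lemma eq_distinct_sum n (F G : config X * n.-tuple X -> \bar R) w :
  measurable_fun setT F -> (forall z, 0 <= F z) ->
  measurable_fun setT G -> (forall z, 0 <= G z) ->
  (forall w' s, points w' `|` [set x | x \in s] = points w -> F (w', s) = G (w', s)) ->
  distinct_sum F w = distinct_sum G w.
Proof.
elim: n F G w => [|n IH] F G w mF F0 mG G0 FG /=.
  by apply: FG; apply/seteqP; split => [x []//|x]; left.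
apply: eq_integral_points; [exact: measurable_integrand|exact: measurable_integrand|].
move=> x wx; apply: IH; [exact: measurable_slice|by move=> ?|exact: measurable_slice|by move=> ?|].
move=> w' s w's; apply: FG; apply/seteqP; split => y /=.
  rewrite inE => -[w'y|/predU1P[->//|ys]].
    have : (points (rmpt w x)) y by rewrite -w's; left.
    by case.
  have : (points (rmpt w x)) y by rewrite -w's; right.
  by case.
move=> wy; have [->|yx] := pselect (y = x); first by right; rewrite mem_head.
have : (points (rmpt w x)) y by split.
by rewrite -w's => -[?|/= ys]; [left|right; rewrite inE ys orbT].
Qed.

Lemma distinct_sumZl n (k : R) (F : config X * n.-tuple X -> \bar R) w : (0 <= k)%R ->
  measurable_fun setT F -> (forall z, 0 <= F z) ->
  distinct_sum (fun q => k%:E * F q) w = k%:E * distinct_sum F w.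
Proof.
move=> k0; elim: n F w => [//|n IH] F w mF F0 /=.
rewrite -ge0_integralZl//; last 2 first.
- exact: measurable_integrand.
- by move=> x _; have [_ /(_ (x, rmpt w x))] := measurable_dslice mF F0.
apply: eq_integral => x _; apply: IH => //; exact: measurable_slice.
Qed.

Variables (sigma : {sigma_finite_measure set X -> \bar R}) (P : probability (config X) R).
Hypothesis P_poisson : is_poisson_measure sigma P.

(** One use of the Mecke formula for each of the n points. *)
Lemma mecke_tuple n (F : config X * n.-tuple X -> \bar R) :
  measurable_fun setT F -> (forall z, 0 <= F z) ->
  \int[P]_w distinct_sum F w = \int[P]_w \int[power_measure sigma n]_s F (w, s).
Proof.
elim: n F => [|n IH] F mF F0 /=.
  apply: eq_integral => w _; rewrite integral_dirac//; first by rewrite diracT mul1e.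
  exact: (measurableT_comp mF (pair1_measurable w)).
have [mS S0] := measurable_dslice mF F0.
have mS' : measurable_fun setT (fun z : config X * X => distinct_sum (slice F z.2) z.1).
  exact: (measurableT_comp mS (measurable_fun_pair measurable_snd measurable_fst)).
rewrite (mecke X_sigma_compact P_poisson mS') => [|z]; last exact: (S0 (z.2, z.1)).
rewrite (fubini_tonelli _ mS') => [|z]; last exact: (S0 (z.2, z.1)).
under eq_integral => x _ do rewrite (IH (slice F x) (measurable_slice x mF) (fun q => F0 _)).
have mI : measurable_fun setT (fun z : config X * X =>
    \int[power_measure sigma n]_s F (z.1, tcons (z.2, s))).
  apply: (measurable_fun_fubini_tonelli_F (m2 := power_measure sigma n)
    (fun q : (config X * X) * n.-tuple X => F (q.1.1, tcons (q.1.2, q.2)))) => //.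
  apply: (measurableT_comp mF) => /=; apply: measurable_fun_pair.
    exact: measurableT_comp.
  by apply: measurable_tcons_fun; [exact: measurableT_comp|exact: measurable_snd].
rewrite -(fubini_tonelli (fun z : config X * X =>
    \int[power_measure sigma n]_s F (z.1, tcons (z.2, s))))//; last first.
  by move=> z; exact: integral_ge0.
apply: eq_integral => w _; rewrite -(@integral_power_measureS _ _ _ sigma n (fun s => F (w, s)))//.
exact: (measurableT_comp mF (pair1_measurable w)).
Qed.

End distinct_sums.

(** * Null sets and the addition of points *)

Section add_points.
Context d (R : realType) (X : borelMetricType d R).
Hypothesis X_sigma_compact : sigma_compact X.
Variable n : nat.
Implicit Types (w : config X) (t : n.-tuple X) (l : seq 'I_n).

Definition addpts w t l : config X := foldr (fun i w' => addpt w' (tnth t i)) w l.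

Lemma points_addpts w t l x :
  points (addpts w t l) x <-> points w x \/ exists2 i, i \in l & x = tnth t i.
Proof.
elim: l => [|i l IH]; first by split; [left|move=> [//|[]]].
have E : points (addpts w t (i :: l)) x <-> points (addpts w t l) x \/ x = tnth t i by [].
split=> [/E[/IH[wx|[j jl ->]]|->]|[wx|[j]]].
- by left.
- by right; exists j => //; rewrite inE jl orbT.
- by right; exists i => //; rewrite mem_head.
- by apply/E; left; apply/IH; left.
- rewrite inE => /predU1P[-> xE|jl xE]; apply/E; first by right.
  by left; apply/IH; right; exists j.
Qed.

Lemma measurable_addpts l :
  measurable_fun setT (fun z : config X * n.-tuple X => addpts z.1 z.2 l).
Proof.
elim: l => /= [|i l IH]; first exact: measurable_fst.
apply: measurable_addpt => //.
exact: (measurableT_comp (measurable_tnth i) measurable_snd).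
Qed.

Lemma addpts_upd w t i x l : i \notin l -> addpts w (upd t i x) l = addpts w t l.
Proof.
elim: l => //= j l IH; rewrite inE negb_or => /andP[ij il].
by rewrite IH// tnth_upd eq_sym (negPf ij).
Qed.

End add_points.

Lemma measurable_add_points d (R : realType) (X : borelMetricType d R)
    (X_sigma_compact : sigma_compact X) n k (a : seq 'I_n) (c : k.-tuple 'I_n) :
  measurable_fun setT (fun z : config X * n.-tuple X =>
    (addpts z.1 z.2 a, map_tuple (tnth z.2) c)).
Proof.
apply: measurable_fun_pair; first exact: measurable_addpts.
apply/measurable_fun_tnthP => i.
rewrite (_ : _ \o _ = fun z => tnth z.2 (tnth c i)).
  exact: (measurableT_comp (measurable_tnth _) measurable_snd).
by apply/funext => z /=; rewrite tnth_map.
Qed.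

Section null_sets.
Context d (R : realType) (X : borelMetricType d R).
Hypothesis X_sigma_compact : sigma_compact X.
Variables (sigma : {sigma_finite_measure set X -> \bar R}) (P : probability (config X) R).
Hypothesis P_poisson : is_poisson_measure sigma P.
Local Open Scope ereal_scope.

Lemma integrate_coords_cst n (l : seq 'I_n) :
  exists2 k : \bar R, 0 <= k & forall z : config X * n.-tuple X,
    integrate_coords sigma l (fun=> 1) z = k.
Proof.
elim: l => [|i l [k k0 Hk]]; first by exists 1.
exists (k * sigma setT); first exact: mule_ge0.
by move=> z /=; rewrite /integrate_coord; under eq_integral do rewrite Hk; rewrite integral_cst.
Qed.

Lemma integral_power_coords n (l : seq 'I_n) (F : config X * n.-tuple X -> \bar R) w t :
  measurable_fun setT F -> (forall z, 0 <= F z) -> perm_eq l (enum 'I_n) ->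
  \int[power_measure sigma n]_s F (w, s) = integrate_coords sigma l F (w, t).
Proof.
move=> mF F0 ln; rewrite (perm_integrate_coords sigma mF F0 ln) -val_ord_tuple.
rewrite -(integrate_coords_power sigma (c := ord_tuple n) (F := fun s => F (w, s)) (w, t))//.
- apply: eq_integrate_coords => t' _ /=; congr (F (w, _)).
  by apply: eq_from_tnth => i; rewrite tnth_map tnth_ord_tuple.
- exact: (measurableT_comp mF (pair1_measurable w)).
- by rewrite val_ord_tuple enum_uniq.
Qed.

Lemma integral_product_coords n (l : seq 'I_n) (F : config X * n.-tuple X -> \bar R) t :
  measurable_fun setT F -> (forall z, 0 <= F z) -> perm_eq l (enum 'I_n) ->
  \int[P \x power_measure sigma n]_z F z = \int[P]_w integrate_coords sigma l F (w, t).
Proof.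
move=> mF F0 ln; rewrite fubini_tonelli1//; apply: eq_integral => w _.
exact: integral_power_coords.
Qed.

Let indic_ge0 dT (T : measurableType dT) (N : set T) z : 0 <= (\1_N z)%:E :> \bar R.
Proof. by rewrite lee_fin. Qed.

(** The coordinate i is integrated first; the order of integration is free. *)
Lemma null_coord n (i : 'I_n) (N : set (config X * n.-tuple X)) : measurable N ->
  (forall z, integrate_coord sigma i (EFin \o \1_N) z = 0) ->
  (P \x power_measure sigma n) N = 0.
Proof.
move=> mN Ni.
have mI : measurable_fun setT (EFin \o \1_N : _ -> \bar R).
  by apply/measurable_EFinP; exact: measurable_indic.
have I0 z : 0 <= (EFin \o \1_N) z :> \bar R by exact: indic_ge0.
have -> : (P \x power_measure sigma n) N = \int[P \x power_measure sigma n]_z (EFin \o \1_N) z.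
  by rewrite integral_indic// setIT.
rewrite (@integral_product_coords _ (rcons (rem i (enum 'I_n)) i) _ (nseq_tuple n point))//; last first.
  by rewrite perm_rcons perm_sym perm_to_rem// mem_enum.
rewrite -cats1.
rewrite integral0_eq// => w _; rewrite integrate_coords_cat.
rewrite (_ : integrate_coords sigma [:: i] _ = cst 0); last by apply/funext => z; exact: Ni.
by elim: (rem _ _) (nseq_tuple _ _) => //= j l IH t; rewrite /integrate_coord integral0_eq.
Qed.

(** Adding a point cannot charge a null set: by the Mecke formula, the mean of
    the integral of Psi (addpt w x) over x is the mean of Psi w times the
    number of points of w. The points of a are added one by one. *)
Lemma add_points_null k (N : set (config X * k.-tuple X)) n (a : seq 'I_n) (c : k.-tuple 'I_n) t :
  measurable N -> (P \x power_measure sigma k) N = 0 -> uniq (a ++ c) ->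
  \int[P]_w integrate_coords sigma (a ++ c)
    (fun z => (\1_N (addpts z.1 z.2 a, map_tuple (tnth z.2) c))%:E) (w, t) = 0.
Proof.
move=> mN N0.
have mIN : measurable_fun setT (fun z => (\1_N z)%:E : \bar R).
  by apply/measurable_EFinP; exact: measurable_indic.
have mPhi b : measurable_fun setT
    (fun z : config X * n.-tuple X => (\1_N (addpts z.1 z.2 b, map_tuple (tnth z.2) c))%:E : \bar R).
  exact: (measurableT_comp mIN (measurable_add_points X_sigma_compact b c)).
elim: a => [|i a IH] /=.
  move=> uc; transitivity (\int[P]_w \int[power_measure sigma k]_s (\1_N (w, s))%:E).
    apply: eq_integral => w _.
    rewrite -(integrate_coords_power sigma (c := c) (F := fun s => (\1_N (w, s))%:E) (w, t))//.
      by apply: eq_integrate_coords.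
    exact: (measurableT_comp mIN (pair1_measurable w)).
  rewrite -(fubini_tonelli1 (fun z => (\1_N z)%:E))// -[RHS]N0.
  by rewrite integral_indic// setIT.
move=> /andP[ia uac].
pose Phi b (z : config X * n.-tuple X) : \bar R := (\1_N (addpts z.1 z.2 b, map_tuple (tnth z.2) c))%:E.
pose Psi w := integrate_coords sigma (a ++ c) (Phi a) (w, t).
have Psi0 w : 0 <= Psi w by apply: integrate_coords_ge0 => z; exact: indic_ge0.
have mPsi : measurable_fun setT Psi.
  apply: (measurableT_comp _ (pair2_measurable t)).
  by apply: measurable_integrate_coords; [exact: mPhi|move=> z; exact: indic_ge0].
have PsiE w : integrate_coord sigma i (integrate_coords sigma (a ++ c) (Phi (i :: a))) (w, t) =
    \int[sigma]_x Psi (addpt w x).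
  apply: eq_integral => x _ /=.
  transitivity (integrate_coords sigma (a ++ c) (fun z => Phi a (addpt z.1 x, z.2)) (w, upd t i x)).
    apply: eq_integrate_coords => t' t't; rewrite /Phi /=; congr (\1_N (_, _))%:E.
    rewrite t't// tnth_upd eqxx; apply: config_eq; apply/seteqP; split => y.
      move=> [/points_addpts[wy|[j ja ->]]|->]; apply/points_addpts.
      - by left; left.
      - by right; exists j.
      - by left; right.
    move=> /points_addpts[[wy|->]|[j ja ->]].
    - by left; apply/points_addpts; left.
    - by right.
    - by left; apply/points_addpts; right; exists j.
  rewrite (integrate_coords_param sigma (fun w => addpt w x)) /=.
  apply: (@integrate_coords_indep _ _ _ _ _ _ sigma (a ++ c) i) => w' t' y.
  move: ia; rewrite mem_cat negb_or => /andP[ia ic].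
  rewrite /Phi /= addpts_upd//; congr (\1_N (_, _))%:E.
  apply: eq_from_tnth => j; rewrite [LHS]tnth_map [RHS]tnth_map tnth_upd.
  by case: eqP => // ji; move: ic; rewrite -ji mem_tnth.
under eq_integral do rewrite -/(Phi (i :: a)) PsiE.
rewrite -(mecke_add X_sigma_compact P_poisson (F := fun z => Psi z.1))//; last first.
  exact: measurableT_comp.
have Psi_ae : ae_eq P setT Psi (cst 0).
  apply/ae_eq_integral_abs => //; rewrite -[RHS](IH uac).
  by apply: eq_integral => w _; rewrite gee0_abs.
transitivity (\int[P]_w (cst 0 w : \bar R)); last by rewrite integral0.
apply: ae_eq_integral => //.
- by under eq_fun do rewrite /= integral_cst//; apply: emeasurable_funM => //; exact: measurable_point_measure.
- case: Psi_ae => M [mM M0 HM]; exists M; split => // w /= Hw; apply: HM => /= H; apply: Hw => _.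
  by apply: integral0_eq => x _; exact: H.
Qed.

(** The coordinates outside a and c contribute a constant factor, possibly
    infinite, in front of the integral of add_points_null. *)
Lemma add_points_null_full k (N : set (config X * k.-tuple X)) n (a : seq 'I_n) (c : k.-tuple 'I_n) :
  measurable N -> (P \x power_measure sigma k) N = 0 -> uniq (a ++ c) ->
  (P \x power_measure sigma n)
    [set z | N (addpts z.1 z.2 a, map_tuple (tnth z.2) c)] = 0.
Proof.
move=> mN N0 uac.
pose t : n.-tuple X := nseq_tuple n point.
pose rest := [seq i <- enum 'I_n | i \notin a ++ c].
pose Phi (z : config X * n.-tuple X) : \bar R :=
  (\1_N (addpts z.1 z.2 a, map_tuple (tnth z.2) c))%:E.
have mpair := measurable_add_points X_sigma_compact a c.
have mPhi : measurable_fun setT Phi.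
  have mIN : measurable_fun setT (fun z => (\1_N z)%:E : \bar R).
    by apply/measurable_EFinP; exact: measurable_indic.
  exact: (measurableT_comp mIN mpair).
have Phi0 z : 0 <= Phi z by exact: indic_ge0.
set N' := [set z | _].
have mN' : measurable N'.
  by have := mpair measurableT N mN; rewrite setTI.
have -> : (P \x power_measure sigma n) N' = \int[P \x power_measure sigma n]_z Phi z.
  rewrite (_ : Phi = EFin \o \1_N'); first by rewrite integral_indic// setIT.
  by apply/funext => z; rewrite /= !indicE; congr (_%:R%:E); apply/idP/idP; rewrite !inE.
rewrite (@integral_product_coords _ ((a ++ c) ++ rest) _ t)//; last first.
  apply: uniq_perm; [|exact: enum_uniq|].
    rewrite cat_uniq uac filter_uniq ?enum_uniq// andbT/=.
    by apply/hasPn => i; rewrite mem_filter => /andP[].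
  by move=> i; rewrite mem_cat mem_filter mem_enum andbT orbN.
have [k0 k00 Hk] := @integrate_coords_cst n rest.
have restE : integrate_coords sigma rest Phi = fun z => k0 * Phi z.
  apply/funext => z; rewrite muleC -(Hk z) -integrate_coordsZl//.
  - by congr integrate_coords; apply/funext => z'; rewrite mule1.
  - move=> i; rewrite mem_filter mem_cat negb_or => /andP[/andP[ia ic] _] w t' x.
    rewrite /Phi /= addpts_upd//; congr (\1_N (_, _))%:E.
    apply: eq_from_tnth => j; rewrite [LHS]tnth_map [RHS]tnth_map tnth_upd.
    by case: eqP => // ji; move: ic; rewrite -ji mem_tnth.
under eq_integral => w _.
  rewrite integrate_coords_cat restE (integrate_coordsZl sigma (H := fun=> k0))//; over.
rewrite ge0_integralZl//; last 2 first.
- apply: (measurableT_comp _ (pair2_measurable t)).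
  exact: measurable_integrate_coords.
- by move=> w _; exact: integrate_coords_ge0.
by rewrite add_points_null// mule0.
Qed.

End null_sets.

(** * Correlation integrals of a cyclic process *)

Lemma ae_forall_countable d (T : measurableType d) (R : realType)
    (m : {measure set T -> \bar R}) (I : countType) (Q : I -> T -> Prop) :
  (forall i, {ae m, forall z, Q i z}) -> {ae m, forall z, forall i, Q i z}.
Proof.
move=> HQ; pose Q' n z := if choice.unpickle n is Some i then Q i z else True.
have : {ae m, forall z, forall n, Q' n z}.
  apply: ae_foralln => n; rewrite /Q'; case: (choice.unpickle n) => [i|]; first exact: HQ.
  exact: aeW.
by apply: filterS => z H i; have := H (choice.pickle i); rewrite /Q' choice.pickleK.
Qed.

Section cyclic_identity.
Context d (R : realType) (X : borelMetricType d R).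
Hypothesis X_sigma_compact : sigma_compact X.
Variables (sigma : {sigma_finite_measure set X -> \bar R}) (P : probability (config X) R).
Hypotheses (P_poisson : is_poisson_measure sigma P) (sigma_diffuse : diffuse sigma).
Local Open Scope ereal_scope.

Variable G : config X -> X -> R.
Hypotheses (mG : measurable_fun setT (fun z : config X * X => G z.1 z.2))
  (G0 : forall w x, (0 <= G w x)%R)
  (G_cyclic : forall k, (2 <= k)%N -> cyclic_condition P sigma G k).
Variable c : R.
Hypothesis G_int : forall w, \int[sigma]_x (G w x)%:E = c%:E.

Let c_ge0 : (0 <= c)%R.
Proof.
by rewrite -lee_fin -(G_int point); apply: integral_ge0 => x _; rewrite lee_fin.
Qed.

(** Removing x makes the value at x insensitive to the presence of x, as in
    the integrand of a Skorohod integral; it differs from G w x for x in w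
    only, a null set. *)
Definition predictable (w : config X) (x : X) : R := G (rmpt w x) x.

Lemma measurable_predictable dT (T : measurableType dT) (f : T -> config X) (g : T -> X) :
  measurable_fun setT f -> measurable_fun setT g ->
  measurable_fun setT (fun z => predictable (f z) (g z)).
Proof.
move=> mf mg.
have mfg : measurable_fun setT (fun z => (rmpt (f z) (g z), g z)).
  by apply: measurable_fun_pair => //; exact: measurable_rmpt.
exact: (measurableT_comp mG mfg).
Qed.

Lemma points_null w : sigma (points w) = 0.
Proof.
apply/negligibleP; first exact: measurable_points.
have /pcard_geP/surjPex[e ew] := config_countable w.
apply: (@negligibleS _ _ _ _ (\bigcup_m [set e m])).
  by move=> x /ew [m _ <-]; exists m.
apply: negligible_bigcup => m; apply/negligibleP; first exact: measurable_singleton.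
exact: sigma_diffuse.
Qed.

Lemma predictable_int w : \int[sigma]_x (predictable w x)%:E = c%:E.
Proof.
rewrite -(G_int w); apply: ae_eq_integral => //.
- apply/measurable_EFinP.
  exact: (measurable_predictable (f := cst w) (g := id)).
- by apply/measurable_EFinP; exact: (measurableT_comp mG (pair1_measurable w)).
exists (points w); split; [exact: measurable_points|exact: points_null|].
by move=> x /= H; apply: contrapT => wx; apply: H => _; rewrite /predictable rmpt_id.
Qed.

Definition shifted n (A : {set 'I_n}) (p : 'I_n) (z : config X * n.-tuple X) : R :=
  predictable (addpts z.1 z.2 (enum A)) (tnth z.2 p).

Lemma measurable_shifted n (A : {set 'I_n}) p : measurable_fun setT (shifted A p).
Proof.
apply: measurable_predictable; first exact: measurable_addpts.
exact: (measurableT_comp (measurable_tnth _) measurable_snd).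
Qed.

Lemma shifted_ge0 n (A : {set 'I_n}) p z : (0 <= shifted A p z)%R.
Proof. exact: G0. Qed.

(** The properties that fail on a null set only: the points of the tuple are
    distinct and not in w, and all cyclic identities hold along them after any
    addition of other points of the tuple. The points added are distinct from
    those of the cycle, which is all that has_sinks asks for. *)
Let general_position n (z : config X * n.-tuple X) :=
  [/\ forall i, ~ points z.1 (tnth z.2 i),
      forall i j, i != j -> tnth z.2 i <> tnth z.2 j &
      forall k (e : k.-tuple 'I_n) (A : {set 'I_n}), (2 <= k)%N -> uniq e ->
        (forall i, i \in e -> i \notin A) ->
        (\prod_(i < k) diffop (tnth (map_tuple (tnth z.2) e) i)
          (fun w => G w (tnth (map_tuple (tnth z.2) e) (ordS i)))
          (addpts z.1 z.2 (enum A)) = 0)%R].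

Let ordS_neq k (i : 'I_k) : (2 <= k)%N -> ordS i != i.
Proof.
move=> k2; apply/eqP => /(congr1 val) /=.
have := ltn_ord i; rewrite leq_eqVlt => /orP[/eqP ik|ik]; last first.
  by rewrite modn_small// => /eqP; rewrite -addn1 -{2}[val i]addn0 eqn_add2l.
by rewrite ik modnn => i0; move: k2; rewrite -ik -i0.
Qed.

Let addpts_setU1 n w (t : n.-tuple X) (i : 'I_n) (B : {set 'I_n}) :
  addpts w t (enum (i |: B)) = addpt (addpts w t (enum B)) (tnth t i).
Proof.
apply: config_eq; apply/seteqP; split => x.
  move=> /points_addpts[wx|[j]]; first by left; apply/points_addpts; left.
  rewrite mem_enum !inE => /predU1P[-> xj|jB xj]; first by right.
  by left; apply/points_addpts; right; exists j => //; rewrite mem_enum.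
move=> [/points_addpts[wx|[j jB xj]]|xi]; apply/points_addpts.
- by left.
- by right; exists j => //; move: jB; rewrite !mem_enum !inE => ->; rewrite orbT.
- by right; exists i => //; rewrite mem_enum !inE eqxx.
Qed.

Let shifted_self n (B : {set 'I_n}) i z : shifted (i |: B) i z = shifted B i z.
Proof.
rewrite /shifted /predictable addpts_setU1; congr (G _ _); apply: config_eq.
apply/seteqP; split => x /=; first by move=> [[//|xi] nxi].
by move=> [H nxi]; split => //; left.
Qed.

(** Draw an arrow from i to p when adding the point i changes the value at the
    point p. A cycle of arrows would be a nonvanishing product in the cyclic
    condition, so no_cycle_sink applies. *)
Let general_position_sinks n (z : config X * n.-tuple X) : general_position z ->
  has_sinks (fun p A => shifted A p z).
Proof.
move=> [zw ztt zcyc] J B J0 JB.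
have notin (p : 'I_n) : p \notin B -> ~ points (addpts z.1 z.2 (enum B)) (tnth z.2 p).
  move=> pB /points_addpts[/zw//|[j]]; rewrite mem_enum => jB.
  by apply: ztt; apply: contraNneq pB => ->.
suff noc : forall k (e : k.-tuple 'I_n), (2 <= k)%N -> uniq e -> {subset e <= J} ->
    ~ (forall i, shifted (tnth e i |: B) (tnth e (ordS i)) z !=
         shifted B (tnth e (ordS i)) z).
  have [i iJ Hi] := no_cycle_sink (e := fun i p => shifted (i |: B) p z != shifted B p z) J0 noc.
  exists i => // p pJ; have [->|pi] := eqVneq p i; first exact: shifted_self.
  by have := Hi p pJ pi; rewrite negbK => /eqP.
move=> k e k2 ue eJ He.
have eB i : i \in e -> i \notin B by move=> /eJ iJ; rewrite (disjointFr JB).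
have /eqP := zcyc k e B k2 ue eB; rewrite prodf_seq_eq0 => /hasP[i _ /=].
rewrite /diffop subr_eq0 => /eqP Hi; have /eqP := He i; apply.
rewrite /shifted /predictable addpts_setU1 rmpt_id; last first.
  move=> [/=|/= E]; first by apply: notin; apply: eB; exact: mem_tnth.
  apply: (ztt (tnth e (ordS i)) (tnth e i)) => //.
  apply/eqP; move/tuple_uniqP : (ue) => inj_e /inj_e ei.
  by have := ordS_neq i k2; rewrite ei eqxx.
rewrite rmpt_id; last by apply: notin; apply: eB; exact: mem_tnth.
by move: Hi; rewrite !tnth_map.
Qed.

Let ae_general_position n : {ae P \x power_measure sigma n, forall z, general_position z}.
Proof.
have H1 : {ae P \x power_measure sigma n, forall z : config X * n.-tuple X,
    forall i, ~ points z.1 (tnth z.2 i)}.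
  apply: ae_forall_countable => i.
  have mf : measurable_fun setT (fun z : config X * n.-tuple X => (z.1, tnth z.2 i)).
    apply: measurable_fun_pair => //.
    exact: (measurableT_comp (measurable_tnth _) measurable_snd).
  have mN := mf measurableT _ (measurable_mem_config X_sigma_compact).
  rewrite setTI in mN.
  exists ((fun z : config X * n.-tuple X => (z.1, tnth z.2 i)) @^-1` [set z | points z.1 z.2]).
  split => //; last by move=> z /= /contrapT.
  apply: (null_coord P (i := i)) => // -[w t]; rewrite /integrate_coord /=.
  transitivity (\int[sigma]_x (\1_(points w) x)%:E : \bar R).
    apply: eq_integral => x _; rewrite !indicE; congr ((nat_of_bool _)%:R%:E).
    by apply/idP/idP; rewrite !inE/= tnth_upd eqxx.
  by rewrite integral_indic ?setIT; [exact: points_null|by []|exact: measurable_points].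
have H2 : {ae P \x power_measure sigma n, forall z : config X * n.-tuple X,
    forall i j, i != j -> tnth z.2 i <> tnth z.2 j}.
  apply: ae_forall_countable => i; apply: ae_forall_countable => j.
  have [->|ij] := eqVneq i j; first exact: aeW.
  have mf : measurable_fun setT (fun z : config X * n.-tuple X =>
      (addpt point (tnth z.2 i), tnth z.2 j)).
    apply: measurable_fun_pair; last exact: (measurableT_comp (measurable_tnth _) measurable_snd).
    apply: (measurable_addpt X_sigma_compact (f := cst point)) => //.
    exact: (measurableT_comp (measurable_tnth _) measurable_snd).
  have mN := mf measurableT _ (measurable_mem_config X_sigma_compact).
  rewrite setTI in mN.
  set N := (X in measurable X) in mN.
  have NE z : N z <-> tnth z.2 j = tnth z.2 i.
    by split=> [[//|//]|]; right.
  exists N; split => //; last by move=> z /= H; apply/NE; apply: contrapT => E; apply: H => _ /esym.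
  apply: (null_coord P (i := i)) => // -[w t]; rewrite /integrate_coord /=.
  transitivity (\int[sigma]_x (\1_[set tnth t j] x)%:E : \bar R).
    apply: eq_integral => x _; rewrite !indicE; congr ((nat_of_bool _)%:R%:E).
    apply/idP/idP; rewrite !inE.
      by move/NE; rewrite /= !tnth_upd eqxx eq_sym (negPf ij) => ->.
    by move=> /= ->; apply/NE; rewrite /= !tnth_upd eqxx eq_sym (negPf ij).
  by rewrite integral_indic ?setIT; [exact: sigma_diffuse|by []|exact: measurable_singleton].
have H3 : {ae P \x power_measure sigma n, forall z : config X * n.-tuple X,
    forall k (e : k.-tuple 'I_n) (A : {set 'I_n}), (2 <= k)%N -> uniq e ->
        (forall i, i \in e -> i \notin A) ->
        (\prod_(i < k) diffop (tnth (map_tuple (tnth z.2) e) i)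
          (fun w => G w (tnth (map_tuple (tnth z.2) e) (ordS i)))
          (addpts z.1 z.2 (enum A)) = 0)%R}.
  apply: ae_forall_countable => k; apply: ae_forall_countable => e; apply: ae_forall_countable => A.
  have [k2|k2] := boolP (2 <= k)%N; last exact: aeW.
  have [ue|ue] := boolP (uniq e); last exact: aeW.
  have [eA|eA] := boolP [forall i, (i \in e) ==> (i \notin A)]; last first.
    apply: aeW => z _ _ H; exfalso; move/negP: eA; apply; apply/forallP => i.
    by apply/implyP; exact: H.
  have [N [mN N0 HN]] := G_cyclic k2.
  exists [set z | N (addpts z.1 z.2 (enum A), map_tuple (tnth z.2) e)]; split.
  - have := measurable_add_points X_sigma_compact (enum A) e measurableT mN.
    by rewrite setTI.
  - apply: (add_points_null_full X_sigma_compact P_poisson) => //.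
    rewrite cat_uniq enum_uniq ue andbT; apply/hasPn => i ie; rewrite /= mem_enum.
    by have := forallP eA i; rewrite ie.
  - by move=> z /= Hz; apply: HN => /= H; apply: Hz => _ _ _.
by apply: filterS3 H1 H2 H3 => z h1 h2 h3; split.
Qed.

Definition shifted_prod n (A : {set 'I_n}) (z : config X * n.-tuple X) : R := (\prod_(p < n) shifted A p z)%R.

Lemma shifted_prod_ge0 n (A : {set 'I_n}) z : 0 <= (shifted_prod A z)%:E.
Proof. by rewrite lee_fin prodr_ge0// => p _; exact: shifted_ge0. Qed.

Lemma measurable_shifted_prod n (A : {set 'I_n}) : measurable_fun setT (fun z => (shifted_prod A z)%:E).
Proof.
apply/measurable_EFinP; apply: measurable_prod => p _; exact: measurable_shifted.
Qed.

(** The term of order n of the expansion of the Laplace transform, after the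
    iterated Mecke formula: each of the n values sees the configuration
    enlarged by all n points. *)
Definition correlation n := \int[P \x power_measure sigma n]_z (shifted_prod [set: 'I_n] z)%:E.

Let shifted_upd n (A : {set 'I_n}) p i w t x : i \notin A -> i != p ->
  shifted A p (w, upd t i x) = shifted A p (w, t).
Proof.
move=> iA ip; rewrite /shifted /= tnth_upd eq_sym (negPf ip) addpts_upd//.
by rewrite mem_enum.
Qed.

(** A point whose index is not in A is not added to the configuration, so that
    integrating it affects one factor only and gives c, whatever the
    configuration. *)
Let integrate_rest n (A : {set 'I_n}) (l : seq 'I_n) (H : config X * n.-tuple X -> R) z :
  measurable_fun setT H -> (forall z, (0 <= H z)%R) -> uniq l ->
  (forall i, i \in l -> i \notin A) ->
  (forall i w t x, i \in l -> H (w, upd t i x) = H (w, t)) ->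
  integrate_coords sigma l (fun z => (H z * \prod_(p <- l) shifted A p z)%:E) z =
  (H z * c ^+ size l)%:E.
Proof.
elim: l H z => [|i l IH] H z mH H0 /=; first by rewrite big_nil expr0.
move=> /andP[il ul] lA Hl.
have -> : (fun z => (H z * \prod_(p <- i :: l) shifted A p z)%:E) =
    (fun z => ((H z * shifted A i z) * \prod_(p <- l) shifted A p z)%:E).
  by apply/funext => z'; rewrite big_cons mulrA.
have -> : integrate_coords sigma l (fun z => ((H z * shifted A i z) * \prod_(p <- l) shifted A p z)%:E) =
    (fun z => (H z * shifted A i z * c ^+ size l)%:E).
  apply/funext => z'; apply: IH => //.
  - by apply: measurable_funM => //; exact: measurable_shifted.
  - by move=> z''; rewrite mulr_ge0// shifted_ge0.
  - by move=> j jl; apply: lA; rewrite inE jl orbT.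
  - move=> j w t x jl; rewrite Hl ?inE ?jl ?orbT// shifted_upd//.
      by apply: lA; rewrite inE jl orbT.
    by apply: contraNneq il => <-.
case: z => w t; rewrite /integrate_coord /=.
transitivity (\int[sigma]_x ((H (w, t) * c ^+ size l)%:E * (predictable (addpts w t (enum A)) x)%:E)).
  apply: eq_integral => x _; rewrite Hl ?mem_head// -EFinM; congr EFin.
  rewrite /shifted /= tnth_upd eqxx addpts_upd ?mem_enum ?lA ?mem_head//.
  by rewrite mulrAC.
rewrite ge0_integralZl//.
- by rewrite predictable_int -EFinM -mulrA -exprSr.
- apply/measurable_EFinP.
  exact: (measurable_predictable (f := cst (addpts w t (enum A))) (g := id)).
- by move=> x _; rewrite lee_fin G0.
- by rewrite lee_fin mulr_ge0// exprn_ge0// c_ge0.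
Qed.

(** The points outside A integrate to c each, and those of A give a
    correlation integral of lower order. *)
Let integral_shifted_prod n (A : {set 'I_n}) :
  \int[P \x power_measure sigma n]_z (shifted_prod A z)%:E = (c ^+ (n - #|A|))%:E * correlation #|A|.
Proof.
pose t : n.-tuple X := nseq_tuple n point.
have perm_l : perm_eq (enum A ++ enum (~: A)) (enum 'I_n).
  apply: uniq_perm; [|exact: enum_uniq|].
    rewrite cat_uniq !enum_uniq andbT/=; apply/hasPn => i.
    by rewrite !mem_enum !inE.
  by move=> i; rewrite mem_cat !mem_enum inE orbN.
rewrite (integral_product_coords sigma P t _ _ perm_l);
  [|exact: measurable_shifted_prod|exact: shifted_prod_ge0].
pose H (z : config X * n.-tuple X) := (\prod_(p <- enum A) shifted A p z)%R.
have mH : measurable_fun setT H.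
  by apply: measurable_prod => p _; exact: measurable_shifted.
have H0 z : (0 <= H z)%R by rewrite prodr_ge0// => p _; exact: shifted_ge0.
have KE : (fun z => (shifted_prod A z)%:E) = (fun z => (H z * \prod_(p <- enum (~: A)) shifted A p z)%:E).
  apply/funext => z; rewrite /shifted_prod /H !big_enum/= (bigID [in A])/=; congr (_ * _)%:E.
  by apply: eq_bigl => p; rewrite inE.
have inner : integrate_coords sigma (enum (~: A)) (fun z => (shifted_prod A z)%:E) =
    fun z => (c ^+ (n - #|A|))%:E * (H z)%:E.
  apply/funext => z; rewrite KE integrate_rest ?enum_uniq//.
  - rewrite -cardE -EFinM mulrC; congr ((_ ^+ _ * _)%R%:E).
    by rewrite [LHS]cardsCs finset.setCK card_ord.
  - by move=> i; rewrite mem_enum inE.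
  - move=> i w t' x; rewrite mem_enum inE => iA; apply: eq_big_seq => p.
    by rewrite mem_enum => pA; apply: shifted_upd => //; apply: contraNneq iA => ->.
have cn0 : 0 <= (c ^+ (n - #|A|))%:E by rewrite lee_fin exprn_ge0// c_ge0.
have mHE : measurable_fun setT (fun z => (H z)%:E) by exact/measurable_EFinP.
under eq_integral => w _.
  rewrite integrate_coords_cat inner (integrate_coordsZl sigma (H := fun=> (c ^+ (n - #|A|))%:E))//.
  over.
rewrite ge0_integralZl//; last 2 first.
- apply: (measurableT_comp _ (pair2_measurable t)).
  by apply: measurable_integrate_coords => // z; rewrite lee_fin.
- by move=> w _; apply: integrate_coords_ge0 => z; rewrite lee_fin.
congr (_ * _); rewrite /correlation fubini_tonelli1; [|exact: measurable_shifted_prod|exact: shifted_prod_ge0].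
apply: eq_integral => w _.
transitivity (\int[power_measure sigma #|A|]_s (shifted_prod [set: 'I_#|A|] (w, s))%:E); last by [].
rewrite -(integrate_coords_power sigma (c := enum_tuple A) (F := fun s => (shifted_prod [set: 'I_#|A|] (w, s))%:E) (w, t))//; first last.
- exact: enum_uniq.
- by move=> s; exact: shifted_prod_ge0.
- exact: (measurableT_comp (measurable_shifted_prod _) (pair1_measurable w)).
apply: eq_integrate_coords => t' _; congr EFin; rewrite /H /shifted_prod /=.
rewrite (big_tuple _ _ (enum_tuple A)); apply: eq_bigr => j _.
rewrite /shifted /= tnth_map; congr (predictable _ _).
apply: config_eq; apply/seteqP; split => x /points_addpts[wx|[i iA xi]]; apply/points_addpts.
- by left.
- right; have /tnthP[m im] : i \in enum_tuple A by [].
  by exists m; rewrite ?mem_enum ?inE// tnth_map -im.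
- by left.
- right; exists (tnth (enum_tuple A) i); first exact: mem_tnth.
  by rewrite xi tnth_map.
Qed.

Let card_parity n (b : bool) : (0 < n)%N ->
  (\sum_(A : {set 'I_n} | odd #|A| == b) 1 =
   \sum_(A : {set 'I_n} | odd #|A| != b) 1 :> R)%R.
Proof.
move=> n0.
have H : has_sinks (fun (_ : 'I_n) (_ : {set 'I_n}) => 1%R : R).
  by move=> J B /set0Pn[i iJ] _; exists i.
have := alternating_parity b H n0.
by rewrite !big1_eq.
Qed.

(** The alternating identity for n points in general position is integrated.
    By induction each subset other than the full one contributes c ^+ n up to
    its sign, and there are as many even as odd subsets, which leaves c ^+ n
    for the full one. *)
Lemma correlationE n : correlation n = (c ^+ n)%:E.
Proof.
elim/ltn_ind: n => n IH; case: (posnP n) => [->|n0].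
  have K0 z : shifted_prod [set: 'I_0] z = 1%R by rewrite /shifted_prod big_ord0.
  rewrite /correlation; under eq_integral do rewrite K0.
  rewrite integral_cst//= -setXTT product_measure1E//= probability_setT mul1e.
  by rewrite diracT expr0 mul1e.
pose b := odd n.
have sums : \sum_(A : {set 'I_n} | odd #|A| == b) \int[P \x power_measure sigma n]_z (shifted_prod A z)%:E =
    \sum_(A : {set 'I_n} | odd #|A| != b) \int[P \x power_measure sigma n]_z (shifted_prod A z)%:E.
  rewrite -[LHS]big_filter -[RHS]big_filter -!ge0_integral_sum//;
    try by move=> A; first [exact: measurable_shifted_prod|move=> *; exact: shifted_prod_ge0].
  apply: ae_eq_integral => //.
  - by apply: emeasurable_sum => A; exact: measurable_shifted_prod.
  - by apply: emeasurable_sum => A; exact: measurable_shifted_prod.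
  apply: filterS (ae_general_position n) => z zgp _.
  rewrite !big_filter !sumEFin; congr EFin.
  exact: (alternating_parity b (general_position_sinks zgp) n0).
have IA (A : {set 'I_n}) : A != [set: 'I_n]%SET ->
    \int[P \x power_measure sigma n]_z (shifted_prod A z)%:E = (c ^+ n)%:E.
  move=> AT; have An : (#|A| < n)%N.
    by rewrite -[X in (_ < X)%N]card_ord -cardsT proper_card// properT.
  by rewrite integral_shifted_prod (IH _ An) -EFinM -exprD subnK// ltnW.
have IT : \int[P \x power_measure sigma n]_z (shifted_prod [set: 'I_n] z)%:E = correlation n by [].
have oT : odd #|[set: 'I_n]%SET| == b by rewrite cardsT card_ord.
move: sums; rewrite (bigD1 [set: 'I_n]%SET)//= IT.
rewrite (eq_bigr (fun=> (c ^+ n)%:E)); last by move=> A /andP[_ /IA].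
rewrite [in X in _ = X -> _](eq_bigr (fun=> (c ^+ n)%:E)); last first.
  by move=> A Ab; apply: IA; apply: contraNneq Ab => ->.
rewrite !sumEFin => E.
have := congr1 (fun r => c ^+ n * r)%R (card_parity b n0).
rewrite (bigD1 [set: 'I_n]%SET)//= mulrDr mulr1 !mulr_sumr.
under eq_bigr do rewrite mulr1; under [in X in _ = X -> _]eq_bigr do rewrite mulr1.
move: E; set S := (\sum_(i | _ && _) _)%R => E S'; move: E; rewrite -S' EFinD.
by move/(congr1 (fun r => r - S%:E)); rewrite !addeK.
Qed.

End cyclic_identity.

(** * The Laplace transform of a point sum *)

Section parity_exp.
Context (R : realType).
Local Open Scope ereal_scope.

(** The even and odd halves of the exponential series, which are the means of
    the two parity_sum. *)
Definition parity_exp (b : bool) (x : R) : \bar R :=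
  \sum_(0 <= n <oo) ((odd n == b)%:R * (x ^+ n / n`!%:R))%:E.

Lemma parity_exp_ge0 b x : (0 <= x)%R -> 0 <= parity_exp b x.
Proof.
by move=> x0; apply: nneseries_ge0 => n _ _; rewrite lee_fin mulr_ge0// divr_ge0// exprn_ge0.
Qed.

Lemma parity_exp_fin b x : (0 <= x)%R -> parity_exp b x < +oo.
Proof.
move=> x0; apply: le_lt_trans (ltry (expR x)); rewrite -expR_nneseries//.
have H n : (0 <= x ^+ n / n`!%:R)%R by rewrite divr_ge0// exprn_ge0.
apply: lee_nneseries => n _; first by move=> _; rewrite lee_fin mulr_ge0.
by rewrite lee_fin ler_piMl// lern1 leq_b1.
Qed.

Lemma parity_expE x : (0 <= x)%R ->
  parity_exp false x = parity_exp true x + (expR (- x))%:E.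
Proof.
move=> x0.
pose u b N := (\sum_(0 <= n < N) (odd n == b)%:R * (x ^+ n / n`!%:R))%R.
have pfin b : parity_exp b x \is a fin_num.
  by rewrite ge0_fin_numE ?parity_exp_ge0// parity_exp_fin.
have cvu b : u b @ \oo --> fine (parity_exp b x).
  suff H : (fun N => (u b N)%:E) @ \oo --> (fine (parity_exp b x))%:E by exact: (fine_cvg H).
  rewrite fineK// (_ : (fun N => (u b N)%:E) = fun N => \sum_(0 <= n < N) ((odd n == b)%:R * (x ^+ n / n`!%:R))%:E).
    apply: is_cvg_nneseries => n _ _.
    by rewrite lee_fin mulr_ge0// divr_ge0// exprn_ge0.
  by apply/funext => N; rewrite sumEFin.
have cvd : (fun N => u false N - u true N)%R @ \oo --> expR (- x).
  rewrite (_ : (fun N => _) = series (exp_coeff (- x))); first exact: is_cvg_series_exp_coeff.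
  apply/funext => N; rewrite /u /series/= -sumrB; apply: eq_bigr => n _.
  rewrite exp_coeffE -mulrBl exprNn -signr_odd [RHS]mulrC -mulrA; congr (_ * _)%R.
  by case: (odd n); rewrite ?expr0 ?expr1 ?subr0 ?sub0r.
have E : (fine (parity_exp false x) - fine (parity_exp true x) = expR (- x))%R.
  apply: (cvg_unique _ _ cvd); first exact: norm_hausdorff.
  exact: (cvgB (cvu false) (cvu true)).
rewrite -E -[X in _ = X + _](fineK (pfin true)) -EFinD addrC subrK.
by rewrite fineK.
Qed.

End parity_exp.

Section laplace.
Context d (R : realType) (X : borelMetricType d R).
Hypothesis X_sigma_compact : sigma_compact X.
Variables (sigma : {sigma_finite_measure set X -> \bar R}) (P : probability (config X) R).
Hypotheses (P_poisson : is_poisson_measure sigma P) (sigma_diffuse : diffuse sigma).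
Local Open Scope ereal_scope.

Lemma distinct_sum_prod (g : X -> R) n w : measurable_fun setT g -> (forall x, (0 <= g x)%R) ->
  distinct_sum (fun q : config X * n.-tuple X => (\prod_(p < n) g (tnth q.2 p))%:E) w =
  factorial_sum g n w.
Proof.
move=> mg g0; elim: n w => [|n IH] w /=; first by rewrite big_ord0.
have mG : measurable_fun setT (fun q : config X * n.-tuple X => (\prod_(p < n) g (tnth q.2 p))%:E).
  apply/measurable_EFinP; apply: measurable_prod => p _; apply: (measurableT_comp mg).
  exact: (measurableT_comp (measurable_tnth _) measurable_snd).
apply: eq_integral => x _; rewrite -IH -distinct_sumZl//; last first.
  by move=> z; rewrite lee_fin prodr_ge0.
congr distinct_sum; apply/funext => q; rewrite -EFinM big_ord_recl /=; congr EFin.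
congr (_ * _)%R; apply: eq_bigr => p _; congr g.
by rewrite (tnth_nth x) /= -tnth_nth.
Qed.

Variable v : config X -> X -> R.
Hypotheses (mv : measurable_fun setT (fun z : config X * X => v z.1 z.2))
  (v0 : forall w x, (0 <= v w x)%R)
  (v_cyclic : forall k, (2 <= k)%N -> cyclic_condition P sigma v k).
Variables (c m : R).
Hypothesis v_int : forall w, \int[sigma]_x (v w x)%:E = m%:E.
Hypothesis v_exp : forall w, \int[sigma]_x (1 - expR (- v w x))%:E = c%:E.

Let G w x : R := (1 - expR (- v w x))%R.

Let mG : measurable_fun setT (fun z : config X * X => G z.1 z.2).
Proof.
apply: measurable_funB => //; apply: measurableT_comp => //; exact: measurableT_comp.
Qed.

Let G0 w x : (0 <= G w x)%R.
Proof. by rewrite subr_ge0 -expR0 ler_expR oppr_le0. Qed.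

Let G_cyclic k : (2 <= k)%N -> cyclic_condition P sigma G k.
Proof.
move=> k2; apply: filterS (v_cyclic k2) => z /eqP; rewrite prodf_seq_eq0 => /hasP[i _ /=].
rewrite /diffop subr_eq0 => /eqP Hi; rewrite (bigD1 i)//= /diffop /G Hi.
by rewrite subrr mul0r.
Qed.

(** The point sum that occurs in a Skorohod integral. *)
Definition reduced_sum w : \bar R := \int[point_measure w]_t (v (rmpt w t) t)%:E.

Let mvr dT (T : measurableType dT) (f : T -> config X) (h : T -> X) :
  measurable_fun setT f -> measurable_fun setT h ->
  measurable_fun setT (fun z => v (rmpt (f z) (h z)) (h z)).
Proof.
move=> mf mh.
have H : measurable_fun setT (fun z => (rmpt (f z) (h z), h z)).
  by apply: measurable_fun_pair => //; exact: measurable_rmpt.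
exact: (measurableT_comp mv H).
Qed.

Lemma measurable_reduced_sum : measurable_fun setT reduced_sum.
Proof.
apply: (@measurable_config_integral _ _ _ X_sigma_compact _ _ id _
  (fun z : config X * X => (v (rmpt z.1 z.2) z.2)%:E)) => //.
  by apply/measurable_EFinP; exact: mvr.
by move=> z; rewrite lee_fin.
Qed.

Lemma reduced_sum_ge0 w : 0 <= reduced_sum w.
Proof. by apply: integral_ge0 => x _; rewrite lee_fin. Qed.

(** Its mean is m by the Mecke formula. *)
Lemma reduced_sum_fin : {ae P, forall w, reduced_sum w < +oo}.
Proof.
have H : \int[P]_w reduced_sum w = m%:E.
  rewrite (mecke X_sigma_compact P_poisson (F := fun z => (v z.1 z.2)%:E))//; last 2 first.
  - exact/measurable_EFinP.
  - by move=> z; rewrite lee_fin.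
  under eq_integral do rewrite v_int.
  by rewrite integral_cst//= probability_setT mule1.
have : P.-integrable setT reduced_sum.
  apply/integrableP; split; first exact: measurable_reduced_sum.
  under eq_integral do rewrite gee0_abs ?reduced_sum_ge0//.
  by rewrite H ltry.
move=> /(integrable_ae measurableT); apply: filterS => w /(_ I).
by rewrite ge0_fin_numE ?reduced_sum_ge0.
Qed.

Let pred := predictable G.

Let mfs n : measurable_fun setT (fun w => factorial_sum (pred w) n w).
Proof.
have mp : measurable_fun setT (fun z : config X * X => pred z.1 z.2).
  exact: (measurable_predictable X_sigma_compact mG).
have [H _] := measurable_factorial_sum X_sigma_compact n mp (fun z => G0 _ _).
by apply: (measurableT_comp H (measurable_fun_pair (@measurable_id _ _ setT) (@measurable_id _ _ setT))).
Qed.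

Let mpred w : measurable_fun setT (pred w).
Proof. exact: (measurable_predictable X_sigma_compact mG (f := cst w) (g := id)). Qed.

(** The iterated Mecke formula turns the mean into a correlation integral. *)
Let factorial_sum_mean n : \int[P]_w factorial_sum (pred w) n w = (c ^+ n)%:E.
Proof.
rewrite -(correlationE X_sigma_compact P_poisson sigma_diffuse mG G0 G_cyclic v_exp n).
rewrite /correlation fubini_tonelli1; last 2 first.
- exact: (measurable_shifted_prod X_sigma_compact mG).
- move=> z; exact: (shifted_prod_ge0 G0).
rewrite -(mecke_tuple X_sigma_compact P_poisson)//; last 2 first.
- exact: (measurable_shifted_prod X_sigma_compact mG).
- move=> z; exact: (shifted_prod_ge0 G0).
apply: eq_integral => w _.
have mpw := mpred w.
rewrite -distinct_sum_prod//; last by move=> x; exact: G0.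
apply: (eq_distinct_sum X_sigma_compact).
- apply/measurable_EFinP; apply: measurable_prod => p _; apply: (measurableT_comp mpw).
  exact: (measurableT_comp (measurable_tnth _) measurable_snd).
- by move=> z; rewrite lee_fin prodr_ge0// => p _; exact: G0.
- exact: (measurable_shifted_prod X_sigma_compact mG).
- move=> z; exact: (shifted_prod_ge0 G0).
move=> w' s ws.
suff E : addpts w' s (enum [set: 'I_n]%SET) = w.
  by congr EFin; apply: eq_bigr => p _; rewrite /shifted E.
apply: config_eq; apply/seteqP; split => x.
  move=> /points_addpts H; rewrite -ws.
  by case: H => [w'x|[i _ ->]]; [left|right; exact: mem_tnth].
rewrite -{1}ws => -[w'x|/= xs]; apply/points_addpts; first by left.
have /tnthP[i xi] := xs.
by right; exists i => //; rewrite mem_enum inE.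
Qed.

Let c0 : (0 <= c)%R.
Proof.
by rewrite -lee_fin -(v_exp point); apply: integral_ge0 => x _; rewrite lee_fin G0.
Qed.

Let fs0 n w : 0 <= factorial_sum (pred w) n w.
Proof. by apply: (factorial_sum_ge0 X_sigma_compact (mpred w)) => x; exact: G0. Qed.

Let ps0 b w : 0 <= parity_sum (pred w) b w.
Proof. by apply: (parity_sum_ge0 X_sigma_compact (mpred w)) => x; exact: G0. Qed.

Let parity_mean b : \int[P]_w parity_sum (pred w) b w = parity_exp b c.
Proof.
have coef0 n : (0 <= (odd n == b)%:R / n`!%:R :> R)%R by rewrite divr_ge0.
rewrite /parity_sum integral_nneseries//; last 2 first.
- by move=> n; apply: measurable_funeM; exact: mfs.
- by move=> n w _; rewrite mule_ge0.
apply: eq_eseriesr => n _; rewrite ge0_integralZl//.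
by rewrite factorial_sum_mean -EFinM mulrAC mulrA.
Qed.

Let mps b : measurable_fun setT (fun w => parity_sum (pred w) b w).
Proof.
apply: ge0_emeasurable_sum => [n w _ _|n _]; last by apply: measurable_funeM; exact: mfs.
by rewrite mule_ge0// ?lee_fin ?divr_ge0.
Qed.

(** Integrating parity_sum_exp, the two parity sums have the means
    parity_exp b c: the transform is the exponential series at - c. *)
Lemma laplace_functional :
  \int[P]_w (expR (- fine (reduced_sum w)))%:E = (expR (- c))%:E.
Proof.
have me : measurable_fun setT (fun w => (expR (- fine (reduced_sum w)))%:E).
  apply/measurable_EFinP; apply: measurableT_comp => //; apply: measurableT_comp => //.
  by apply: measurableT_comp => //; exact: measurable_reduced_sum.
have e0 w : 0 <= (expR (- fine (reduced_sum w)))%:E by rewrite lee_fin expR_ge0.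
have E : \int[P]_w parity_sum (pred w) false w =
    \int[P]_w parity_sum (pred w) true w + \int[P]_w (expR (- fine (reduced_sum w)))%:E.
  rewrite -ge0_integralD//; apply: ae_eq_integral => //; first exact: emeasurable_funD.
  apply: filterS reduced_sum_fin => w fw _.
  apply: (parity_sum_exp X_sigma_compact (v := fun x => v (rmpt w x) x)) => //.
  exact: (mvr (f := cst w) (h := id)).
have pf : parity_exp true c \is a fin_num.
  by rewrite ge0_fin_numE ?parity_exp_ge0// parity_exp_fin.
move: E; rewrite !parity_mean parity_expE// => E.
move/(congr1 (fun z => z - parity_exp true c)) : E.
by rewrite addeAC subee// add0e addeAC subee// add0e.
Qed.

End laplace.

(** * Moments and the integral of 1 - exp(-af) *)

Section exp_moments.
Context (R : realType).
Local Open Scope ereal_scope.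

Let coef (b : bool) n : R := ((n != 0)%N && (odd n == b))%:R.

Let coef_ge0 b n : (0 <= coef b n)%R. Proof. by []. Qed.

(** The term of order 0 is left out because its integral is infinite on a
    space of infinite measure. *)
Definition tail_exp b (x : R) : \bar R := \sum_(0 <= n <oo) (coef b n * (x ^+ n / n`!%:R))%:E.

Let term_ge0 b n x : (0 <= x)%R -> 0 <= (coef b n * (x ^+ n / n`!%:R))%:E.
Proof. by move=> x0; rewrite lee_fin mulr_ge0// divr_ge0// exprn_ge0. Qed.

Lemma tail_exp_ge0 b x : (0 <= x)%R -> 0 <= tail_exp b x.
Proof. by move=> x0; apply: nneseries_ge0 => n _ _; exact: term_ge0. Qed.

Lemma parity_exp_tail b x : (0 <= x)%R -> parity_exp b x = (~~ b)%:R%:E + tail_exp b x.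
Proof.
move=> x0; rewrite /parity_exp (nneseriesD1 (n := 0))//; last first.
  by move=> n _; rewrite lee_fin mulr_ge0// divr_ge0// exprn_ge0.
congr (_ + _); first by rewrite expr0 fact0 divr1 mulr1; case: b.
rewrite eseries_mkcond; apply: eq_eseriesr => n _ /=; rewrite /coef.
by case: eqP; rewrite /= ?mul0r.
Qed.

Lemma tail_exp_fin b x : (0 <= x)%R -> tail_exp b x < +oo.
Proof.
move=> x0; apply: le_lt_trans (parity_exp_fin b x0).
by rewrite parity_exp_tail// leeDr// lee_fin.
Qed.

Lemma tail_expE x : (0 <= x)%R ->
  tail_exp false x + (1 - expR (- x))%:E = tail_exp true x.
Proof.
move=> x0; have := parity_expE x0; rewrite !parity_exp_tail//.
have fin b : tail_exp b x \is a fin_num by rewrite ge0_fin_numE ?tail_exp_ge0 ?tail_exp_fin.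
rewrite -(fineK (fin true)) -(fineK (fin false)) -!EFinD => -[E].
by congr EFin; rewrite addrA [X in (X - _)%R]addrC E/= add0r addrK.
Qed.

Section integral_tail.
Context d (T : measurableType d) (m : {measure set T -> \bar R}) (f : T -> R) (a : R).
Hypotheses (mf : measurable_fun setT f) (f0 : forall x, (0 <= f x)%R) (a0 : (0 <= a)%R).

Let mpow n : measurable_fun setT (fun x => (f x ^+ n)%:E).
Proof. by apply/measurable_EFinP; exact: measurable_funX. Qed.

Let pow0 n x : 0 <= (f x ^+ n)%:E. Proof. by rewrite lee_fin exprn_ge0. Qed.

Let termE b n x : (coef b n * ((a * f x) ^+ n / n`!%:R))%:E =
  (coef b n * (a ^+ n / n`!%:R))%:E * (f x ^+ n)%:E.
Proof. by rewrite -EFinM exprMn -!mulrA [(f x ^+ n * _)%R]mulrC. Qed.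

Lemma measurable_tail_exp b : measurable_fun setT (fun x => tail_exp b (a * f x)).
Proof.
apply: ge0_emeasurable_sum => [n x _ _|n _].
  by apply: term_ge0; rewrite mulr_ge0.
by under eq_fun do rewrite termE; exact: measurable_funeM.
Qed.

Lemma integral_tail_exp b : \int[m]_x tail_exp b (a * f x) =
  \sum_(0 <= n <oo) ((coef b n * (a ^+ n / n`!%:R))%:E * \int[m]_x (f x ^+ n)%:E).
Proof.
rewrite integral_nneseries//; last 2 first.
- by move=> n; under eq_fun do rewrite termE; exact: measurable_funeM.
- by move=> n x _; apply: term_ge0; rewrite mulr_ge0.
apply: eq_eseriesr => n _; under eq_integral do rewrite termE.
by rewrite ge0_integralZl//; exact: term_ge0.
Qed.

Lemma integral_tail_expE : \int[m]_x tail_exp false (a * f x) +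
  \int[m]_x (1 - expR (- (a * f x)))%:E = \int[m]_x tail_exp true (a * f x).
Proof.
have af0 x : (0 <= a * f x)%R by rewrite mulr_ge0.
rewrite -ge0_integralD//.
- by apply: eq_integral => x _; rewrite tail_expE.
- by move=> x _; exact: tail_exp_ge0.
- exact: measurable_tail_exp.
- by move=> x _; rewrite lee_fin subr_ge0 -expR0 ler_expR oppr_le0.
- apply/measurable_EFinP; apply: measurable_funB => //; apply: measurableT_comp => //.
  by apply: measurableT_comp => //; exact: measurable_funM.
Qed.

End integral_tail.

(** The function 1 - exp(- y) is the difference of the odd and even tails of
    the exponential series at y, whose integrals are series in the moments.
    The bound on the moments makes these finite, so that they can be
    subtracted. *)
Lemma exp_moments d1 d2 (T1 : measurableType d1) (T2 : measurableType d2)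
    (m1 : {measure set T1 -> \bar R}) (m2 : {measure set T2 -> \bar R})
    (f : T1 -> R) (g : T2 -> R) (a M : R) :
  measurable_fun setT f -> (forall x, (0 <= f x)%R) ->
  measurable_fun setT g -> (forall x, (0 <= g x)%R) -> (0 <= a)%R -> (0 <= M)%R ->
  (forall k, (1 <= k)%N -> \int[m1]_x (f x ^+ k)%:E = \int[m2]_x (g x ^+ k)%:E) ->
  (forall k, (1 <= k)%N -> \int[m2]_x (g x ^+ k)%:E <= (M ^+ k)%:E) ->
  \int[m1]_x (1 - expR (- (a * f x)))%:E = \int[m2]_x (1 - expR (- (a * g x)))%:E.
Proof.
move=> mf f0 mg g0 a0 M0 fg gM.
have tails b : \int[m1]_x tail_exp b (a * f x) = \int[m2]_x tail_exp b (a * g x).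
  rewrite !integral_tail_exp//; apply: eq_eseriesr => -[|n] _; last by rewrite fg.
  by rewrite /coef /= mul0r !mul0e.
have fin b : \int[m2]_x tail_exp b (a * g x) \is a fin_num.
  rewrite ge0_fin_numE; last first.
    by apply: integral_ge0 => x _; rewrite tail_exp_ge0// mulr_ge0.
  apply: le_lt_trans (tail_exp_fin b (mulr_ge0 a0 M0)).
  rewrite integral_tail_exp//; apply: lee_nneseries => [n _ _|n _].
    apply: mule_ge0; first exact: term_ge0.
    by apply: integral_ge0 => x _; rewrite lee_fin exprn_ge0.
  case: n => [|n]; first by rewrite /coef /= !mul0r mul0e.
  have -> : (coef b n.+1 * ((a * M) ^+ n.+1 / (n.+1)`!%:R))%:E =
      (coef b n.+1 * (a ^+ n.+1 / (n.+1)`!%:R))%:E * (M ^+ n.+1)%:E.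
    by rewrite -EFinM exprMn -!mulrA [(M ^+ n.+1 * _)%R]mulrC.
  by apply: lee_wpmul2l; [exact: term_ge0|exact: gM].
have := integral_tail_expE m1 mf f0 a0; rewrite !tails -(integral_tail_expE m2 mg g0 a0).
move/(congr1 (fun z => z - \int[m2]_x tail_exp false (a * g x))).
by rewrite addeAC subee// add0e addeAC subee// add0e.
Qed.

End exp_moments.

(** * Positive isometries and the parts of a function *)

Section Lfun_facts.
Context d (T : measurableType d) (R : realType) (m : {measure set T -> \bar R}).
Local Open Scope ereal_scope.

Lemma Lfun_measurable p (f : T -> R) : f \in Lfun m p -> measurable_fun setT f.
Proof. by move/sub_Lfun_mfun; rewrite inE. Qed.

Lemma Lfun_le (p : R) (f g : T -> R) : (1 <= p)%R -> measurable_fun setT f ->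
  (forall x, (`|f x| <= `|g x|)%R) -> g \in Lfun m p%:E -> f \in Lfun m p%:E.
Proof.
move=> p1 mf fg gL; have mg := Lfun_measurable gL.
have p0 : (0 < p)%R by exact: lt_le_trans p1.
have := gL; rewrite !inE => /andP[_]; rewrite inE /= => gfin.
apply/andP; split; first by rewrite inE.
rewrite inE /=; apply: le_lt_trans gfin; rewrite unlock.
have I0 (k : T -> R) : 0 <= \int[m]_x `|(EFin \o k) x| `^ p.
  by apply: integral_ge0 => x _; exact: poweR_ge0.
have mpow (k : T -> R) : measurable_fun setT k ->
    measurable_fun setT (fun x => `|(EFin \o k) x| `^ p).
  move=> mk; apply: (measurableT_comp (measurable_poweR p)).
  by apply: measurableT_comp => //; exact/measurable_EFinP.
apply: gt0_ler_poweR; rewrite ?invr_ge0 ?(ltW p0)// ?in_itv/= ?I0 ?leey//.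
apply: ge0_le_integral => //; try by first [exact: mpow|move=> x _; exact: poweR_ge0].
by move=> x _; rewrite lee_fin ge0_ler_powR// ?nnegrE// ltW.
Qed.

Lemma Lnorm_moment (k : nat) (f : T -> R) : (0 < k)%N ->
  'N[m]_(k%:R%:E)[EFin \o f] `^ k%:R = \int[m]_x (`|f x| ^+ k)%:E.
Proof.
move=> k0; rewrite poweR_Lnorm ?pnatr_eq0 -?lt0n//; apply: eq_integral => x _ /=.
by rewrite powR_mulrn.
Qed.

Lemma Lnorm_one (f : T -> R) : 'N[m]_1[EFin \o f] = \int[m]_x `|f x|%:E.
Proof. by rewrite Lnorm1. Qed.

End Lfun_facts.

Section positive_isometry.
Context d1 d2 (Y : measurableType d1) (X : measurableType d2) (R : realType).
Variables (mu : {measure set Y -> \bar R}) (sigma : {measure set X -> \bar R}).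
Variables (U : (Y -> R) -> X -> R) (h : Y -> R).
Hypotheses (U_isometry : forall p, (1 <= p)%E -> Lp_isometry mu sigma p U)
  (U_positive : forall p, (1 <= p)%E -> positive_operator mu sigma p U)
  (h_Lp : forall n, (1 <= n)%N -> h \in Lfun mu n%:R%:E).
Local Open Scope ereal_scope.

Let h_meas : measurable_fun setT h.
Proof. exact: (Lfun_measurable (h_Lp (leqnn 1))). Qed.

Let pos_Lp n : (1 <= n)%N -> h^\+%R \in Lfun mu n%:R%:E.
Proof.
move=> n1; apply: (Lfun_le (g := h)); rewrite ?ler1n//; last exact: h_Lp.
  exact: measurable_funrpos.
by move=> y; rewrite ger0_norm ?funrpos_ge0// /funrpos ge_max ler_norm normr_ge0.
Qed.

Let neg_Lp n : (1 <= n)%N -> h^\-%R \in Lfun mu n%:R%:E.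
Proof.
move=> n1; apply: (Lfun_le (g := h)); rewrite ?ler1n//; last exact: h_Lp.
  exact: measurable_funrneg.
move=> y; rewrite ger0_norm ?funrneg_ge0// /funrneg ge_max normr_ge0 andbT.
by rewrite -normrN ler_norm.
Qed.

Let leqE n : (1 <= n)%N -> 1 <= n%:R%:E :> \bar R.
Proof. by move=> n1; rewrite lee_fin ler1n. Qed.

(** As h and |h| have the same norm in L^1, so do U h = U h^+ - U h^- and
    U |h| = U h^+ + U h^-, which forces the smaller of U h^+ and U h^- to
    vanish. *)
Let parts_ae : {ae sigma, forall x,
  ((U h)^\+ x = U h^\+ x)%R /\ ((U h)^\- x = U h^\- x)%R}.
Proof.
set a := U h^\+%R; set b := U h^\-%R.
have p1 := pos_Lp (leqnn 1); have n1 := neg_Lp (leqnn 1); have h1 := h_Lp (leqnn 1).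
have [UL Ulin Unorm] := U_isometry (lexx (1 : \bar R)).
have a0 := U_positive (lexx (1 : \bar R)) p1 (funrpos_ge0 h).
have b0 := U_positive (lexx (1 : \bar R)) n1 (funrneg_ge0 h).
have hE : h = (fun y => - 1 * h^\- y + h^\+ y)%R.
  apply/funext => y; rewrite mulN1r addrC.
  exact: (congr1 (@^~ y) (esym (funrposBneg h))).
have nE : (fun y => `|h y|)%R = (fun y => 1 * h^\- y + h^\+ y)%R.
  apply/funext => y; rewrite mul1r addrC.
  exact: (congr1 (@^~ y) (esym (funrposDneg h))).
have UhE : {ae sigma, forall x, U h x = - 1 * b x + a x}%R.
  by apply: filterS (Ulin (- 1)%R _ _ n1 p1) => x; rewrite -hE.
have UnE : {ae sigma, forall x, U (fun y => `|h y|)%R x = 1 * b x + a x}%R.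
  by apply: filterS (Ulin 1%R _ _ n1 p1) => x; rewrite -nE.
have nL : (fun y => `|h y|)%R \in Lfun mu 1 by exact: Lfun_norm.
have ma := Lfun_measurable (UL _ p1); have mb := Lfun_measurable (UL _ n1).
have mU := Lfun_measurable (UL _ h1); have mUn := Lfun_measurable (UL _ nL).
pose c x := Num.min `|a x|%R `|b x|%R.
have mc : measurable_fun setT c by apply: measurable_minr; exact: measurableT_comp.
have c0 x : (0 <= c x)%R by rewrite le_min !normr_ge0.
have IE : \int[sigma]_x `|U (fun y => `|h y|)%R x|%:E =
    \int[sigma]_x `|U h x|%:E + 2%:R%:E * \int[sigma]_x (c x)%:E.
  rewrite -ge0_integralZl//; last 2 first.
  - exact/measurable_EFinP.
  - by move=> x _; rewrite lee_fin.
  rewrite -ge0_integralD//.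
  - apply: ae_eq_integral => //.
    + by apply/measurable_EFinP; exact: measurableT_comp.
    + apply/measurable_EFinP; apply: measurable_funD; first exact: measurableT_comp.
      exact: measurable_funM.
    apply: filterS2 (filterI UhE UnE) (filterI a0 b0) => x [-> ->] [ax bx] _.
    rewrite -EFinM -EFinD; congr EFin; rewrite /c (ger0_norm ax) (ger0_norm bx).
    rewrite mulN1r mul1r ger0_norm ?addr_ge0//; case: (leP (a x) (b x)) => ab.
      by rewrite ler0_norm ?subr_le0// 1?addrC ?subr_le0//; ring.
    by rewrite ger0_norm 1?addrC ?subr_ge0 ?(ltW ab)//; ring.
  - by apply/measurable_EFinP; exact: measurableT_comp.
  - by move=> x _; rewrite -EFinM lee_fin mulr_ge0.
  - by apply: measurable_funeM; exact/measurable_EFinP.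
have fin : \int[sigma]_x `|U h x|%:E \is a fin_num.
  have := UL _ h1; rewrite inE => /andP[_]; rewrite inE /= /finite_norm Lnorm_one => fin.
  by rewrite ge0_fin_numE//; apply: integral_ge0 => x _; rewrite lee_fin.
have cI : \int[sigma]_x (c x)%:E = 0.
  have NE : \int[sigma]_x `|U (fun y => `|h y|)%R x|%:E = \int[sigma]_x `|U h x|%:E.
    rewrite -!Lnorm_one !Unorm// !Lnorm_one; apply: eq_integral => y _.
    by rewrite normr_id.
  move: IE; rewrite NE => /(congr1 (fun z => z - \int[sigma]_x `|U h x|%:E)).
  rewrite subee// addeAC subee// add0e => /esym/eqP.
  by rewrite mule_eq0 => /orP[|/eqP//]; rewrite eqe pnatr_eq0.
have cz : {ae sigma, forall x, c x = 0%R}.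
  have mce : measurable_fun setT (EFin \o c) by exact/measurable_EFinP.
  have [H _] := ae_eq_integral_abs sigma measurableT mce.
  have /H : \int[sigma]_x `|(EFin \o c) x| = 0.
    by rewrite -[RHS]cI; apply: eq_integral => x _ /=; rewrite ger0_norm.
  by apply: filterS => x /(_ I) [].
apply: filterS3 UhE cz (filterI a0 b0) => x hx cx [ax bx].
rewrite /funrpos /funrneg hx mulN1r; move: cx; rewrite /c (ger0_norm ax) (ger0_norm bx).
rewrite -[U h^\+%R x]/(a x) -[U h^\-%R x]/(b x).
case: (leP (a x) (b x)) => ab E; rewrite E ?addr0 ?oppr0 ?add0r ?opprK.
  by rewrite max_r ?max_l// oppr_le0.
by rewrite max_l ?max_r// oppr_le0.
Qed.

Let part_moment (f : X -> R) (g : Y -> R) k : (1 <= k)%N ->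
  measurable_fun setT f -> (forall x, (0 <= f x)%R) -> (forall y, (0 <= g y)%R) ->
  {ae sigma, forall x, f x = U g x} -> g \in Lfun mu k%:R%:E ->
  \int[sigma]_x (f x ^+ k)%:E = \int[mu]_y (g y ^+ k)%:E.
Proof.
move=> k1 mf f0 g0 fg gL; have [UL _ Unorm] := U_isometry (leqE k1).
have mUg := Lfun_measurable (UL _ gL).
transitivity (\int[sigma]_x (`|U g x| ^+ k)%:E).
  apply: ae_eq_integral => //.
  - by apply/measurable_EFinP; exact: measurable_funX.
  - by apply/measurable_EFinP; apply: measurable_funX; exact: measurableT_comp.
  by apply: filterS fg => x fx _; rewrite -fx ger0_norm.
rewrite -Lnorm_moment// Unorm// Lnorm_moment//; apply: eq_integral => y _.
by rewrite ger0_norm.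
Qed.

Let Uh_meas : measurable_fun setT (U h).
Proof.
have [UL _ _] := U_isometry (lexx (1 : \bar R)).
exact: (Lfun_measurable (UL _ (h_Lp (leqnn 1)))).
Qed.

(** The positive part of U h is U applied to the positive part of h, and the
    k-th power of the norm of order k of a nonnegative function is its moment. *)
Lemma isometry_pos_moment k : (1 <= k)%N ->
  \int[sigma]_x ((U h)^\+ x ^+ k)%:E = \int[mu]_y (h^\+ y ^+ k)%:E.
Proof.
move=> k1; apply: (part_moment k1); [exact: measurable_funrpos|exact: funrpos_ge0|
  exact: funrpos_ge0| |exact: pos_Lp].
by apply: filterS parts_ae => x [].
Qed.

Lemma isometry_neg_moment k : (1 <= k)%N ->
  \int[sigma]_x ((U h)^\- x ^+ k)%:E = \int[mu]_y (h^\- y ^+ k)%:E.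
Proof.
move=> k1; apply: (part_moment k1); [exact: measurable_funrneg|exact: funrneg_ge0|
  exact: funrneg_ge0| |exact: neg_Lp].
by apply: filterS parts_ae => x [].
Qed.

Hypothesis h_sup : (ereal_sup [set 'N[mu]_(n%:R%:E)[EFin \o h] |
  n in [set n : nat | (1 <= n)%N]] < +oo).

Lemma moment_bound : exists2 M : R, (0 <= M)%R & forall k, (1 <= k)%N ->
  \int[mu]_y (`|h y| ^+ k)%:E <= (M ^+ k)%:E.
Proof.
move: h_sup; set S := ereal_sup _ => S_fin.
have le_sup n : (1 <= n)%N -> 'N[mu]_(n%:R%:E)[EFin \o h] <= S.
  by move=> n1; apply: ereal_sup_ubound; exists n.
have S0 : 0 <= S by apply: le_trans (le_sup 1%N isT); exact: Lnorm_ge0.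
have SE : (fine S)%:E = S by rewrite fineK// ge0_fin_numE.
exists (fine S); first exact: fine_ge0.
move=> k k1; rewrite -Lnorm_moment// -(powR_mulrn _ (fine_ge0 S0)) -poweR_EFin SE.
by apply: gt0_ler_poweR; rewrite ?ler0n ?in_itv/= ?Lnorm_ge0 ?S0 ?leey// le_sup.
Qed.

End positive_isometry.

(** * Joint Laplace transforms determine joint laws *)

Section threshold.
Context (R : realType).

Lemma bernoulli_inequality (y : R) k : 0 <= y <= 1 -> 1 - k%:R * y <= (1 - y) ^+ k.
Proof.
move=> /andP[y0 y1]; elim: k => [|k IH]; first by rewrite mul0r subr0 expr0.
rewrite exprS; apply: le_trans (ler_wpM2l _ IH); last by rewrite subr_ge0.
rewrite -natr1; have : 0 <= k%:R * y * y by rewrite !mulr_ge0.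
by nra.
Qed.

Lemma sqr_le_expR (z : R) : 0 <= z -> z ^+ 2 / 4 <= expR z.
Proof.
move=> z0; rewrite [z in expR z](_ : z = z / 2 + z / 2); last by field.
have := expR_ge1Dx (z / 2); rewrite expRD => H; nra.
Qed.

(** With N = n + 1, the power (1 - exp(- N x)) ^+ k is close to
    exp(- k * exp(- N x)). For k = N * exp(N c), the quantity k * exp(- N x)
    tends to 0 if x > c and to infinity if x <= c. For c < 0 the exponent 0
    gives the constant 1, which is right for x >= 0. *)
Definition threshold_exponent (c : R) (n : nat) : nat :=
  if c < 0 then 0%N else Num.truncn (n.+1%:R * expR (n.+1%:R * c)).

Definition threshold c n x : R :=
  (1 - expR (- (n.+1%:R * x))) ^+ threshold_exponent c n.

Lemma cvg_threshold c x : 0 <= x -> threshold c n x @[n --> \oo] --> ((c < x)%R%:R : R).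
Proof.
move=> x0; have [c0|c0] := ltP c 0.
  rewrite (lt_le_trans c0 x0) (_ : (fun n => _) = cst 1); first exact: cvg_cst.
  by apply/funext => n; rewrite /threshold /threshold_exponent c0 expr0.
have N0 n : 0 < n.+1%:R :> R by [].
have N1 n : 1 <= n.+1%:R :> R by rewrite ler1n.
have y0 n : 0 <= expR (- (n.+1%:R * x)) by exact: expR_ge0.
have y1 n : expR (- (n.+1%:R * x)) <= 1 by rewrite -expR0 ler_expR oppr_le0 mulr_ge0.
have t0 n : 0 <= threshold c n x by rewrite exprn_ge0// subr_ge0.
have t1 n : threshold c n x <= 1 by rewrite exprn_ile1 ?subr_ge0// gerBl.
have KE n : threshold_exponent c n = Num.truncn (n.+1%:R * expR (n.+1%:R * c)).
  by rewrite /threshold_exponent ltNge c0.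
have m0 n : 0 <= n.+1%:R * expR (n.+1%:R * c) by rewrite mulr_ge0// expR_ge0.
have [cx|xc] := ltP c x.
  (* the defect is at most k * exp(- N x) <= N * exp(- N (x - c)) *)
  have d0 : 0 < x - c by rewrite subr_gt0.
  apply: (@squeeze_cvgr _ _ _ _ (fun n => 1 - 4 / (x - c) ^+ 2 * harmonic n) (fun=> 1)).
  - near=> n; rewrite t1 andbT.
    apply: le_trans (bernoulli_inequality _ _); last by rewrite y0 y1.
    rewrite lerD2l lerN2.
    apply: (@le_trans _ _ (n.+1%:R * expR (n.+1%:R * c) * expR (- (n.+1%:R * x)))).
      by rewrite ler_wpM2r// KE truncn_le.
    rewrite -mulrA -expRD -mulrN -mulrDr -opprB mulrN expRN /harmonic /=.
    have := sqr_le_expR (mulr_ge0 (ltW (N0 n)) (ltW d0)).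
    rewrite ler_pdivrMr// => H; rewrite ler_pdivrMr ?expR_gt0//.
    rewrite (_ : 4 / (x - c) ^+ 2 / n.+1%:R * expR (n.+1%:R * (x - c)) =
      (expR (n.+1%:R * (x - c)) * 4) / (n.+1%:R * (x - c) ^+ 2)); last first.
      by field; rewrite gt_eqF// gt_eqF.
    rewrite ler_pdivlMr ?mulr_gt0 ?exprn_gt0//.
    by apply: le_trans H; rewrite exprMn mulrA -expr2.
  - rewrite -[X in _ --> X]subr0; apply: cvgB; first exact: cvg_cst.
    by rewrite -[X in _ --> X](mulr0 (4 / (x - c) ^+ 2)); apply: cvgM; [exact: cvg_cst|exact: cvg_harmonic].
  - exact: cvg_cst.
(* the power is at most exp(- k * exp(- N c)), where k >= N * exp(N c) - 1 *)
apply: (@squeeze_cvgr _ _ _ _ (fun=> 0) (@harmonic R)); last 2 first.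
- exact: cvg_cst.
- exact: cvg_harmonic.
near=> n; rewrite t0 /=.
apply: (@le_trans _ _ (expR (- n%:R))).
  rewrite /threshold; apply: (@le_trans _ _ (expR (- expR (- (n.+1%:R * x))) ^+ threshold_exponent c n)).
    by apply: lerXn2r; rewrite ?nnegrE ?subr_ge0 ?expR_ge0//; exact: expR_ge1Dx.
  rewrite -expRM_natl ler_expR mulrN lerN2 KE.
  have : n.+1%:R * expR (n.+1%:R * c) - 1 <= (Num.truncn (n.+1%:R * expR (n.+1%:R * c)))%:R.
    by rewrite lerBlDr natr1 ltW// truncnS_gt.
  set K := (Num.truncn _)%:R => HK.
  have exc : expR (- (n.+1%:R * c)) <= expR (- (n.+1%:R * x)).
    by rewrite ler_expR lerN2 ler_wpM2l.
  have ec1 : expR (- (n.+1%:R * c)) <= 1 by rewrite -expR0 ler_expR oppr_le0 mulr_ge0.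
  apply: (@le_trans _ _ (K * expR (- (n.+1%:R * c)))); last by rewrite ler_wpM2l.
  apply: (@le_trans _ _ ((n.+1%:R * expR (n.+1%:R * c) - 1) * expR (- (n.+1%:R * c)))); last first.
    by rewrite ler_wpM2r// expR_ge0.
  rewrite mulrBl mul1r -mulrA -expRD subrr expR0 mulr1.
  by rewrite lerBrDr -[leRHS]natr1 lerD2l.
rewrite expRN /harmonic /= lef_pV2 ?posrE ?expR_gt0//.
by have := expR_ge1Dx (n%:R : R); rewrite -natr1 addrC.
Unshelve. all: by end_near.
Qed.

End threshold.

Section ray_determined.
Context (R : realType).
Local Open Scope ereal_scope.

Let ray_cover : \bigcup_k `](- k%:R)%R, +oo[%classic = [set: R].
Proof.
apply/seteqP; split => // x _.
exists (Num.truncn `|x|%R).+1 => //=; rewrite in_itv/= andbT ltrNl.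
by apply: le_lt_trans (truncnS_gt _); rewrite -normrN ler_norm.
Qed.

Lemma measure_rays_unique (m1 m2 : {measure set R -> \bar R}) :
  m1 setT < +oo -> (forall c, m1 `]c, +oo[%classic = m2 `]c, +oo[%classic) ->
  forall A, measurable A -> m1 A = m2 A.
Proof.
move=> m1T m12.
apply: (@measure_unique _ R R (@RGenOInfty.G R) (fun k => `](- k%:R)%R, +oo[%classic)).
- exact: RGenOInfty.measurableE.
- move=> _ _ [x ->] [y ->]; exists (Num.max x y).
  apply/seteqP; split => z /=; rewrite !in_itv/= !andbT gt_max.
    by move=> [-> ->].
  by move=> /andP[].
- by move=> k; eexists.
- exact: ray_cover.
- by move=> _ [c ->].
- move=> k; apply: le_lt_trans m1T; apply: le_measure; rewrite ?inE//.
Qed.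

End ray_determined.

Section joint_law.
Context d1 d2 (T1 : measurableType d1) (T2 : measurableType d2) (R : realType).
Variables (P1 : probability T1 R) (P2 : probability T2 R).
Variables (A1 B1 : T1 -> R) (A2 B2 : T2 -> R).
Hypotheses (mA1 : measurable_fun setT A1) (mB1 : measurable_fun setT B1)
  (mA2 : measurable_fun setT A2) (mB2 : measurable_fun setT B2).
Local Open Scope ereal_scope.

Hypothesis rays : forall c e,
  P1 (A1 @^-1` `]c, +oo[ `&` B1 @^-1` `]e, +oo[) = P2 (A2 @^-1` `]c, +oo[ `&` B2 @^-1` `]e, +oo[).

Let pre d (T : measurableType d) (f : T -> R) (C : set R) :
  measurable_fun setT f -> measurable C -> measurable (f @^-1` C).
Proof. by move=> mf mC; rewrite -[_ @^-1` _]setTI; exact: mf. Qed.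

Let slice d (T : measurableType d) (P : probability T R) (f : T -> R)
  (mf : measurable_fun setT f) (D : set T) (mD : measurable D) : {measure set R -> \bar R} :=
  measure_function_pushforward__canonical__measure_function_Measure (mrestr P mD) mf.

Let rectangles C E : measurable C -> measurable E ->
  P1 (A1 @^-1` C `&` B1 @^-1` E) = P2 (A2 @^-1` C `&` B2 @^-1` E).
Proof.
move=> mC mE.
have fin d (T : measurableType d) (P : probability T R) (D : set T) : measurable D -> P D < +oo.
  by move=> mD; apply: le_lt_trans (ltry 1); exact: probability_le1.
have half c E' : measurable E' ->
    P1 (A1 @^-1` `]c, +oo[ `&` B1 @^-1` E') = P2 (A2 @^-1` `]c, +oo[ `&` B2 @^-1` E').
  move=> mE'; rewrite setIC [in RHS]setIC.
  apply: (@measure_rays_unique R (slice P1 mB1 (pre mA1 _)) (slice P2 mB2 (pre mA2 _))) => //.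
  - by apply: fin; apply: measurableI; exact: pre.
  - by move=> e; rewrite /slice /= /pushforward /mrestr setIC [in RHS]setIC; exact: rays.
apply: (@measure_rays_unique R (slice P1 mA1 (pre mB1 mE)) (slice P2 mA2 (pre mB2 mE))) => //.
- by apply: fin; apply: measurableI; exact: pre.
- by move=> c; exact: half.
Qed.

(** Quadrants determine rectangles, one coordinate at a time, and rectangles
    determine the law. *)
Lemma joint_law (D : set (R * R)) : measurable D ->
  P1 ((fun t => (A1 t, B1 t)) @^-1` D) = P2 ((fun t => (A2 t, B2 t)) @^-1` D).
Proof.
have m1 : measurable_fun setT (fun t => (A1 t, B1 t)) by exact: measurable_fun_pair.
have m2 : measurable_fun setT (fun t => (A2 t, B2 t)) by exact: measurable_fun_pair.
apply: (@measure_unique _ R _ [set A `*` B | A in measurable & B in measurable] (fun=> setT)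
  _ _ _ _ (measure_function_pushforward__canonical__measure_function_Measure P1 m1)
  (measure_function_pushforward__canonical__measure_function_Measure P2 m2)).
- exact: measurable_prod_measurableType.
- move=> _ _ [A mA [B mB <-]] [C mC [E mE <-]].
  exists (A `&` C); first exact: measurableI.
  by exists (B `&` E); [exact: measurableI|rewrite setXI].
- by move=> _; exists setT => //; exists setT => //; rewrite setXTT.
- by rewrite bigcup_const.
- by move=> _ [A mA [B mB <-]]; exact: rectangles.
- by move=> _; rewrite /= /pushforward preimage_setT probability_setT ltry.
Qed.

End joint_law.

Section mixed_moments.
Context d (T : measurableType d) (R : realType) (P : probability T R) (A B : T -> R).
Hypotheses (mA : measurable_fun setT A) (mB : measurable_fun setT B)
  (A0 : forall t, 0 <= A t) (B0 : forall t, 0 <= B t).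

(** A power of 1 - exp(- N A) is a combination of exponentials; instead of
    expanding it, the two recursion formulas below lower the exponents one by
    one. *)
Definition mixed_term n K L a b t : R :=
  (1 - expR (- (n.+1%:R * A t))) ^+ K * (1 - expR (- (n.+1%:R * B t))) ^+ L *
  expR (- (a%:R * A t + b%:R * B t)).

Let one_sub (f : T -> R) n : (forall t, 0 <= f t) ->
  forall t, 0 <= 1 - expR (- (n.+1%:R * f t)) <= 1.
Proof.
by move=> f0 t; rewrite gerBl ?expR_ge0 andbT subr_ge0 -expR0 ler_expR oppr_le0 mulr_ge0.
Qed.

Lemma mixed_term_itv n K L a b t : 0 <= mixed_term n K L a b t <= 1.
Proof.
have /andP[a0 a1] := one_sub n A0 t; have /andP[b0 b1] := one_sub n B0 t.
have e1 : expR (- (a%:R * A t + b%:R * B t)) <= 1.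
  by rewrite -expR0 ler_expR oppr_le0 addr_ge0// mulr_ge0.
by rewrite !mulr_ge0 ?exprn_ge0 ?expR_ge0//= !mulr_ile1 ?mulr_ge0 ?exprn_ge0 ?exprn_ile1 ?expR_ge0.
Qed.

Lemma measurable_mixed_term n K L a b : measurable_fun setT (mixed_term n K L a b).
Proof.
have me (f : T -> R) : measurable_fun setT f -> measurable_fun setT (fun t => expR (- f t)).
  by move=> mf; apply: measurableT_comp => //; exact: measurableT_comp.
have mo (f : T -> R) : measurable_fun setT f -> measurable_fun setT (fun t => 1 - expR (- (n.+1%:R * f t))).
  by move=> mf; apply: measurable_funB => //; apply: me; exact: measurable_funM.
apply: measurable_funM; first by apply: measurable_funM; apply: measurable_funX; exact: mo.
by apply: me; apply: measurable_funD; exact: measurable_funM.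
Qed.

Lemma integrable_mixed_term n K L a b : P.-integrable setT (EFin \o mixed_term n K L a b).
Proof.
apply: (le_integrable measurableT (g := cst 1%E)).
- by apply/measurable_EFinP; exact: measurable_mixed_term.
- move=> t _ /=; have /andP[h0 h1] := mixed_term_itv n K L a b t.
  by rewrite normr1 lee_fin ger0_norm.
- exact: finite_measure_integrable_cst.
Qed.

Lemma mixed_termSl n K L a b : (\int[P]_t (mixed_term n K.+1 L a b t)%:E =
  \int[P]_t (mixed_term n K L a b t)%:E - \int[P]_t (mixed_term n K L (a + n.+1) b t)%:E)%E.
Proof.
rewrite -integralB//; try exact: integrable_mixed_term.
apply: eq_integral => t _; rewrite -EFinB; congr EFin; rewrite /mixed_term exprS.
have -> : expR (- ((a + n.+1)%:R * A t + b%:R * B t)) =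
    expR (- (n.+1%:R * A t)) * expR (- (a%:R * A t + b%:R * B t)).
  by rewrite -expRD natrD; congr expR; ring.
ring.
Qed.

Lemma mixed_termSr n K L a b : (\int[P]_t (mixed_term n K L.+1 a b t)%:E =
  \int[P]_t (mixed_term n K L a b t)%:E - \int[P]_t (mixed_term n K L a (b + n.+1) t)%:E)%E.
Proof.
rewrite -integralB//; try exact: integrable_mixed_term.
apply: eq_integral => t _; rewrite -EFinB; congr EFin; rewrite /mixed_term exprS.
have -> : expR (- (a%:R * A t + (b + n.+1)%:R * B t)) =
    expR (- (n.+1%:R * B t)) * expR (- (a%:R * A t + b%:R * B t)).
  by rewrite -expRD natrD; congr expR; ring.
ring.
Qed.

Lemma cvg_mixed_term c e :
  (\int[P]_t (mixed_term n (threshold_exponent c n) (threshold_exponent e n) 0 0 t)%:E)%E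
    @[n --> \oo] --> P (A @^-1` `]c, +oo[ `&` B @^-1` `]e, +oo[).
Proof.
set S := _ `&` _.
have pre (f : T -> R) (C : set R) : measurable_fun setT f -> measurable C -> measurable (f @^-1` C).
  by move=> mf mC; rewrite -[_ @^-1` _]setTI; exact: mf.
have mS : measurable S by apply: measurableI; exact: pre.
have -> : P S = (\int[P]_t (\1_S t)%:E)%E by rewrite integral_indic// setIT.
have [] := @dominated_convergence _ _ _ P setT measurableT
  (fun n t => (mixed_term n (threshold_exponent c n) (threshold_exponent e n) 0 0 t)%:E)
  (fun t => (\1_S t)%:E) (cst 1%E) _ _ _ _ _ => //.
- by move=> n; apply/measurable_EFinP; exact: measurable_mixed_term.
- by apply/measurable_EFinP; exact: measurable_indic.
- apply: aeW => t _; apply: cvg_EFin; first by near=> n.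
  have H := cvgM (cvg_threshold (c := c) (A0 t)) (cvg_threshold (c := e) (B0 t)).
  rewrite (_ : \1_S t = (c < A t)%R%:R * (e < B t)%R%:R); last first.
    rewrite indicE -natrM mulnb; congr (nat_of_bool _)%:R.
    apply/idP/andP; rewrite inE /S /= !in_itv/= !andbT; first by move=> [].
    by move=> [].
  rewrite (_ : _ \o _ = (fun n => threshold c n (A t) * threshold e n (B t))); first exact: H.
  by apply/funext => n; rewrite /= /mixed_term !mul0r addr0 oppr0 expR0 mulr1.
- exact: finite_measure_integrable_cst.
- apply: aeW => t n _; have /andP[h0 h1] := mixed_term_itv n (threshold_exponent c n) (threshold_exponent e n) 0 0 t.
  by rewrite /= lee_fin ger0_norm.
Unshelve. all: by end_near.
Qed.

End mixed_moments.

Section laplace_determines_law.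
Context d1 d2 (T1 : measurableType d1) (T2 : measurableType d2) (R : realType).
Variables (P1 : probability T1 R) (P2 : probability T2 R).
Variables (A1 B1 : T1 -> R) (A2 B2 : T2 -> R).
Hypotheses (mA1 : measurable_fun setT A1) (mB1 : measurable_fun setT B1)
  (mA2 : measurable_fun setT A2) (mB2 : measurable_fun setT B2).
Hypotheses (A10 : forall t, 0 <= A1 t) (B10 : forall t, 0 <= B1 t)
  (A20 : forall t, 0 <= A2 t) (B20 : forall t, 0 <= B2 t).
Hypothesis laplace : forall a b : nat,
  (\int[P1]_t (expR (- (a%:R * A1 t + b%:R * B1 t)))%:E =
   \int[P2]_t (expR (- (a%:R * A2 t + b%:R * B2 t)))%:E)%E.

Let mixed n K L a b : (\int[P1]_t (mixed_term A1 B1 n K L a b t)%:E =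
   \int[P2]_t (mixed_term A2 B2 n K L a b t)%:E)%E.
Proof.
elim: K a b => [|K IH] a b; last by rewrite !mixed_termSl// !IH.
elim: L a b => [|L IH] a b; last by rewrite !mixed_termSr// !IH.
have E d (T : measurableType d) (P : probability T R) (A B : T -> R) :
    (\int[P]_t (mixed_term A B n 0 0 a b t)%:E =
     \int[P]_t (expR (- (a%:R * A t + b%:R * B t)))%:E)%E.
  by apply: eq_integral => t _; rewrite /mixed_term !expr0 !mul1r.
by rewrite !E.
Qed.

(** All integrals of mixed_term agree, and for the exponents of threshold they
    converge to the probability that A > c and B > e. *)
Lemma laplace_joint_law (D : set (R * R)) : measurable D ->
  P1 ((fun t => (A1 t, B1 t)) @^-1` D) = P2 ((fun t => (A2 t, B2 t)) @^-1` D).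
Proof.
apply: joint_law => // c e.
have H1 := cvg_mixed_term (P := P1) mA1 mB1 A10 B10 (c := c) (e := e).
have H2 := cvg_mixed_term (P := P2) mA2 mB2 A20 B20 (c := c) (e := e).
have E : (fun n => \int[P1]_t (mixed_term A1 B1 n (threshold_exponent c n) (threshold_exponent e n) 0 0 t)%:E)%E =
    (fun n => \int[P2]_t (mixed_term A2 B2 n (threshold_exponent c n) (threshold_exponent e n) 0 0 t)%:E)%E.
  by apply/funext => n; exact: mixed.
move: H1; rewrite E => H1; apply: (cvg_unique _ H1 H2).
exact: ereal_hausdorff.
Qed.

End laplace_determines_law.

(** * The Skorohod integral of a process with deterministic integrals *)

Section skorohod_law.
Context d (R : realType) (X : borelMetricType d R).
Hypothesis X_sigma_compact : sigma_compact X.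
Variables (sigma : {sigma_finite_measure set X -> \bar R}) (P : probability (config X) R).
Hypotheses (P_poisson : is_poisson_measure sigma P) (sigma_diffuse : diffuse sigma).
Variable u : config X -> X -> R.
Hypotheses (u_measurable : measurable_fun setT (fun z : config X * X => u z.1 z.2))
  (u_cyclic : forall k, (2 <= k)%N -> cyclic_condition P sigma u k).
Local Open Scope ereal_scope.

(** What an isometry provides: integrals against sigma that do not depend on
    the configuration. *)
Definition deterministic_parts (mp mn : R) (cp cn : nat -> R) : Prop := forall w,
  [/\ \int[sigma]_x ((u w)^\+ x)%:E = mp%:E, \int[sigma]_x ((u w)^\- x)%:E = mn%:E,
      forall a, \int[sigma]_x (1 - expR (- (a%:R * (u w)^\+ x)))%:E = (cp a)%:E &
      forall a, \int[sigma]_x (1 - expR (- (a%:R * (u w)^\- x)))%:E = (cn a)%:E].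

Variables (mp mn : R) (cp cn : nat -> R).
Hypothesis u_parts : deterministic_parts mp mn cp cn.

Let up w x := (u w)^\+%R x.
Let un w x := (u w)^\-%R x.

Let mup : measurable_fun setT (fun z : config X * X => up z.1 z.2).
Proof. exact: (measurable_funrpos u_measurable). Qed.

Let mun : measurable_fun setT (fun z : config X * X => un z.1 z.2).
Proof. exact: (measurable_funrneg u_measurable). Qed.

Let up0 w x : (0 <= up w x)%R. Proof. exact: funrpos_ge0. Qed.
Let un0 w x : (0 <= un w x)%R. Proof. exact: funrneg_ge0. Qed.

Let mup1 w : measurable_fun setT (up w).
Proof. exact: (measurableT_comp mup (pair1_measurable w)). Qed.

Let mun1 w : measurable_fun setT (un w).
Proof. exact: (measurableT_comp mun (pair1_measurable w)). Qed.

Definition pos_sum w : R := fine (reduced_sum up w).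
Definition neg_sum w : R := fine (reduced_sum un w).

Lemma pos_sum_ge0 w : (0 <= pos_sum w)%R.
Proof. by apply: fine_ge0; apply: integral_ge0 => x _; rewrite lee_fin. Qed.

Lemma neg_sum_ge0 w : (0 <= neg_sum w)%R.
Proof. by apply: fine_ge0; apply: integral_ge0 => x _; rewrite lee_fin. Qed.

Lemma measurable_pos_sum : measurable_fun setT pos_sum.
Proof. by apply: measurableT_comp => //; exact: measurable_reduced_sum. Qed.

Lemma measurable_neg_sum : measurable_fun setT neg_sum.
Proof. by apply: measurableT_comp => //; exact: measurable_reduced_sum. Qed.

Let mrm w (f : config X -> X -> R) : measurable_fun setT (fun z : config X * X => f z.1 z.2) ->
  measurable_fun setT (fun t => f (rmpt w t) t).
Proof.
move=> mf; apply: (measurableT_comp mf (g := fun t => (rmpt w t, t))).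
apply: measurable_fun_pair => //.
exact: (measurable_rmpt X_sigma_compact (f := cst w) (g := id)).
Qed.

Let parts_fin : {ae P, forall w, reduced_sum up w < +oo /\ reduced_sum un w < +oo}.
Proof.
have Hp w : \int[sigma]_x (up w x)%:E = mp%:E by have [] := u_parts w.
have Hn w : \int[sigma]_x (un w x)%:E = mn%:E by have [] := u_parts w.
have Fp := reduced_sum_fin X_sigma_compact P_poisson mup up0 Hp.
have Fn := reduced_sum_fin X_sigma_compact P_poisson mun un0 Hn.
by apply: filterS2 Fp Fn => w fp fn; split.
Qed.

(** The process a * u^+ + b * u^- inherits the cyclic condition from u; since
    u^+ and u^- are never both nonzero, the integral of 1 - exp(- v) splits
    into two parts. *)
Lemma joint_laplace (a b : nat) :
  \int[P]_w (expR (- (a%:R * pos_sum w + b%:R * neg_sum w)))%:E = (expR (- (cp a + cn b)))%:E.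
Proof.
pose v w x : R := (a%:R * up w x + b%:R * un w x)%R.
have mv : measurable_fun setT (fun z : config X * X => v z.1 z.2).
  by apply: measurable_funD; exact: measurable_funM.
have v0 w x : (0 <= v w x)%R by rewrite addr_ge0// mulr_ge0.
have v_cyclic k : (2 <= k)%N -> cyclic_condition P sigma v k.
  move=> k2; apply: filterS (u_cyclic k2) => z /eqP; rewrite prodf_seq_eq0 => /hasP[i _ /=].
  rewrite /diffop subr_eq0 => /eqP Hi; rewrite (bigD1 i)//= /diffop.
  rewrite [X in (X * _)%R](_ : _ = 0%R) ?mul0r//; apply/eqP; rewrite subr_eq0; apply/eqP.
  by rewrite /v /up /un /funrpos /funrneg Hi.
have v_int w : \int[sigma]_x (v w x)%:E = (a%:R * mp + b%:R * mn)%:E.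
  have [Hp Hn _ _] := u_parts w.
  under eq_integral do rewrite EFinD !EFinM.
  rewrite ge0_integralD//; first last.
  - by apply: measurable_funeM; exact/measurable_EFinP.
  - by move=> x _; rewrite -EFinM lee_fin mulr_ge0.
  - by apply: measurable_funeM; exact/measurable_EFinP.
  - by move=> x _; rewrite -EFinM lee_fin mulr_ge0.
  rewrite !ge0_integralZl// ?Hp ?Hn//; try exact/measurable_EFinP;
    by move=> x _; rewrite lee_fin.
have v_exp w : \int[sigma]_x (1 - expR (- v w x))%:E = (cp a + cn b)%:E.
  have [_ _ Hp Hn] := u_parts w.
  rewrite EFinD -Hp -Hn -ge0_integralD//; first last.
  - apply/measurable_EFinP; apply: measurable_funB => //; apply: measurableT_comp => //.
    by apply: measurableT_comp => //; apply: measurable_funM => //; exact: mun1.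
  - by move=> x _; rewrite lee_fin subr_ge0 -expR0 ler_expR oppr_le0 mulr_ge0// funrneg_ge0.
  - apply/measurable_EFinP; apply: measurable_funB => //; apply: measurableT_comp => //.
    by apply: measurableT_comp => //; apply: measurable_funM => //; exact: mup1.
  - by move=> x _; rewrite lee_fin subr_ge0 -expR0 ler_expR oppr_le0 mulr_ge0// funrpos_ge0.
  apply: eq_integral => x _; rewrite -EFinD; congr EFin; rewrite /v /up /un /funrpos /funrneg.
  have [ux|ux] := leP 0%R (u w x).
    rewrite (max_r (x := (- u w x)%R)) ?oppr_le0//.
    by rewrite !mulr0 addr0 oppr0 expR0 subrr addr0.
  rewrite (max_l (x := (- u w x)%R)) ?oppr_ge0 ?(ltW ux)//.
  by rewrite !mulr0 add0r oppr0 expR0 subrr add0r.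
rewrite -(laplace_functional X_sigma_compact P_poisson sigma_diffuse mv v0 v_cyclic v_int v_exp).
apply: ae_eq_integral => //.
- apply/measurable_EFinP; apply: measurableT_comp => //; apply: measurableT_comp => //.
  apply: measurable_funD; apply: measurable_funM => //.
    exact: measurable_pos_sum.
  exact: measurable_neg_sum.
- apply/measurable_EFinP; apply: measurableT_comp => //; apply: measurableT_comp => //.
  by apply: measurableT_comp => //; exact: measurable_reduced_sum.
apply: filterS parts_fin => w [fp fn] _; congr (expR (- _))%:E.
have -> : reduced_sum v w = a%:R%:E * reduced_sum up w + b%:R%:E * reduced_sum un w.
  rewrite /reduced_sum -!ge0_integralZl//; first last.
  - by move=> x _; rewrite lee_fin.
  - by apply/measurable_EFinP; exact: mrm.
  - by move=> x _; rewrite lee_fin.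
  - by apply/measurable_EFinP; exact: mrm.
  rewrite -ge0_integralD//; first last.
  - by apply: measurable_funeM; apply/measurable_EFinP; exact: mrm.
  - by move=> x _; rewrite -EFinM lee_fin mulr_ge0.
  - by apply: measurable_funeM; apply/measurable_EFinP; exact: mrm.
  - by move=> x _; rewrite -EFinM lee_fin mulr_ge0.
have p0 : 0 <= reduced_sum up w by apply: reduced_sum_ge0.
have n0 : 0 <= reduced_sum un w by apply: reduced_sum_ge0.
have fpn : reduced_sum up w \is a fin_num by rewrite ge0_fin_numE.
have fnn : reduced_sum un w \is a fin_num by rewrite ge0_fin_numE.
by rewrite fineD ?fin_numM// !fineM.
Qed.

Let rintegralE d' (T : measurableType d') (m : {measure set T -> \bar R}) (f : T -> R) :
  (\int[m]_x f x)%R = fine (\int[m]_x (f^\+ x)%:E - \int[m]_x (f^\- x)%:E).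
Proof.
rewrite /Rintegral integralE; congr (fine (_ - _)); apply: eq_integral => x _.
  exact: (congr1 (@^~ x) (funerpos f)).
exact: (congr1 (@^~ x) (funerneg f)).
Qed.

(** This holds at every w, even where a sum is infinite, as the real-valued
    integral is by definition the finite part of a difference; measurability
    follows from it. *)
Lemma skorohodE w : skorohod sigma u w =
  (fine (reduced_sum up w - reduced_sum un w) - (mp - mn))%R.
Proof.
rewrite /skorohod !rintegralE; congr (_ - _)%R.
have [Hp Hn _ _] := u_parts w.
suff null (f : config X -> X -> R) : measurable_fun setT (fun z : config X * X => f z.1 z.2) ->
    \int[sigma]_x (f (rmpt w x) x)%:E = \int[sigma]_x (f w x)%:E.
  by rewrite (null up mup) (null un mun) Hp Hn.
move=> mf; apply: ae_eq_integral => //.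
- by apply/measurable_EFinP; exact: mrm.
- by apply/measurable_EFinP; exact: (measurableT_comp mf (pair1_measurable w)).
exists (points w); split; [exact: measurable_points|exact: points_null|].
by move=> x /= H; apply: contrapT => wx; apply: H => _; rewrite rmpt_id.
Qed.

Lemma measurable_skorohod : measurable_fun setT (skorohod sigma u).
Proof.
rewrite (_ : skorohod sigma u = fun w =>
  (fine (reduced_sum up w - reduced_sum un w) - (mp - mn))%R); last first.
  by apply/funext => w; exact: skorohodE.
apply: measurable_funB => //; apply: measurableT_comp => //.
by apply: emeasurable_funB; exact: measurable_reduced_sum.
Qed.

Lemma skorohod_ae : {ae P, forall w,
  skorohod sigma u w = (pos_sum w - neg_sum w - (mp - mn))%R}.
Proof.
apply: filterS parts_fin => w [fp fn]; rewrite skorohodE fineB// ge0_fin_numE//.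
  by apply: reduced_sum_ge0.
by apply: reduced_sum_ge0.
Qed.

End skorohod_law.

(** * Equality of the laws *)

Section same_law_skorohod.
Context (R : realType) d1 d2 (X : borelMetricType d1 R) (Y : borelMetricType d2 R).
Hypotheses (X_sigma_compact : sigma_compact X) (Y_sigma_compact : sigma_compact Y).
Variables (sigma : {sigma_finite_measure set X -> \bar R})
  (mu : {sigma_finite_measure set Y -> \bar R})
  (P : probability (config X) R) (Q : probability (config Y) R).
Hypotheses (P_poisson : is_poisson_measure sigma P) (Q_poisson : is_poisson_measure mu Q)
  (sigma_diffuse : diffuse sigma) (mu_diffuse : diffuse mu).
Variables (u : config X -> X -> R) (v : config Y -> Y -> R).
Hypotheses (u_measurable : measurable_fun setT (fun z : config X * X => u z.1 z.2))
  (v_measurable : measurable_fun setT (fun z : config Y * Y => v z.1 z.2))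
  (u_cyclic : forall k, (2 <= k)%N -> cyclic_condition P sigma u k)
  (v_cyclic : forall k, (2 <= k)%N -> cyclic_condition Q mu v k).
Variables (mp mn : R) (cp cn : nat -> R).
Hypotheses (u_parts : deterministic_parts sigma u mp mn cp cn)
  (v_parts : deterministic_parts mu v mp mn cp cn).

Let ae_preimage d (T : measurableType d) (m : {measure set T -> \bar R}) (f g : T -> R) B :
  measurable_fun setT f -> measurable_fun setT g -> measurable B ->
  {ae m, forall t, f t = g t} -> m (f @^-1` B) = m (g @^-1` B).
Proof.
move=> mf mg mB fg.
have pre (k : T -> R) : measurable_fun setT k -> measurable (k @^-1` B).
  by move=> mk; rewrite -[_ @^-1` _]setTI; exact: mk.
rewrite -[f @^-1` B]setIT -[g @^-1` B]setIT -!integral_indic//; try exact: pre.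
apply: ae_eq_integral => //; try by apply/measurable_EFinP; apply: measurable_indic; exact: pre.
by apply: filterS fg => t E _; rewrite !indicE; congr ((nat_of_bool _)%:R%:E);
  apply/idP/idP; rewrite !inE /= E.
Qed.

(** Outside a null set a Skorohod integral is the difference of its two sums,
    minus a constant common to both sides, and the joint law of the two sums
    is determined by integrals that are common too. *)
Lemma same_law_skorohod : same_law P Q (skorohod sigma u) (skorohod mu v).
Proof.
have mF := measurable_skorohod X_sigma_compact sigma_diffuse u_measurable u_parts.
have mG := measurable_skorohod Y_sigma_compact mu_diffuse v_measurable v_parts.
split => // B mB; rewrite /pushforward.
have mdiff : measurable_fun setT (fun z : R * R => z.1 - z.2 - (mp - mn)).
  by apply: measurable_funB => //; apply: measurable_funB.
have mpu := measurable_pos_sum X_sigma_compact u_measurable.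
have mnu := measurable_neg_sum X_sigma_compact u_measurable.
have mpv := measurable_pos_sum Y_sigma_compact v_measurable.
have mnv := measurable_neg_sum Y_sigma_compact v_measurable.
rewrite (ae_preimage (g := fun w => pos_sum u w - neg_sum u w - (mp - mn)) mF _ mB); last 2 first.
- by apply: measurable_funB => //; exact: measurable_funB.
- exact: skorohod_ae.
rewrite [RHS](ae_preimage (g := fun w => pos_sum v w - neg_sum v w - (mp - mn)) mG _ mB); last 2 first.
- by apply: measurable_funB => //; exact: measurable_funB.
- exact: skorohod_ae.
have mD : measurable ((fun z : R * R => z.1 - z.2 - (mp - mn)) @^-1` B).
  by rewrite -[_ @^-1` _]setTI; exact: mdiff.
apply: (laplace_joint_law mpu mnu mpv mnv _ _ _ _ _ mD).
- exact: pos_sum_ge0.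
- exact: neg_sum_ge0.
- exact: pos_sum_ge0.
- exact: neg_sum_ge0.
move=> a b.
rewrite (joint_laplace X_sigma_compact P_poisson sigma_diffuse u_measurable u_cyclic u_parts).
by rewrite (joint_laplace Y_sigma_compact Q_poisson mu_diffuse v_measurable v_cyclic v_parts).
Qed.

End same_law_skorohod.

Theorem corollary3p2 (R : realType) (dX dY : measure_display)
  (X : borelMetricType dX R) (Y : borelMetricType dY R)
  (X_sigma_compact : sigma_compact X) (Y_sigma_compact : sigma_compact Y)
  (sigma : {sigma_finite_measure set X -> \bar R})
  (mu : {sigma_finite_measure set Y -> \bar R})
  (sigma_diffuse : diffuse sigma) (mu_diffuse : diffuse mu)
  (pi_sigma : probability (config X) R) (pi_mu : probability (config Y) R)
  (pi_sigma_poisson : is_poisson_measure sigma pi_sigma)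
  (pi_mu_poisson : is_poisson_measure mu pi_mu)
  (U : config X -> (Y -> R) -> X -> R)
  (U_isometry : forall p : \bar R, (1 <= p)%E -> random_isometry mu sigma p U)
  (U_positive : forall p : \bar R, (1 <= p)%E ->
     forall w, positive_operator mu sigma p (U w))
  (h : Y -> R)
  (h_Lp : forall n : nat, (1 <= n)%N -> h \in Lfun mu n%:R%:E)
  (h_sup : (ereal_sup [set 'N[mu]_(n%:R%:E)[EFin \o h] | n in [set n : nat | (1 <= n)%N]]
              < +oo)%E)
  (Uh_measurable : measurable_fun [set: config X * X]
     (fun z : config X * X => U z.1 h z.2))
  (Uh_integrable : forall (a : nat) (l : 'I_a.+1 -> nat),
     (forall i, (1 <= l i)%N) ->
     (\int[pi_sigma]_w \int[power_measure sigma a.+1]_s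
        `|Delta ord_max (fun p w' t => U w' h t ^+ l p) s w|%:E < +oo)%E)
  (Uh_cyclic : forall k : nat, (2 <= k)%N ->
     cyclic_condition pi_sigma sigma (fun w t => U w h t) k) :
  same_law pi_sigma pi_mu (skorohod sigma (fun w t => U w h t))
    (compensated_integral mu h).
Proof.
have mh : measurable_fun setT h := Lfun_measurable (h_Lp 1%N isT).
have [M M0 hM] := moment_bound h_sup.
have mhp := measurable_funrpos mh; have mhn := measurable_funrneg mh.
have hp0 := funrpos_ge0 h; have hn0 := funrneg_ge0 h.
have part_le (f : Y -> R) k : measurable_fun setT f -> (forall y, 0 <= f y <= `|h y|) ->
    (1 <= k)%N -> (\int[mu]_y (f y ^+ k)%:E <= (M ^+ k)%:E)%E.
  move=> mf fh k1; apply: le_trans (hM k k1); apply: ge0_le_integral => //.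
  - by move=> y _; have /andP[f0 _] := fh y; rewrite lee_fin exprn_ge0.
  - by apply/measurable_EFinP; exact: measurable_funX.
  - by apply/measurable_EFinP; apply: measurable_funX; exact: measurableT_comp.
  - move=> y _; have /andP[f0 f1] := fh y.
    by rewrite lee_fin lerXn2r// nnegrE.
have hp_le y : 0 <= h^\+ y <= `|h y| by rewrite hp0 /funrpos ge_max ler_norm normr_ge0.
have hn_le y : 0 <= h^\- y <= `|h y|.
  by rewrite hn0 /funrneg ge_max normr_ge0 -normrN ler_norm.
have fin1 (f : Y -> R) : measurable_fun setT f -> (forall y, 0 <= f y <= `|h y|) ->
    (\int[mu]_y (f y)%:E)%E \is a fin_num.
  move=> mf fh; rewrite ge0_fin_numE; last first.
    by apply: integral_ge0 => y _; have /andP[f0 _] := fh y; rewrite lee_fin.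
  exact: le_lt_trans (part_le f 1%N mf fh isT) (ltry _).
have fine_ (f : Y -> R) (a : nat) : measurable_fun setT f -> (forall y, 0 <= f y <= `|h y|) ->
    (\int[mu]_y (1 - expR (- (a%:R * f y)))%:E)%E \is a fin_num.
  move=> mf fh; have f0 y : 0 <= f y by have /andP[] := fh y.
  rewrite ge0_fin_numE; last first.
    by apply: integral_ge0 => y _; rewrite lee_fin subr_ge0 -expR0 ler_expR oppr_le0 mulr_ge0.
  apply: (@le_lt_trans _ _ (\int[mu]_y (a%:R%:E * (f y)%:E))%E).
    apply: ge0_le_integral => //.
    - by move=> y _; rewrite lee_fin subr_ge0 -expR0 ler_expR oppr_le0 mulr_ge0.
    - apply/measurable_EFinP; apply: measurable_funB => //; apply: measurableT_comp => //.
      by apply: measurableT_comp => //; exact: measurable_funM.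
    - by apply: measurable_funeM; exact/measurable_EFinP.
    - move=> y _; rewrite -EFinM lee_fin lerBlDr -lerBlDl.
      by have := expR_ge1Dx (- (a%:R * f y)).
  rewrite ge0_integralZl//; [|exact/measurable_EFinP|by move=> y _; rewrite lee_fin].
  have := fin1 f mf fh; rewrite ge0_fin_numE => [If|]; last first.
    by apply: integral_ge0 => y _; rewrite lee_fin.
  by rewrite lte_mul_pinfty.
have parts_Y : deterministic_parts mu (fun=> h)
    (fine (\int[mu]_y (h^\+ y)%:E)%E) (fine (\int[mu]_y (h^\- y)%:E)%E)
    (fun a => fine (\int[mu]_y (1 - expR (- (a%:R * h^\+ y)))%:E)%E)
    (fun a => fine (\int[mu]_y (1 - expR (- (a%:R * h^\- y)))%:E)%E).
  move=> w; split.
  - by rewrite fineK// fin1.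
  - by rewrite fineK// fin1.
  - by move=> a; rewrite fineK// fine_.
  - by move=> a; rewrite fineK// fine_.
have parts_X : deterministic_parts sigma (fun w t => U w h t)
    (fine (\int[mu]_y (h^\+ y)%:E)%E) (fine (\int[mu]_y (h^\- y)%:E)%E)
    (fun a => fine (\int[mu]_y (1 - expR (- (a%:R * h^\+ y)))%:E)%E)
    (fun a => fine (\int[mu]_y (1 - expR (- (a%:R * h^\- y)))%:E)%E).
  move=> w; have [<- <- cp cn] := parts_Y point.
  have iso p (p1 : (1 <= p)%E) : Lp_isometry mu sigma p (U w) by exact: U_isometry.
  have pos p (p1 : (1 <= p)%E) : positive_operator mu sigma p (U w) by exact: U_positive.
  have mUw : measurable_fun setT (U w h) := measurableT_comp Uh_measurable (pair1_measurable w).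
  have Hp := isometry_pos_moment iso pos h_Lp.
  have Hn := isometry_neg_moment iso pos h_Lp.
  split.
  - exact: (Hp 1%N isT).
  - exact: (Hn 1%N isT).
  - move=> a; rewrite -cp; apply: (exp_moments (M := M)) => //.
    + exact: measurable_funrpos.
    + by move=> k k1; exact: part_le.
  - move=> a; rewrite -cn; apply: (exp_moments (M := M)) => //.
    + exact: measurable_funrneg.
    + by move=> k k1; exact: part_le.
have cyclic_Y k : (2 <= k)%N -> cyclic_condition pi_mu mu (fun=> h) k.
  case: k => // k _; apply: aeW => z.
  by rewrite big_ord_recl /= /diffop subrr mul0r.
have mY : measurable_fun setT (fun z : config Y * Y => h z.2) by exact: measurableT_comp.
(* compensated_integral mu h is the Skorohod integral of a deterministic process *)
exact: (same_law_skorohod X_sigma_compact Y_sigma_compact pi_sigma_poisson pi_mu_poisson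
  sigma_diffuse mu_diffuse Uh_measurable mY Uh_cyclic cyclic_Y parts_X parts_Y).
Qed.
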